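(* Let $Q(x,y)=a_1x^2+b_1xy+c_1y^2$ be a positive definite binary quadratic form with $a_1,b_1,c_1\in\mathbb{Z}$, and put $\Delta=4a_1c_1-b_1^2>0$. Let $q\in\mathbb{N}$ and $a\in\mathbb{Z}$ with $\gcd(2\Delta a,q)=1$. Let $\varepsilon>0$ and let $\beta$ satisfy $2/5+3\varepsilon\le\beta<1$. Set $L:=q^{\beta}$ and $X:=Lq=q^{1+\beta}$. Let $w:\mathbb{R}\to\mathbb{R}_{\ge0}$ be a smooth function with compact support in $[X,2X]$, with $w(x)=1$ for $x\in[5X/4,7X/4]$, and such that for every integer $j\ge1$ its $j$-th derivative satisfies $w^{(j)}(x)\ll_j X^{-j}$. Define $$S:=\sum_{\substack{b\in\mathbb{Z},\ |b|\le L\\ \gcd(b,q)=1}}\ \sum_{\substack{n\in\mathbb{Z}\\ na\equiv b \ (\mathrm{mod}\ q)}} r_Q(n)\,w(n).$$ Then, as $q\to\infty$, $$S=\frac{4\pi\,\varphi(q)\,L}{\Delta^{1/2}q^2}\prod_{\substack{p\mid q\\ p\ \text{prime}}}\left(1-\frac{G_Q(p,1)}{p^2}\right)\int_0^\infty w(x)\,dx\cdot(1+o(1)).$$ Moreover, $S$ satisfies $$\frac{q^{2\beta}}{(\log\log q)^2}\ll S\ll q^{2\beta}.$$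
   Context: $r_Q(n)$ denotes the number of pairs $(x,y)\in\mathbb{Z}^2$ with $Q(x,y)=n$. For $m\in\mathbb{N}$ and $h\in\mathbb{Z}$, $G_Q(m,h):=\sum_{x,y \bmod m} e\!\left(\frac{hQ(x,y)}{m}\right)$, where $e(t)=e^{2\pi i t}$. $\varphi$ is Euler's totient function. Implied constants may depend on $Q$, $\varepsilon$, $\beta$ and the implied constants in the derivative bounds for $w$, but not on $q$, $a$ or $w$ otherwise. *)

(* Defs.v *)
From HB Require Import structures.
From mathcomp Require Export all_boot all_order all_algebra.
From mathcomp Require Export all_classical all_reals all_analysis.
From mathcomp Require Export finmap complex.


Export Order.TTheory GRing.Theory Num.Theory.
Export numFieldNormedType.Exports.

#[export] Set Implicit Arguments.
#[export] Unset Strict Implicit.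
#[export] Unset Printing Implicit Defensive.

Global Open Scope classical_set_scope.
Global Open Scope ring_scope.
Global Open Scope complex_scope.

Definition bqf (a1 b1 c1 x y : int) : int :=
  a1 * x ^+ 2 + b1 * x * y + c1 * y ^+ 2.

Definition bqfR (R : realType) (a1 b1 c1 : int) (x y : R) : R :=
  a1%:~R * x ^+ 2 + b1%:~R * x * y + c1%:~R * y ^+ 2.

Definition bqf_posdef (R : realType) (a1 b1 c1 : int) : Prop :=
  forall x y : R, (x, y) != (0, 0) -> 0 < bqfR a1 b1 c1 x y.

(* The opposite of the usual discriminant. *)
Definition bqf_Delta (a1 b1 c1 : int) : int := 4 * a1 * c1 - b1 ^+ 2.

(* [fset_set] is empty on infinite sets; for positive definite forms the set
   is finite. *)
Definition rQ (a1 b1 c1 n : int) : nat :=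
  #|` fset_set [set xy : int * int | bqf a1 b1 c1 xy.1 xy.2 = n] |%fset.

Definition e2pi (R : realType) (t : R) : R[i] :=
  cos (2 * pi * t) +i* sin (2 * pi * t).

Definition GQ (R : realType) (a1 b1 c1 : int) (m : nat) (h : int) : R[i] :=
  \sum_(x < m) \sum_(y < m)
    e2pi ((h * bqf a1 b1 c1 (x : nat)%:Z (y : nat)%:Z)%:~R / m%:R : R).

Definition smooth (R : realType) (w : R -> R) : Prop :=
  forall (j : nat) (x : R), derivable (derive1n j w) x 1.

(* [C] is the sequence of implied constants in w^(j)(x) <<_j X^-j. *)
Definition weight (R : realType) (X : R) (C : nat -> R) (w : R -> R) : Prop :=
  [/\ forall x, 0 <= w x,
      smooth w,
      closure [set x | w x != 0] `<=` `[X, 2 * X],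
      forall x, 5 * X / 4 <= x <= 7 * X / 4 -> w x = 1
    & forall j : nat, (1 <= j)%N -> forall x, `|derive1n j w x| <= C j * X ^- j].

Definition Lq (R : realType) (beta : R) (q : nat) : R := q%:R `^ beta.

Definition Xq (R : realType) (beta : R) (q : nat) : R := Lq beta q * q%:R.

(* The finitely supported sums over sets are 0 by convention when the support
   is infinite; the inner one has finite support as soon as w vanishes outside
   a bounded set. *)
Definition SQ (R : realType) (a1 b1 c1 : int) (beta : R) (q : nat) (a : int)
    (w : R -> R) : R :=
  \sum_(b \in [set b : int | `|b|%:~R <= Lq beta q /\ coprimez b q%:Z])
    \sum_(n \in [set n : int | (n * a = b %[mod q%:Z])%Z])
      (rQ a1 b1 c1 n)%:R * w n%:~R.

Definition main_term (R : realType) (a1 b1 c1 : int) (beta : R) (q : nat)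
    (w : R -> R) : R[i] :=
  (4 * pi * (totient q)%:R * Lq beta q
    / (Num.sqrt (bqf_Delta a1 b1 c1)%:~R * q%:R ^+ 2))%:C
  * (\prod_(p <- primes q) (1 - GQ R a1 b1 c1 p 1 / p%:R ^+ 2))
  * (\int[lebesgue_measure]_(x in `[0, +oo[) w x)%:C.

(* Main.v *)
(** Opening the form gives [S] as a sum over lattice points [(x, y)] of [w (Q x y)] times the
    number of [b] with [|b| <= L], [b = a Q(x, y) mod q], restricted to [Q(x, y)] prime to [q].
    Inclusion-exclusion over the primes dividing [q] removes the coprimality condition at the cost
    of [d | Q(x, y)].

    For small [d] one splits [(x, y)] into classes modulo [d]. On each class the number of [b] is
    expanded in additive characters modulo [q]; the nonzero frequencies are bounded by Weyl
    differencing the quadratic exponential sum over a box of side [K ~ X^(1/2)], which after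
    summation over the frequencies against the kernel of [|b| <= L] costs only [(K + L) q^o(1)]
    because each integer has few factorisations. As [K = q^((1 + beta) / 2)] is a power of [q]
    smaller than [L^2 = q^(2 beta)], no Gauss sum evaluation, Poisson summation or Weil bound is
    needed. The zero frequency is a weighted lattice point count in an ellipse.

    For large [d] one has [d | b] as well, so the trivial bound saves a factor [d].

    The resulting density is the product of [1 - rho p / p^2], where [rho p] is the number of zeros
    of [Q] modulo [p]; it equals [(1 - G_Q(p, 1) / p^2) (1 - 1 / p)] and is at least
    [(1 - 1 / p)^2], so Mertens' theorem gives the [(log log q)^2] in the lower bound. *)

Require Import Defs.
From mathcomp Require Import ring lra zify.
Import Normc.

(** * Divisors and representations *)

(** The main term can be as small as [q ^ (2 beta) / (log log q) ^ 2], so a fixed power of [q] must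
    be saved, uniformly in [a] and [w]. One small exponent [s] measures all losses, and small and
    large [d] are separated at [D = q ^ (10 s)]. A small [d] pays [D ^ 2] three times: for the
    number of classes, for the variation of the weight along a class of step [d], and for the length
    of the range of dual frequencies. With divisor bounds and logarithms this adds [64 s] to
    [(beta + 1) / 2]. The target [2 beta - 5 s] asks for [69 s <= (3 beta - 1) / 2]; the right side
    is at least [1 / 10] when [beta >= 2 / 5], so [s <= 1 / 1000] is safe. A large [d] gains [10 s],
    and loses [2 s] to the multiplicity of representations and [s] to the number of terms of the
    sieve. The weight is removed by Abel summation in both variables: a box of side about
    [X ^ (1/2)] has about [X] cells, and the mixed second difference of [w (Q x y)] is
    [O(d ^ 2 / X)], so the total variation stays bounded in [X]. *)

Lemma size_divisors_primeX_mul (p e m : nat) : prime p -> (0 < m)%N -> ~~ (p %| m)%N ->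
  (size (divisors (p ^ e * m)) <= e.+1 * size (divisors m))%N.
Proof.
move=> pp m0 pm.
have n0 : (0 < p ^ e * m)%N by rewrite muln_gt0 expn_gt0 prime_gt0.
pose t := [seq (p ^ i * d)%N | i <- iota 0 e.+1, d <- divisors m].
have -> : (e.+1 * size (divisors m) = size t)%N.
  by rewrite size_allpairs size_iota.
apply: uniq_leq_size; first exact: divisors_uniq.
move=> x; rewrite -dvdn_divisors // => xn.
have x0 : (0 < x)%N by apply: dvdn_gt0 xn.
have [y py xE] := pfactor_coprime pp x0.
apply/allpairsP; exists (logn p x, y); split; last by rewrite mulnC.
- rewrite mem_iota add0n /= ltnS.
  have := dvdn_leq_log p n0 xn.
  rewrite lognM ?expn_gt0 ?(prime_gt0 pp)//.
  rewrite pfactorK// (@logn_coprime _ m) ?prime_coprime// addn0. by [].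
- rewrite -dvdn_divisors //.
  have yn : (y %| p ^ e * m)%N by apply: dvdn_trans xn; rewrite [X in (_ %| X)%N]xE dvdn_mulr.
  by move: yn; rewrite Gauss_dvdr// coprimeXr// coprime_sym.
Qed.

(** The quotient of both sides is a product over primes of [(e + 1) / p ^ (e eps)]. A factor is at
    most 1 once [p ^ eps >= 2], and at most [C0] for the boundedly many smaller primes. *)
Lemma size_divisors_bound (R : realType) (eps : R) : 0 < eps ->
  exists2 C : R, 1 <= C & forall n : nat, (0 < n)%N ->
    (size (divisors n))%:R <= C * n%:R `^ eps.
Proof.
move=> e0.
have ln2 : 0 < ln 2 :> R by apply: ln_gt0; lra.
(* This value makes [e + 1 <= C0 * (1 + e * eps * ln 2)], and the bracket is at most [2 ^ (e * eps)]
   by [1 + x <= expR x]. *)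
pose C0 : R := 1 + (eps * ln 2)^-1.
have el0 : 0 < eps * ln 2 by apply: mulr_gt0.
have C01 : 1 <= C0 by rewrite /C0 lerDl invr_ge0 ltW.
have [P0 P0P] : exists P : nat, 2 <= P%:R `^ eps.
  exists (Num.truncn (2 `^ eps^-1)).+1.
  have {1}-> : 2 = (2 `^ eps^-1) `^ eps :> R by rewrite -powRrM mulVf ?gt_eqF// powRr1.
  rewrite ge0_ler_powR ?nnegrE ?powR_ge0 ?ler0n// ?ltW//.
  exact: truncnS_gt.
have Cp (p e : nat) : prime p -> e.+1%:R <= C0 * (p ^ e)%:R `^ eps.
  move=> pp.
  have p2 : (2 : R) <= p%:R by rewrite ler_nat prime_gt1.
  have p0 : (0 : R) < p%:R by lra.
  have -> : (p ^ e)%:R `^ eps = expR (e%:R * (eps * ln p%:R)) :> R.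
    rewrite natrX /powR expf_eq0 (gt_eqF p0) andbF lnXn// -mulr_natl; congr expR.
    by ring.
  have lnp : ln 2 <= ln p%:R :> R by rewrite ler_ln ?posrE//; lra.
  apply: (@le_trans _ _ (C0 * (1 + e%:R * (eps * ln 2)))).
    rewrite /C0 mulrDl mul1r !mulrDr mulr1 -addn1 natrD.
    have -> : (eps * ln 2)^-1 * (e%:R * (eps * ln 2)) = e%:R :> R.
      by field; rewrite !gt_eqF.
    have : 0 <= e%:R * (eps * ln 2) :> R by rewrite mulr_ge0// ltW.
    have : 0 <= (eps * ln 2)^-1 :> R by rewrite invr_ge0 ltW.
    by lra.
  rewrite ler_wpM2l//; first by lra.
  apply: le_trans (expR_ge1Dx _).
  by rewrite lerD2l ler_wpM2l// ler_wpM2l// ltW.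
have CP (p e : nat) : prime p -> (P0 <= p)%N -> e.+1%:R <= (p ^ e)%:R `^ eps.
  move=> pp Pp.
  apply: (@le_trans _ _ (2 ^+ e)).
    by rewrite -natrX ler_nat ltn_expl.
  have -> : (p ^ e)%:R `^ eps = (p%:R `^ eps) ^+ e :> R.
    by rewrite natrX -powR_mulrn ?ler0n// -powRrM mulrC powRrM powR_mulrn ?powR_ge0.
  rewrite lerXn2r ?nnegrE ?powR_ge0//.
  apply: le_trans P0P _.
  by rewrite ge0_ler_powR ?nnegrE ?ler0n ?ler_nat// ltW.
have main : forall n : nat, (0 < n)%N ->
    (size (divisors n))%:R <= C0 ^+ count (fun p => (p < P0)%N) (primes n) * n%:R `^ eps.
  move=> n; elim/ltn_ind: n => n IH n0.
  have [n1|n1] := leqP n 1.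
    have -> : n = 1%N by lia.
    by rewrite /= powR1 mulr1.
  have pp := pdiv_prime n1.
  set p := pdiv n in pp.
  have pn : (p %| n)%N by apply: pdiv_dvd.
  have [m pm nE] := pfactor_coprime pp n0.
  set e := logn p n in nE.
  have e0' : (0 < e)%N by rewrite /e logn_gt0 mem_primes pp n0 pn.
  have m0 : (0 < m)%N by move: n0; rewrite {1}nE muln_gt0 => /andP[].
  have mn : (m < n)%N.
    by rewrite [X in (_ < X)%N]nE -{1}[m]muln1 ltn_mul2l m0 /= -(expn0 p) ltn_exp2l// prime_gt1.
  have npm : ~~ (p %| m)%N by rewrite -prime_coprime.
  have perm : perm_eq (primes n) (p :: primes m).
    apply: uniq_perm; first exact: primes_uniq.
      by rewrite /= primes_uniq andbT mem_primes (negbTE npm) !andbF.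
    move=> r; rewrite [primes n](_ : _ = primes (p ^ e * m)); last by rewrite mulnC -nE.
    rewrite primesM ?expn_gt0 ?(prime_gt0 pp)//.
    by rewrite primesX// primes_prime// !inE.
  have -> : count (fun p => (p < P0)%N) (primes n) =
            ((p < P0) + count (fun p => (p < P0)%N) (primes m))%N.
    by move/permP : perm => ->.
  have H1 : (size (divisors n))%:R <= e.+1%:R * (size (divisors m))%:R :> R.
    by rewrite -natrM ler_nat {1}nE mulnC size_divisors_primeX_mul.
  apply: le_trans H1 _.
  have nR : n%:R `^ eps = (p ^ e)%:R `^ eps * m%:R `^ eps :> R.
    by rewrite {1}nE natrM powRM ?ler0n// mulrC.
  rewrite nR exprD.
  have -> (x y z t : R) : x * y * (z * t) = (x * z) * (y * t) by ring.
  apply: ler_pM => //; last exact: IH.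
  case: (ltnP p P0) => H /=; first by rewrite expr1; apply: Cp.
  by rewrite expr0 mul1r; apply: CP.
exists (C0 ^+ P0); first by rewrite exprn_ege1.
move=> n n0; apply: le_trans (main n n0) _.
rewrite ler_wpM2r ?powR_ge0// ler_weXn2l//.
rewrite -size_filter -[X in (_ <= X)%N](size_iota 0).
apply: uniq_leq_size; first by rewrite filter_uniq// primes_uniq.
by move=> x; rewrite mem_filter mem_iota => /andP[].
Qed.

Lemma size_le_fibers (T U : eqType) (f : T -> U) (s : seq T) (t : seq U) (B : nat) :
  (forall x, x \in s -> f x \in t) ->
  (forall y, y \in t -> (size [seq x <- s | f x == y] <= B)%N) ->
  (size s <= size t * B)%N.
Proof.
elim: t s => [|y t IH] s ft fB.
  by case: s ft fB => // x s /(_ x); rewrite mem_head => /(_ isT).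
rewrite /= mulSn -(count_predC (fun x => f x == y) s) -!size_filter leq_add//.
  by apply: fB; rewrite mem_head.
apply: IH => [x|z zt].
  rewrite mem_filter /= => /andP[fxy xs].
  by have := ft x xs; rewrite inE (negbTE fxy).
rewrite -filter_predI; apply: leq_trans (fB z _); last by rewrite inE zt orbT.
by rewrite !size_filter; apply: sub_count => x /= /andP[].
Qed.

(** Fix one representation [(u0, v0)] and sort the others by the divisor [gcd (x v0 - u0 y, m)] of
    [m]; this plays the role of the ideal attached to a representation in the ring of the norm form.
    Within one fibre, with base point [(u1, v1)], the product with the conjugate of the base point
    has second coordinate [x v1 - u1 y], and [m] divides [4 D] times it. The norm identity leaves
    [8 D + 1] values for the quotient and a sign for the first coordinate. *)
Lemma size_primitive_representations (D m : nat) (s : seq (int * int)) :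
  (0 < D)%N -> (0 < m)%N -> uniq s ->
  (forall x, x \in s -> x.1 ^+ 2 + D%:Z * x.2 ^+ 2 = m%:Z /\ coprimez x.1 x.2) ->
  (size s <= size (divisors m) * (2 * (8 * D).+1))%N.
Proof.
move=> D0 m0 us hs.
have D4 : 4 * D%:Z != 0 by lia.
have cop u v : u ^+ 2 + D%:Z * v ^+ 2 = m%:Z -> coprimez u v -> coprimez v m%:Z.
  move=> <- cuv; rewrite /coprimez.
  have -> : u ^+ 2 + D%:Z * v ^+ 2 = (D%:Z * v) * v + u ^+ 2 by ring.
  rewrite gcdzMDl -/(coprimez _ _) expr2 coprimezMr.
  by rewrite [coprimez v u]coprimez_sym cuv.
case: s us hs => [//|[u0 v0] s0]; set s := _ :: s0 => us hs.
have [e0 c0] := hs (u0, v0) (mem_head _ _); rewrite /= in e0 c0.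
have cv0 := cop _ _ e0 c0.
pose g (x : int * int) : int := gcdz (x.1 * v0 - u0 * x.2) m%:Z.
apply: (@size_le_fibers _ _ (fun x => `|g x|%N)) => [x xs|g1 _].
  rewrite -dvdn_divisors// /g /gcdz absz_nat /=; exact: dvdn_gcdr.
set s1 := [seq x <- s | _].
have us1 : uniq s1 by rewrite filter_uniq.
(* The cofactor [m2 = m / g] divides the other factor because [(x v0 - u0 y) (x v0 + u0 y) = m (v0 ^
   2 - y ^ 2)]. *)
have fact x : x \in s1 -> exists m2 : int, [/\ m%:Z = g1%:Z * m2,
    (g1%:Z %| x.1 * v0 - u0 * x.2)%Z, (m2 %| x.1 * v0 + u0 * x.2)%Z,
    (x.1 ^+ 2 + D%:Z * x.2 ^+ 2 = m%:Z) & coprimez x.2 m%:Z].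
  rewrite mem_filter => /andP[/eqP gx /hs [ex cx]].
  have gE : g x = g1%:Z by rewrite -gx /g /gcdz absz_nat.
  have /dvdzP[m2 m2E] : (g1%:Z %| m%:Z)%Z by rewrite -gE /g dvdz_gcdr.
  have g1n0 : g1%:Z != 0 by apply/eqP => g10; move: m2E; rewrite g10 mulr0 => [[]]; lia.
  exists m2; split => //; first by rewrite m2E mulrC.
  - by rewrite -gE /g dvdz_gcdl.
  - have [a [b ab]] := Bezoutz (x.1 * v0 - u0 * x.2) m%:Z.
    suff : (m%:Z %| g1%:Z * (x.1 * v0 + u0 * x.2))%Z.
      move=> /dvdzP[k kE]; apply/dvdzP; exists k; apply: (mulfI g1n0).
      by rewrite kE m2E; ring.
    rewrite -gE /g -ab.
    have -> : (a * (x.1 * v0 - u0 * x.2) + b * m%:Z) * (x.1 * v0 + u0 * x.2)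
       = m%:Z * (a * (v0 ^+ 2 - x.2 ^+ 2) + b * (x.1 * v0 + u0 * x.2)).
      transitivity (a * (x.1 ^+ 2 * v0 ^+ 2 - u0 ^+ 2 * x.2 ^+ 2) + b * m%:Z * (x.1 * v0 + u0 * x.2)); first by ring.
      have -> : x.1 ^+ 2 = m%:Z - D%:Z * x.2 ^+ 2 by rewrite -ex; ring.
      have -> : u0 ^+ 2 = m%:Z - D%:Z * v0 ^+ 2 by rewrite -e0; ring.
      by ring.
    exact: dvdz_mulr.
  - exact: (cop x.1).
case s1E : s1 => [//|[u1 v1] s2]; rewrite -s1E.
have [m2 [mE gP1 gR1 e1 cv1]] := fact (u1, v1) (etrans (congr1 (fun l => _ \in l) s1E) (mem_head _ _)).
rewrite /= in gP1 gR1 e1 cv1.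
have g1n0 : g1%:Z != 0 by apply/eqP => g10; move: mE; rewrite g10 mul0r => [[]]; lia.
have m2n0 : m2 != 0 by apply/eqP => g10; move: mE; rewrite g10 mulr0 => [[]]; lia.
have copdvd d v : (d %| m%:Z)%Z -> coprimez v m%:Z -> coprimez d v.
  by move=> dm cv; rewrite coprimez_sym; apply: coprimez_dvdr cv.
have gauss d v k : (d %| m%:Z)%Z -> coprimez v m%:Z -> (d %| v * k)%Z -> (d %| k)%Z.
  by move=> dm cv; rewrite (Gauss_dvdzr _ (copdvd _ _ dm cv)).
(* Both [g1] and [m2] divide [A = x v1 - u1 y], after cancelling the unit [v0], so [m] divides
   [gcd (g1, m2) * A]. That gcd divides [2 x] and [m], hence [(2 x) ^ 2 - 4 m = - 4 D y ^ 2], hence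
   [4 D]. *)
have key x : x \in s1 -> (m%:Z %| 4 * D%:Z * (x.1 * v1 - u1 * x.2))%Z.
  move=> xs; have [m3 [mE' gP gR ex cx]] := fact x xs.
  have m32 : m3 = m2 by apply: (mulfI g1n0); rewrite -mE -mE'.
  rewrite {}m32 in mE' gR.
  have gm : (g1%:Z %| m%:Z)%Z by rewrite mE dvdz_mulr.
  have mm : (m2 %| m%:Z)%Z by rewrite mE dvdz_mull.
  set A := x.1 * v1 - u1 * x.2.
  have gA : (g1%:Z %| A)%Z.
    apply: (gauss _ v0) => //.
    have -> : v0 * A = v1 * (x.1 * v0 - u0 * x.2) - x.2 * (u1 * v0 - u0 * v1) by rewrite /A; ring.
    by rewrite rpredB// dvdz_mull.
  have mA : (m2 %| A)%Z.
    apply: (gauss _ v0) => //.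
    have -> : v0 * A = v1 * (x.1 * v0 + u0 * x.2) - x.2 * (u1 * v0 + u0 * v1) by rewrite /A; ring.
    by rewrite rpredB// dvdz_mull.
  have sA : (m%:Z %| gcdz g1%:Z m2 * A)%Z.
    have [a [b <-]] := Bezoutz g1%:Z m2.
    rewrite mulrDl -!mulrA rpredD// dvdz_mull//; last by rewrite mulrC mE dvdz_mul.
    by rewrite mE dvdz_mul.
  set c := gcdz g1%:Z m2 in sA.
  have cg : (c %| g1%:Z)%Z by apply: dvdz_gcdl.
  have cm : (c %| m2)%Z by apply: dvdz_gcdr.
  have cmm : (c %| m%:Z)%Z by apply: dvdz_trans gm.
  have c2u : (c %| 2 * x.1)%Z.
    apply: (gauss _ v0) => //.
    have -> : v0 * (2 * x.1) = (x.1 * v0 - u0 * x.2) + (x.1 * v0 + u0 * x.2) by ring.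
    by apply: rpredD; [exact: dvdz_trans cg gP|exact: dvdz_trans cm gR].
  have c4D : (c %| 4 * D%:Z)%Z.
    apply: (gauss _ x.2) => //; apply: (gauss _ x.2) => //.
    have -> : x.2 * (x.2 * (4 * D%:Z)) = 4 * m%:Z - (2 * x.1) * (2 * x.1) by rewrite -ex; ring.
    by rewrite rpredB// dvdz_mull.
  have /dvdzP[k ->] := c4D.
  by rewrite -mulrA dvdz_mull.
pose code (x : int * int) := ((4 * D%:Z * (x.1 * v1 - u1 * x.2) %/ m%:Z)%Z, 0 <= x.1 * u1 + D%:Z * x.2 * v1).
pose rng := [seq (z, b) | z <- [seq i%:Z - (4 * D)%:Z | i <- iota 0 (8 * D).+1], b <- [:: true; false]].
have -> : (2 * (8 * D).+1 = size rng)%N by rewrite size_allpairs size_map size_iota mulnC.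
have mz : m%:Z != 0 by lia.
have norm x : x \in s1 -> (x.1 * u1 + D%:Z * x.2 * v1) ^+ 2 + D%:Z * (x.1 * v1 - u1 * x.2) ^+ 2 = m%:Z ^+ 2.
  move=> xs; have [m3 [_ _ _ ex _]] := fact x xs.
  transitivity ((x.1 ^+ 2 + D%:Z * x.2 ^+ 2) * (u1 ^+ 2 + D%:Z * v1 ^+ 2)); first by ring.
  by rewrite ex e1 expr2.
rewrite -(size_map code); apply: uniq_leq_size.
  rewrite map_inj_in_uniq// => x y xs ys [] cE sE.
  have AE : x.1 * v1 - u1 * x.2 = y.1 * v1 - u1 * y.2.
    have := congr1 (fun z => z * m%:Z) cE; rewrite !divzK ?key//; apply: (mulfI D4).
  have TE : x.1 * u1 + D%:Z * x.2 * v1 = y.1 * u1 + D%:Z * y.2 * v1.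
    have : (x.1 * u1 + D%:Z * x.2 * v1) ^+ 2 = (y.1 * u1 + D%:Z * y.2 * v1) ^+ 2.
      by have := norm x xs; rewrite -(norm y ys) AE => /addIr.
    have sgn (a b : int) : (0 <= a) = (0 <= b) -> a ^+ 2 = b ^+ 2 -> a = b.
      by move=> ab /eqP; rewrite eqf_sqr => /orP[/eqP//|/eqP]; clear -ab; lia.
    exact: sgn.
  have x1 : x.1 * m%:Z = y.1 * m%:Z.
    rewrite -e1.
    transitivity (u1 * (x.1 * u1 + D%:Z * x.2 * v1) + D%:Z * v1 * (x.1 * v1 - u1 * x.2)); first by ring.
    by rewrite AE TE; ring.
  have x2 : x.2 * m%:Z = y.2 * m%:Z.
    rewrite -e1.
    transitivity (v1 * (x.1 * u1 + D%:Z * x.2 * v1) - u1 * (x.1 * v1 - u1 * x.2)); first by ring.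
    by rewrite AE TE; ring.
  by apply: injective_projections; apply: (mulIf mz).
move=> _ /mapP[x xs ->].
apply/allpairsP; exists (code x); split; last by [].
  have /dvdzP[k kE] := key x xs.
  have Dz : 0 < D%:Z by lia.
  have A2 : (x.1 * v1 - u1 * x.2) ^+ 2 <= m%:Z ^+ 2.
    rewrite -(norm x xs).
    have := sqr_ge0 (x.1 * u1 + D%:Z * x.2 * v1).
    have := sqr_ge0 (x.1 * v1 - u1 * x.2).
    clear -Dz; nia.
  have A1 : `|x.1 * v1 - u1 * x.2| <= m%:Z.
    by rewrite -ler_sqr ?nnegrE// real_normK ?num_real.
  have -> : (code x).1 = k by rewrite /code -[LHS]/((_ %/ _)%Z) kE mulzK.
  have kb : `|k| <= 4 * D%:Z.
    have m0z : 0 < m%:Z by clear -m0; lia.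
    rewrite -(ler_pM2r m0z) -{1}[m%:Z]gtr0_norm// -normrM -kE normrM ger0_norm; last by clear; lia.
    by rewrite ler_wpM2l//; clear; lia.
  apply/mapP; exists (absz (k + (4 * D)%:Z)); last by clear -kb; lia.
  by rewrite mem_iota; clear -kb; lia.
by case: (code x).2; rewrite !inE.
Qed.

(** Sorting by [g = gcd (x, y)], a divisor of [m], and dividing by [g] gives primitive
    representations of [m / g ^ 2]. The choice of [g] accounts for the second divisor factor. *)
Lemma size_representations (D m : nat) (s : seq (int * int)) :
  (0 < D)%N -> (0 < m)%N -> uniq s ->
  (forall x, x \in s -> x.1 ^+ 2 + D%:Z * x.2 ^+ 2 = m%:Z) ->
  (size s <= size (divisors m) ^ 2 * (2 * (8 * D).+1))%N.
Proof.
move=> D0 m0 us hs.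
rewrite -mulnn -mulnA.
apply: (@size_le_fibers _ _ (fun x => `|gcdz x.1 x.2|%N)) => [x xs|g gm].
  rewrite -dvdn_divisors//.
  have : (gcdz x.1 x.2 %| m%:Z)%Z.
    rewrite -(hs x xs) !expr2; apply: rpredD.
      by rewrite dvdz_mulr// dvdz_gcdl.
    by rewrite !dvdz_mull// dvdz_gcdr.
  by rewrite /dvdz /=.
set s1 := [seq x <- s | _].
have us1 : uniq s1 by rewrite filter_uniq.
have g0 : (0 < g)%N by move: gm; rewrite -dvdn_divisors// => /dvdn_gt0; apply.
have gz : g%:Z != 0 by lia.
have fact x : x \in s1 -> exists y : int * int, [/\ x.1 = y.1 * g%:Z, x.2 = y.2 * g%:Z,
    (y.1 ^+ 2 + D%:Z * y.2 ^+ 2) * (g ^ 2)%N%:Z = m%:Z & coprimez y.1 y.2].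
  rewrite mem_filter => /andP[/eqP gx /hs ex].
  have gE : gcdz x.1 x.2 = g%:Z by rewrite -gx /gcdz absz_nat.
  have /dvdzP[a aE] : (g%:Z %| x.1)%Z by rewrite -gE dvdz_gcdl.
  have /dvdzP[b bE] : (g%:Z %| x.2)%Z by rewrite -gE dvdz_gcdr.
  exists (a, b); split => //=.
    by rewrite -ex aE bE -mulnn PoszM; ring.
  move: gE; rewrite aE bE -mulz_gcdl ?absz_nat// => gE.
  by apply/eqP/(mulIf gz); rewrite mul1r.
have [|] := posnP (size s1); first by move=> ->.
case s1E : s1 => [//|x0 s2] _; rewrite -s1E.
have [y0 [_ _ y0E _]] := fact x0 (etrans (congr1 (fun l => _ \in l) s1E) (mem_head _ _)).
have g2m : (g ^ 2 %| m)%N.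
  have : ((g ^ 2)%N%:Z %| m%:Z)%Z by rewrite -y0E dvdz_mull.
  by rewrite /dvdz /=.
pose m' := (m %/ g ^ 2)%N.
have mE : m = (m' * g ^ 2)%N by rewrite divnK.
have m'0 : (0 < m')%N by move: m0; rewrite mE muln_gt0 => /andP[].
pose f (x : int * int) := ((x.1 %/ g%:Z)%Z, (x.2 %/ g%:Z)%Z).
rewrite -(size_map f).
apply: (@leq_trans (size (divisors m') * (2 * (8 * D).+1))).
  apply: size_primitive_representations => //.
    rewrite map_inj_in_uniq// => x y xs ys [].
    have [a [a1 a2 _ _]] := fact x xs; have [b [b1 b2 _ _]] := fact y ys.
    rewrite a1 a2 b1 b2 !mulzK// => e1 e2.
    by apply: injective_projections; rewrite ?a1 ?b1 ?a2 ?b2 ?e1 ?e2.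
  move=> _ /mapP[x xs ->].
  have [a [a1 a2 aE ca]] := fact x xs.
  rewrite /f a1 a2 !mulzK//=; split => //.
  have g2z : (g ^ 2)%N%:Z != 0 by have : (0 < g ^ 2)%N; [rewrite expn_gt0 g0|lia].
  apply: (mulIf g2z).
  by rewrite aE [in LHS]mE PoszM.
rewrite leq_mul2r; apply/orP; right.
apply: uniq_leq_size; first exact: divisors_uniq.
move=> d; rewrite -!dvdn_divisors// => dm.
by rewrite mE dvdn_mulr.
Qed.

(** * Mertens' theorem *)

Lemma prod_primeX_dvdn (s : seq nat) (f : nat -> nat) (N : nat) : uniq s -> all prime s ->
  (forall p, p \in s -> (p ^ f p %| N)%N) -> (\prod_(p <- s) p ^ f p %| N)%N.
Proof.
elim: s => [|p s IH] /=; first by rewrite big_nil dvd1n.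
move=> /andP[ps us] /andP[pp sp] h; rewrite big_cons Gauss_dvd.
  rewrite h ?mem_head//= IH// => r rs; by apply: h; rewrite inE rs orbT.
rewrite coprimeXl// big_seq; apply: (big_ind (fun x => coprime p x)) => //.
- exact: coprimen1.
- by move=> x y cx cy; rewrite coprimeMr cx.
- move=> r rs; rewrite coprimeXr// prime_coprime// dvdn_prime2//; last exact: (allP sp).
  by apply: contraNneq ps => ->.
Qed.

Lemma prod_primes_dvdn (s : seq nat) (N : nat) : uniq s -> all prime s ->
  (forall p, p \in s -> (p %| N)%N) -> (\prod_(p <- s) p %| N)%N.
Proof.
move=> us sp h; have := @prod_primeX_dvdn s (fun=> 1%N) N us sp.
by under eq_bigr do rewrite expn1; apply => p ps; rewrite expn1 h.
Qed.

Lemma bin_odd_le4X (m : nat) : ('C(m.*2.+1, m) <= 4 ^ m)%N.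
Proof.
have h : (2 * 'C(m.*2.+1, m) <= 2 ^ m.*2.+1)%N.
  rewrite -[X in (X ^ _)%N]/(1 + 1)%N expnDn.
  have lt1 : (m < m.*2.+2)%N by lia.
  have lt2 : (m.+1 < m.*2.+2)%N by lia.
  rewrite (bigD1 (Ordinal lt1))//= (bigD1 (Ordinal lt2))/=; last first.
    by apply/eqP => -[]; lia.
  rewrite !exp1n !muln1.
  have -> : 'C(m.*2.+1, m.+1) = 'C(m.*2.+1, m).
    by rewrite -bin_sub; last by [lia]; congr ('C(_, _)); lia.
  by lia.
move: h; rewrite expnS leq_pmul2l// -mul2n expnM. by [].
Qed.

(** Erdos's induction: for [n = 2 m + 1] the primes in [[m + 2, 2 m + 1]] all divide the binomial
    coefficient [C(2 m + 1, m)], which is at most [4 ^ m]. *)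
Lemma primorial_le (n : nat) : (\prod_(0 <= p < n.+1 | prime p) p <= 4 ^ n)%N.
Proof.
elim/ltn_ind: n => n IH.
have [n2|n2] := leqP n 2.
  by case: n n2 {IH} => [|[|[|n]]] // _; rewrite /index_iota/= unlock.
have := odd_double_half n; case: (boolP (odd n)) => on /= nE; last first.
  rewrite big_mkcond big_nat_recr//= -big_mkcond.
  have -> : prime n = false.
    by apply/negP => pn; have [/eqP|] := even_prime pn; [lia|rewrite (negbTE on)].
  rewrite muln1; case: n n2 IH {on nE} => // n n2 IH.
  by apply: leq_trans (IH n (ltnSn n)) _; rewrite leq_exp2l.
pose m := n./2.
have nm : n = m.*2.+1 by rewrite /m -nE; lia.
have m1 : (0 < m)%N by lia.
rewrite nm (@big_cat_nat _ _ _ m.+2)//=; last by lia.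
apply: (@leq_trans (4 ^ m.+1 * 4 ^ m)); last by rewrite -expnD leq_exp2l//; lia.
apply: leq_mul; first by apply: IH; lia.
apply: leq_trans (bin_odd_le4X m).
apply: dvdn_leq; first by rewrite bin_gt0; lia.
rewrite -big_filter.
apply: prod_primes_dvdn.
- by rewrite filter_uniq// iota_uniq.
- exact: filter_all.
- move=> p; rewrite mem_filter mem_index_iota => /andP[pp /andP[p1 p2]].
  have h : (p %| 'C(m.*2.+1, m) * (m`! * (m.*2.+1 - m)`!))%N.
    rewrite bin_fact; last by lia.
    rewrite dvdn_fact//; lia.
  move: h; rewrite Gauss_dvdl// coprimeMr !prime_coprime//.
  have nd k : (k < p)%N -> ~~ (p %| k`!)%N.
    elim: k => [|k IHk] kp; first by rewrite fact0 dvdn1; move: (prime_gt1 pp); lia.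
    rewrite factS Euclid_dvdM// negb_or IHk ?andbT; last by lia.
    by apply/negP => /dvdn_leq; lia.
  by rewrite !nd//; lia.
Qed.

Section Mertens.
Variable R : realType.

(** Chebyshev's argument: the product of [p ^ (n / p)] with rounded-down exponents divides [n!],
    which is at most [n ^ n]. Replacing the rounded exponent by [n / p] costs the logarithm of the
    primorial, hence the term [ln 4]. *)
Lemma mertens_first (n : nat) : (0 < n)%N ->
  \sum_(0 <= p < n.+1 | prime p) (ln p%:R / p%:R : R) <= ln n%:R + ln 4.
Proof.
move=> n0.
have n0R : (0 : R) < n%:R by rewrite ltr0n.
have dv : (\prod_(0 <= p < n.+1 | prime p) p ^ (n %/ p) <= n ^ n)%N.
  apply: (@leq_trans n`!).
    apply: dvdn_leq; first exact: fact_gt0.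
    rewrite -big_filter; apply: (@prod_primeX_dvdn _ (fun p => n %/ p)%N).
    - by rewrite filter_uniq// iota_uniq.
    - exact: filter_all.
    - move=> p; rewrite mem_filter mem_index_iota => /andP[pp _].
      rewrite pfactor_dvdn// ?fact_gt0// logn_fact// big_ltn; last by lia.
      by rewrite expn1 leq_addr.
  elim: n {n0 n0R} => // n IH; rewrite factS expnS leq_mul2l /=.
  by apply: leq_trans IH _; case: (n) => //= k; rewrite leq_exp2r.
have lnprod (f : nat -> nat) : ln (\prod_(0 <= p < n.+1 | prime p) p ^ f p)%N%:R
    = \sum_(0 <= p < n.+1 | prime p) (f p)%:R * ln p%:R :> R.
  have : (0 < \prod_(0 <= p < n.+1 | prime p) p ^ f p)%N /\
    ln (\prod_(0 <= p < n.+1 | prime p) p ^ f p)%N%:R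
    = \sum_(0 <= p < n.+1 | prime p) (f p)%:R * ln p%:R :> R; last by case.
  apply: (big_ind2 (fun (x : nat) (y : R) => (0 < x)%N /\ ln x%:R = y)).
  - by rewrite ln1.
  - move=> x1 x2 y1 y2 [x10 <-] [y10 <-]; rewrite muln_gt0 x10 y10; split => //.
    by rewrite natrM lnM// posrE ltr0n.
  - move=> p pp; rewrite expn_gt0 prime_gt0//; split => //.
    by rewrite natrX lnXn ?ltr0n ?prime_gt0// mulr_natl.
have h1 : \sum_(0 <= p < n.+1 | prime p) (n %/ p)%N%:R * ln p%:R <= n%:R * ln n%:R :> R.
  rewrite -lnprod mulr_natl -lnXn// ler_ln ?posrE -?natrX ?ltr0n ?expn_gt0 ?n0//.
    by rewrite ler_nat.
  by rewrite prodn_cond_gt0// => p pp; rewrite expn_gt0 prime_gt0.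
have h2 : \sum_(0 <= p < n.+1 | prime p) ln p%:R <= n%:R * ln 4 :> R.
  have := lnprod (fun=> 1%N); under [X in _ = X]eq_bigr do rewrite mul1r; move=> <-.
  rewrite mulr_natl -lnXn// ler_ln ?posrE -?natrX ?ltr0n ?expn_gt0//.
    by rewrite ler_nat; under eq_bigr do rewrite expn1; exact: primorial_le.
  by rewrite prodn_cond_gt0// => p pp; rewrite expn_gt0 prime_gt0.
rewrite -(ler_pM2l n0R) mulrDr.
apply: le_trans (lerD h1 h2); rewrite mulr_sumr -big_split /=.
apply: ler_sum => p pp.
have p0 : (0 : R) < p%:R by rewrite ltr0n prime_gt0.
have lp : 0 <= ln p%:R :> R by apply: ln_ge0; rewrite ler1n prime_gt0.
rewrite mulrCA -[X in _ <= _ + X]mul1r -mulrDl [X in X <= _]mulrC ler_wpM2r//.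
rewrite ler_pdivrMr// natr1 -natrM ler_nat {1}(divn_eq n p) mulSn addnC leq_add2r ltnW// ltn_mod prime_gt0//.
Qed.

(** Partial summation as an induction: the difference of the sum of [1 / p] and [A n / ln n] does
    not jump at a new prime, so only the slow change of [1 / ln n] matters. That change is
    controlled by [1 - ln n / ln (n + 1) <= ln (ln (n + 1)) - ln (ln n)]. The constant [K0] makes
    [n = 2] an equality. *)
Lemma mertens_second : exists K : R, forall n : nat, (2 <= n)%N ->
  \sum_(0 <= p < n.+1 | prime p) (p%:R^-1 : R) <= ln (ln n%:R) + K.
Proof.
pose A n : R := \sum_(0 <= p < n.+1 | prime p) (ln p%:R / p%:R : R).
pose c : R := ln 4.
pose K0 : R := \sum_(0 <= p < 3 | prime p) p%:R^-1 - A 2 / ln 2 + c / ln 2 - ln (ln 2).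
have lnpos n : (2 <= n)%N -> 0 < ln n%:R :> R by move=> n2; rewrite ln_gt0// ltr1n.
have main n : (2 <= n)%N -> \sum_(0 <= p < n.+1 | prime p) (p%:R^-1 : R) - A n / ln n%:R
    <= ln (ln n%:R) - c / ln n%:R + K0.
  elim: n => // n IH n1.
  have [n2|n2] := leqP 2 n; last first.
    have -> : n = 1%N by lia.
    by rewrite /K0; lra.
  have l0 := lnpos n n2; have l1 := lnpos n.+1 n1.
  have l01 : ln n%:R <= ln n.+1%:R :> R by rewrite ler_ln ?posrE ?ltr0n// ?ler_nat//; lia.
  have step : \sum_(0 <= p < n.+2 | prime p) (p%:R^-1 : R) - A n.+1 / ln n.+1%:R
     = \sum_(0 <= p < n.+1 | prime p) (p%:R^-1 : R) - A n / ln n.+1%:R.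
    rewrite /A.
    have recr (F : nat -> R) : \sum_(0 <= p < n.+2 | prime p) F p =
        \sum_(0 <= p < n.+1 | prime p) F p + (if prime n.+1 then F n.+1 else 0).
      by rewrite big_mkcond big_nat_recr//= -big_mkcond.
    rewrite !recr.
    case: ifP => pn; last by rewrite !addr0.
    rewrite mulrDl.
    have -> : ln n.+1%:R / n.+1%:R / ln n.+1%:R = n.+1%:R^-1 :> R.
      by rewrite mulrAC divff ?gt_eqF// mul1r.
    by ring.
  rewrite step.
  have An : A n <= ln n%:R + c by apply: mertens_first; lia.
  have inv01 : 0 <= (ln n%:R)^-1 - (ln n.+1%:R)^-1 :> R.
    by rewrite subr_ge0 lef_pV2 ?posrE.
  have hA : A n * ((ln n%:R)^-1 - (ln n.+1%:R)^-1) <=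
     (ln n%:R + c) * ((ln n%:R)^-1 - (ln n.+1%:R)^-1) by rewrite ler_wpM2r.
  have hl : 1 - ln n%:R / ln n.+1%:R <= ln (ln n.+1%:R) - ln (ln n%:R) :> R.
    rewrite -ln_div ?posrE//.
    have t0 : 0 < ln n%:R / ln n.+1%:R :> R by rewrite divr_gt0.
    have := @le_ln1Dx R (ln n%:R / ln n.+1%:R - 1); rewrite addrCA subrr addr0.
    have -> : ln n.+1%:R / ln n%:R = (ln n%:R / ln n.+1%:R)^-1 :> R by rewrite invf_div.
    rewrite lnV ?posrE// => h; have := h _; lra.
  have IH' := IH n2.
  have e1 : (ln n%:R + c) * ((ln n%:R)^-1 - (ln n.+1%:R)^-1) =
     1 - ln n%:R / ln n.+1%:R + c / ln n%:R - c / ln n.+1%:R.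
    by field; rewrite !gt_eqF.
  rewrite e1 in hA.
  have e2 : A n * ((ln n%:R)^-1 - (ln n.+1%:R)^-1) = A n / ln n%:R - A n / ln n.+1%:R by ring.
  rewrite e2 in hA; lra.
exists (K0 + 1) => n n2.
have h := main n n2; have l0 := lnpos n n2.
have An : A n / ln n%:R <= 1 + c / ln n%:R.
  rewrite ler_pdivrMr// mulrDl divfK ?gt_eqF// mul1r.
  by apply: mertens_first; lia.
lra.
Qed.

(** The inverse factor is [1 + 1 / (p - 1) <= expR (1 / (p - 1))]. Writing
    [1 / (p - 1) = 1 / p + 1 / (p (p - 1))], the second part telescopes to at most 1, which explains
    [K + 1]. *)
Lemma prod_1Bprime_inv_ge : exists2 c : R, 0 < c & forall n : nat, (2 <= n)%N ->
  c / ln n%:R <= \prod_(0 <= p < n.+1 | prime p) (1 - p%:R^-1 : R).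
Proof.
have [K hK] := mertens_second.
exists (expR (- (K + 1))); first exact: expR_gt0.
move=> n n2.
have l0 : 0 < ln n%:R :> R by rewrite ln_gt0// ltr1n.
have -> : expR (- (K + 1)) / ln n%:R = expR (- (ln (ln n%:R) + K + 1)) :> R.
  by rewrite -[X in _ = expR (- X)]addrA [in RHS]opprD [in RHS]expRD [expR (- ln _)]expRN lnK ?posrE// mulrC.
have tele m : \sum_(2 <= k < m.+2) ((k%:R * (k%:R - 1))^-1 : R) = 1 - m.+1%:R^-1.
  elim: m => [|m IH]; first by rewrite big_geq// invr1 subrr.
  rewrite big_nat_recr//= IH -!natr1.
  have : (m%:R + 1 : R) != 0 by rewrite natr1 pnatr_eq0.
  have : (m%:R + 1 + 1 : R) != 0 by rewrite !natr1 pnatr_eq0.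
  by move=> h1 h2; field; rewrite h1 -(addrA _ 1 (-1)) ?subrr ?addr0 ?h2 ?andbT//=.
have sumle : \sum_(0 <= p < n.+1 | prime p) ((p%:R - 1)^-1 : R) <= ln (ln n%:R) + K + 1.
  apply: (@le_trans _ _ (\sum_(0 <= p < n.+1 | prime p) (p%:R^-1 : R) +
     \sum_(0 <= p < n.+1 | prime p) ((p%:R * (p%:R - 1))^-1 : R))).
    rewrite -big_split /=; apply: ler_sum => p pp.
    have p2 : (2 : R) <= p%:R by rewrite ler_nat prime_gt1.
    rewrite le_eqVlt; apply/orP; left; apply/eqP; field.
    by rewrite !gt_eqF//; lra.
  apply: lerD; first exact: hK.
  case: n n2 l0 => [//|n] n2 l0.
  apply: (@le_trans _ _ (\sum_(2 <= k < n.+2) ((k%:R * (k%:R - 1))^-1 : R))).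
    rewrite big_ltn_cond//= big_ltn_cond//= big_mkcond [X in _ <= X]big_nat [X in X <= _]big_nat /=.
    apply: ler_sum => k /andP[k2 _]; case: ifP => // _.
    have k2R : (2 : R) <= k%:R by rewrite ler_nat.
    by rewrite invr_ge0 mulr_ge0//; lra.
  by rewrite tele lerBlDl lerDr invr_ge0.
apply: (@le_trans _ _ (expR (- \sum_(0 <= p < n.+1 | prime p) ((p%:R - 1)^-1 : R)))).
  by rewrite ler_expR lerN2.
rewrite -sumrN expR_sum; apply: ler_prod => p pp; rewrite expR_ge0 /=.
have p2 : (2 : R) <= p%:R by rewrite ler_nat prime_gt1.
rewrite expRN.
have -> : 1 - p%:R^-1 = (1 + (p%:R - 1)^-1)^-1 :> R.
  by field; rewrite !gt_eqF//; lra.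
have i0 : 0 < (p%:R - 1)^-1 :> R by rewrite invr_gt0; lra.
rewrite lef_pV2 ?posrE ?expR_gt0//; last by lra.
exact: expR_ge1Dx.
Qed.

(** The primes dividing [q] are split at [ln q]. Those below it give at least the full product up to
    [ln q]. There are at most [ln q / ln (ln q)] above it, so by Bernoulli's inequality their
    product is at least [1 - 1 / ln (ln q)]. *)
Lemma prod_1Bprimes_inv_ge : exists2 c : R, 0 < c & exists q0 : nat, forall q : nat, (q0 <= q)%N ->
  0 < ln (ln q%:R) :> R /\ c / ln (ln q%:R) <= \prod_(p <- primes q) (1 - p%:R^-1 : R).
Proof.
have [c c0 hc] := prod_1Bprime_inv_ge.
exists (c / 2); first by lra.
(* This threshold forces [ln (ln q) > 2], so that the large primes lose at most the factor 2 in
   [c / 2]. *)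
pose q0 := (Num.truncn (expR (expR 2) : R)).+2.
exists q0 => q q0q.
have q1 : (1 < q)%N by apply: leq_trans q0q.
have qe : expR (expR 2) < q%:R :> R.
  by apply: lt_le_trans (truncnS_gt _) _; rewrite ler_nat; apply: leq_trans q0q.
have q0R : (0 : R) < q%:R by rewrite ltr0n; lia.
have lq : expR 2 < ln q%:R :> R by rewrite -ltr_expR lnK ?posrE.
have lq3 : 3 <= ln q%:R :> R by apply: le_trans (ltW lq); have := @expR_ge1Dx R 2; lra.
have llq : 2 < ln (ln q%:R) :> R by rewrite -ltr_expR lnK ?posrE//; lra.
split; first by lra.
pose n := Num.truncn (ln q%:R : R).
have nle : n%:R <= ln q%:R :> R by rewrite truncn_le; lra.
have n2 : (2 <= n)%N by rewrite /n truncn_ge_nat; lra.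
rewrite (bigID (fun p => (p < n.+1)%N)) /=.
have half (x : nat) : prime x -> 0 <= 1 - (x%:R^-1 : R) <= 1.
  move=> px; have : (2 : R) <= x%:R by rewrite ler_nat prime_gt1.
  move=> x2; have : x%:R^-1 <= 1 :> R by rewrite invf_le1; lra.
  have : 0 <= x%:R^-1 :> R by rewrite invr_ge0. lra.
have h1 : c / ln (ln q%:R) <= \prod_(p <- primes q | (p < n.+1)%N) (1 - p%:R^-1 : R).
  have ln0 : 0 < ln n%:R :> R by rewrite ln_gt0// ltr1n.
  apply: (@le_trans _ _ (c / ln n%:R)).
    rewrite (ler_pM2l c0) lef_pV2 ?posrE//; last by lra.
    by rewrite ler_ln ?posrE// ?ltr0n//; [lia|lra].
  apply: le_trans (hc n n2) _.
  rewrite -[X in X <= _]big_filter -[X in _ <= X]big_filter.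
  have -> : perm_eq [seq p <- index_iota 0 n.+1 | prime p] ([seq p <- primes q | (p < n.+1)%N] ++
     [seq p <- index_iota 0 n.+1 | prime p && (p \notin primes q)]) -> 
    \prod_(i <- [seq p <- index_iota 0 n.+1 | prime p]) (1 - i%:R^-1 : R) =
    (\prod_(i <- [seq p <- primes q | (p < n.+1)%N]) (1 - i%:R^-1 : R)) * 
    \prod_(i <- [seq p <- index_iota 0 n.+1 | prime p && (p \notin primes q)]) (1 - i%:R^-1 : R).
  - by move=> pe; rewrite (perm_big _ pe) big_cat.
  - rewrite -[X in _ <= X]mulr1 ler_wpM2l//.
      by rewrite big_seq prodr_ge0// => p; rewrite mem_filter mem_primes => /andP[_ /andP[pp _]]; case/andP: (half p pp).
    rewrite big_seq; apply: (@le_trans _ _ (\prod_(i <- [seq p <- index_iota 0 n.+1 | prime p && (p \notin primes q)] |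
        i \in [seq p <- index_iota 0 n.+1 | prime p && (p \notin primes q)]) (1 : R))).
      by apply: ler_prod => p; rewrite mem_filter => /andP[/andP[pp _] _]; exact: half.
    by rewrite big1_eq.
  apply: uniq_perm.
  - by rewrite filter_uniq// iota_uniq.
  - rewrite cat_uniq !filter_uniq ?primes_uniq ?iota_uniq//= andbT.
    apply/hasPn => p; rewrite !mem_filter => /andP[/andP[_ pq] _].
    by rewrite /= (negbTE pq) andbF.
  - move=> p; rewrite mem_cat !mem_filter mem_index_iota /= mem_primes.
    by case: (prime p); case: (p < n.+1)%N => //=; case: (p %| q)%N; case: (0 < q)%N.
have h2 : 2^-1 <= \prod_(p <- primes q | ~~ (p < n.+1)%N) (1 - p%:R^-1 : R).
  rewrite -big_filter; set s := [seq _ <- _ | _].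
  have sp p : p \in s -> prime p /\ ln q%:R < p%:R :> R.
    rewrite mem_filter mem_primes => /andP[pn /andP[pp _]]; split => //.
    apply: lt_le_trans (truncnS_gt _) _; rewrite ler_nat -/n; lia.
  have kle : (size s)%:R * ln (ln q%:R) <= ln q%:R :> R.
    have lq0 : 0 < ln q%:R :> R by lra.
    have lqs : 0 < ln q%:R ^+ size s :> R by rewrite exprn_gt0.
    rewrite mulr_natl -lnXn// ler_ln ?posrE//.
    apply: (@le_trans _ _ (\prod_(p <- s) p%:R)).
      elim: (s) sp {lqs} => [|p t IH] tp; first by rewrite big_nil.
      rewrite big_cons exprS ler_pM ?exprn_ge0 ?(ltW lq0)//.
        by have [_ /ltW] := tp p (mem_head _ _).
      by apply: IH => r rt; apply: tp; rewrite inE rt orbT.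
    rewrite -natr_prod ler_nat; apply: dvdn_leq; first exact: ltnW.
    apply: prod_primes_dvdn; first by rewrite filter_uniq// primes_uniq.
      by apply/allP => p /sp[].
    by move=> p; rewrite mem_filter mem_primes => /andP[_ /and3P[]].
  have bern (t : seq nat) : (forall p, p \in t -> prime p /\ ln q%:R < p%:R :> R) ->
     1 - (size t)%:R / ln q%:R <= \prod_(p <- t) (1 - p%:R^-1 : R) <= 1.
    elim: t => [|p t IH] tp; first by rewrite big_nil mul0r subr0 lexx.
    have [pp pl] := tp p (mem_head _ _).
    have /andP[a0 a1] := half p pp.
    have /andP[b0 b1] := IH (fun r rt => tp r (mem_behead (s := p :: t) rt)).
    have pi : p%:R^-1 <= (ln q%:R)^-1 :> R by rewrite lef_pV2 ?posrE ?ltW//; lra.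
    have p0 : 0 <= p%:R^-1 :> R by rewrite invr_ge0.
    rewrite big_cons /= -natr1 mulrDl div1r; nra.
  have /andP[b0 _] := bern s sp.
  apply: le_trans b0.
  have : (size s)%:R / ln q%:R <= 2^-1 :> R; last by lra.
  rewrite ler_pdivrMr; last by lra.
  have : 0 <= (size s)%:R :> R by rewrite ler0n. nra.
rewrite [c / 2 / _]mulrAC -[X in X <= _]/(c / ln (ln q%:R) * 2^-1).
by apply: ler_pM => //; rewrite divr_ge0//; lra.
Qed.
End Mertens.

(** * Additive characters *)

Section Mean_value.
Variable R : realType.

Lemma MVT_everywhere (f df : R -> R) (a b : R) : a <= b ->
  (forall x : R, is_derive x 1 f (df x)) ->
  exists2 c, a <= c <= b & f b - f a = df c * (b - a).
Proof.
move=> ab fd.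
have cf : {within `[a, b], continuous f}.
  by apply: derivable_within_continuous => x _; case: (fd x).
have [c cab e] := MVT_segment ab (fun x _ => fd x) cf.
by exists c => //; rewrite in_itv in cab.
Qed.

Lemma sin_ge_quarter (x : R) : 0 <= x <= pi / 2 -> x / 4 <= sin x.
Proof.
move=> /andP[x0 x2].
have pi2 := pi_ge2 R.
have c4 : 2^-1 <= cos (pi / 4) :> R.
  have cge0 : 0 <= cos (pi / 4) :> R by apply: cos_ge0_pihalf; apply/andP; split; lra.
  have : cos (pi / 4 *+ 2) = 0 :> R.
    by rewrite -(cos_pihalf R); congr cos; rewrite -mulr_natr; field.
  rewrite cos_mulr2n -mulr_natr => h; nra.
have [c /andP[c0 cx] e] : exists2 c, 0 <= c <= x / 2 & sin (x / 2) - sin 0 = cos c * (x / 2 - 0).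
  by apply: MVT_everywhere; lra.
have cosge (y : R) : 0 <= y <= pi / 4 -> 2^-1 <= cos y.
  move=> /andP[y0 y4]; apply: le_trans c4 _.
  rewrite leNgt ltr_cos ?in_itv/=; [|apply/andP; split; lra..].
  by rewrite -leNgt.
have s2 : x / 4 <= sin (x / 2).
  rewrite sin0 subr0 subr0 in e; rewrite e.
  have : 2^-1 <= cos c by apply: cosge; apply/andP; split; lra.
  nra.
have c2 : 2^-1 <= cos (x / 2) by apply: cosge; apply/andP; split; lra.
have -> : sin x = sin ((x / 2) *+ 2) by congr sin; rewrite -mulr_natr; field.
rewrite sin_mulr2n -mulr_natr; nra.
Qed.
End Mean_value.

Section Exponentials.
Variable R : realType.
Implicit Types t : R.

Lemma e2piD s t : e2pi (s + t) = e2pi s * e2pi t :> R[i].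
Proof.
rewrite /e2pi mulrDr cosD sinD.
by apply/eqP; rewrite eq_complex /= eqxx /= addrC.
Qed.

Lemma e2pi0 : e2pi (0 : R) = 1.
Proof. by rewrite /e2pi mulr0 cos0 sin0. Qed.

Lemma e2pi1 : e2pi (1 : R) = 1.
Proof. by rewrite /e2pi mulr1 mulr_natl cos2pi sin2pi. Qed.

Lemma e2piN t : e2pi (- t) = ((e2pi t)^*)%C.
Proof. by rewrite /e2pi mulrN cosN sinN. Qed.

Lemma e2pi_nat (n : nat) : e2pi (n%:R : R) = 1.
Proof.
elim: n => [|n IH]; first exact: e2pi0.
by rewrite -natr1 e2piD IH e2pi1 mulr1.
Qed.

Lemma e2pi_int (z : int) : e2pi (z%:~R : R) = 1.
Proof.
case: z => n; first exact: e2pi_nat.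
by rewrite NegzE mulrNz e2piN -[n.+1%:~R]/(n.+1%:R) e2pi_nat conjc1.
Qed.

Lemma e2piMn t (n : nat) : e2pi (t * n%:R) = e2pi t ^+ n.
Proof.
elim: n => [|n IH]; first by rewrite mulr0 e2pi0 expr0.
by rewrite -natr1 mulrDr mulr1 e2piD IH exprSr.
Qed.

Lemma normc_e2pi t : normc (e2pi t) = 1.
Proof. by rewrite /normc /e2pi cos2Dsin2 sqrtr1. Qed.

Lemma e2pi_eqmod (q : nat) (x y : int) : (0 < q)%N -> (q%:Z %| x - y)%Z ->
  e2pi (x%:~R / q%:R : R) = e2pi (y%:~R / q%:R).
Proof.
move=> q0 /dvdzP[k kE].
have -> : x = y + k * q%:Z by rewrite -kE; ring.
rewrite intrD intrM mulrDl e2piD.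
have -> : k%:~R * (Posz q)%:~R / q%:R = k%:~R :> R.
  by rewrite -[(Posz q)%:~R]/(q%:R) mulfK// pnatr_eq0; lia.
by rewrite e2pi_int mulr1.
Qed.

Lemma normc_sum (I : Type) (s : seq I) (P : pred I) (F : I -> R[i]) :
  normc (\sum_(i <- s | P i) F i) <= \sum_(i <- s | P i) normc (F i).
Proof.
elim/big_rec2: _ => [|i y x _ h]; first by rewrite normc0.
by apply: le_trans (le_normcD _ _) _; rewrite lerD2l.
Qed.

Lemma normc_real (x : R) : normc x%:C = `|x|.
Proof. by rewrite /normc /= expr0n addr0 sqrtr_sqr. Qed.

Lemma normc_ge0 (x : R[i]) : 0 <= normc x.
Proof. by case: x => a b; exact: sqrtr_ge0. Qed.

Lemma normc_conj (x : R[i]) : normc (x^*)%C = normc x.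
Proof. by case: x => a b /=; rewrite sqrrN. Qed.

(** The left side of the conclusion replaces the distance from [t] to the nearest integer by a
    polynomial symmetric under [t -> 1 - t]. The norm equals [2 |sin (pi t)|], and the symmetry
    reduces to [t <= 1/2]. *)
Lemma normc_1Be2pi t : 0 < t < 1 -> t * (1 - t) <= normc (1 - e2pi t).
Proof.
move=> /andP[t0 t1].
have pi2 := pi_ge2 R.
have E : normc (1 - e2pi t) = 2 * `|sin (pi * t)|.
  have -> : 1 - e2pi t = (1 - cos (2 * pi * t)) +i* (- sin (2 * pi * t)).
    by apply/eqP; rewrite eq_complex /= sub0r !eqxx.
  rewrite /normc sqrrN -[RHS]ger0_norm ?mulr_ge0// -sqrtr_sqr; congr Num.sqrt.
  have -> : 2 * pi * t = (pi * t) *+ 2 :> R by rewrite -mulr_natr; ring.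
  rewrite cos_mulr2n sin_mulr2n exprMn real_normK ?num_real//.
  have := cos2Dsin2 (pi * t); set c := cos _; set s := sin _ => h.
  have c2 : c ^+ 2 = 1 - s ^+ 2 by rewrite -h; ring.
  have -> : (1 - (c ^+ 2 *+ 2 - 1)) ^+ 2 + (c * s *+ 2) ^+ 2 =
     (2 - 2 * c ^+ 2) ^+ 2 + 4 * c ^+ 2 * s ^+ 2 by ring.
  by rewrite c2; ring.
have key (u : R) : 0 <= u <= 2^-1 -> u / 2 <= sin (pi * u).
  move=> /andP[u0 u2].
  have h : pi * u / 4 <= sin (pi * u) by apply: sin_ge_quarter; apply/andP; split; nra.
  by apply: le_trans h; nra.
rewrite E; have sle := ler_norm (sin (pi * t)).
have [t2|t2] := lerP t 2^-1.
  have := key t; rewrite (ltW t0) t2 => /(_ isT) h; nra.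
have := key (1 - t) => h.
have : (1 - t) / 2 <= sin (pi * t).
  have -> : sin (pi * t) = sin (pi * (1 - t)).
    rewrite mulrBr mulr1 sinB sinpi cospi; ring.
  by apply: h; apply/andP; split; lra.
move=> h2; nra.
Qed.

(** With [t] the fractional part of [r / q], the second branch is [2 / (t (1 - t))] in partial
    fractions. This form of the usual [min (K, 1 / ||r / q||)] splits a sum over [r] into two
    harmonic sums. *)
Definition gsum_bound (q : nat) (K : R) (r : int) : R :=
  if (q%:Z %| r)%Z then K else 2 * q%:R / (r %% q%:Z)%Z%:~R + 2 * q%:R / (q%:Z - (r %% q%:Z)%Z)%:~R.

Lemma geometric_e2pi_bound (q : nat) (K : R) (r : int) (m n : nat) : (0 < q)%N ->
  (n - m)%N%:R <= K ->
  normc (\sum_(m <= k < n) e2pi (r%:~R / q%:R * k%:R : R)) <= gsum_bound q K r.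
Proof.
move=> q0 nK; rewrite /gsum_bound; case: ifPn => [qr|qr].
  apply: le_trans (normc_sum _ _ _) _.
  under eq_bigr do rewrite normc_e2pi.
  by rewrite big_const_nat iter_addr_0.
have q0R : (0 : R) < q%:R by rewrite ltr0n.
set s := (r %% q%:Z)%Z.
have s0 : 0 < s by rewrite lt_neqAle modz_ge0 ?andbT//; [rewrite eq_sym; apply: contra qr => /eqP qr; apply/dvdz_mod0P|lia].
have sq : s < q%:Z by have := ltz_pmod r (_ : 0 < q%:Z); apply; lia.
pose t : R := s%:~R / q%:R.
have s0R : (0 : R) < s%:~R by rewrite ltr0z.
have sqR : s%:~R < q%:R :> R by rewrite -[q%:R]/((Posz q)%:~R) ltr_int.
have t01 : 0 < t < 1 by rewrite divr_gt0//= ltr_pdivrMr// mul1r.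
have eE : e2pi (r%:~R / q%:R : R) = e2pi t.
  apply: e2pi_eqmod => //; apply/dvdzP; exists (r %/ q%:Z)%Z.
  rewrite {1}(divz_eq r q%:Z) /s; ring.
have tel : (1 - e2pi t) * (\sum_(m <= k < n) e2pi (r%:~R / q%:R * k%:R : R)) =
   \sum_(m <= k < n) (e2pi t ^+ k - e2pi t ^+ k.+1).
  rewrite mulr_sumr; apply: eq_bigr => k _; rewrite e2piMn eE exprS; ring.
have tbd : normc (\sum_(m <= k < n) (e2pi t ^+ k - e2pi t ^+ k.+1)) <= 2.
  have [mn|nm] := leqP m n; last by rewrite big_geq ?normc0//; lia.
  under eq_bigr do rewrite -opprB.
  rewrite sumrN telescope_sumr//.
  have ne k : normc (e2pi t ^+ k) = 1 by rewrite -e2piMn normc_e2pi.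
  by rewrite opprB; apply: le_trans (le_normcD _ _) _; rewrite normcN !ne.
have := congr1 (@normc R) tel; rewrite normcM => h.
have lb := normc_1Be2pi t01.
have tt : 0 < t * (1 - t) by case/andP: t01 => *; apply: mulr_gt0; lra.
have -> : 2 * q%:R / s%:~R + 2 * q%:R / (q%:Z - s)%:~R = 2 / (t * (1 - t)).
  rewrite /t intrB -[(Posz q)%:~R]/(q%:R : R); field.
  by rewrite !gt_eqF//= subr_gt0.
rewrite ler_pdivlMr//.
have n0 := normc_ge0 (\sum_(m <= k < n) e2pi (r%:~R / q%:R * k%:R : R)).
apply: le_trans tbd; rewrite -h mulrC ler_wpM2r//.
Qed.

Lemma sum_e2pi_ord (q : nat) (z : int) : (0 < q)%N ->
  \sum_(h < q) e2pi (h%:R * z%:~R / q%:R : R) = if (q%:Z %| z)%Z then q%:R else 0.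
Proof.
move=> q0; have q0R : (q%:R : R) != 0 by rewrite pnatr_eq0; lia.
have -> : \sum_(h < q) e2pi (h%:R * z%:~R / q%:R : R) = \sum_(h < q) e2pi (z%:~R / q%:R : R) ^+ h.
  by apply: eq_bigr => h _; rewrite -e2piMn; congr e2pi; ring.
case: ifPn => qz.
  have -> : e2pi (z%:~R / q%:R : R) = 1.
    rewrite (@e2pi_eqmod q z 0) ?subr0//; by rewrite mul0r e2pi0.
  by under eq_bigr do rewrite expr1n; rewrite sumr_const card_ord.
have ne1 : e2pi (z%:~R / q%:R : R) - 1 != 0.
  apply/eqP => e1.
  set s := (z %% q%:Z)%Z.
  have s0 : 0 < s by rewrite lt_neqAle modz_ge0 ?andbT//; [rewrite eq_sym; apply: contra qz => /eqP qz; apply/dvdz_mod0P|lia].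
  have sq : s < q%:Z by have := ltz_pmod z (_ : 0 < q%:Z); apply; lia.
  have s0R : (0 : R) < s%:~R by rewrite ltr0z.
  have sqR : s%:~R < q%:R :> R by rewrite -[q%:R]/((Posz q)%:~R) ltr_int.
  have q0R' : (0 : R) < q%:R by rewrite ltr0n.
  have t01 : 0 < (s%:~R / q%:R : R) < 1 by rewrite divr_gt0//= ltr_pdivrMr// mul1r.
  have eE : e2pi (z%:~R / q%:R : R) = e2pi (s%:~R / q%:R).
    apply: e2pi_eqmod => //; apply/dvdzP; exists (z %/ q%:Z)%Z.
    rewrite {1}(divz_eq z q%:Z) /s; ring.
  have h0 : 1 - e2pi (s%:~R / q%:R : R) = 0 by rewrite -eE -opprB e1 oppr0.
  have := normc_1Be2pi t01; rewrite h0 normc0.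
  case/andP: t01 => t0 t1; have : 0 < (s%:~R / q%:R : R) * (1 - s%:~R / q%:R) by apply: mulr_gt0; lra.
  lra.
apply: (mulfI ne1); rewrite mulr0 -subrX1 -e2piMn divfK//.
by rewrite e2pi_int subrr.
Qed.

End Exponentials.

(** * Residue counts and Gauss sums *)

Section Forms_over_fields.
Variables (F : finFieldType) (a b c : F).
Hypothesis odd_card : odd #|F|.
Let Q (v : F * F) : F := a * v.1 ^+ 2 + b * v.1 * v.2 + c * v.2 ^+ 2.
Let D : F := 4 * a * c - b ^+ 2.
Let fiber (t : F) : nat := #|[set v : F * F | Q v == t]%SET|.
Hypothesis D_neq0 : D != 0.

(** Pigeonhole: the squares, and the elements [s - D y ^ 2], each fill at least half of a field of
    odd cardinality, so the two sets meet. *)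
Lemma norm_form_surjective (s : F) : exists x y : F, x ^+ 2 + D * y ^+ 2 = s.
Proof.
pose A := [set x ^+ 2 | x : F]%SET.
have cA : (#|F| <= 2 * #|A|)%N.
  rewrite -[#|F|]sum1_card (partition_big_imset (fun x : F => x ^+ 2)) /=.
  rewrite -/A mulnC -sum_nat_const; apply: leq_sum => y /imsetP[x _ ->].
  rewrite sum1dep_card; apply: (@leq_trans #|[set x; - x]%SET|); last by rewrite cards2; case: eqP.
  by apply/subset_leq_card/fintype.subsetP => z; rewrite !inE => /eqP/eqP; rewrite eqf_sqr.
pose B := [set s - D * y | y in A]%SET.
have cB : #|B| = #|A|.
  by rewrite card_imset// => x y /addrI/oppr_inj/(mulfI D_neq0).
have : (#|(A :&: B)%SET| != 0)%N.
  have := cardsUI A B; have := max_card (mem (A :|: B)%SET); move: cA odd_card; rewrite cB; move: #|_ :|: _| #|_ :&: _| #|F| #|A| => u i f k; lia.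
rewrite cards_eq0 => /finset.set0Pn[z]; rewrite inE => /andP[/imsetP[x _ ->] /imsetP[w /imsetP[y _ ->] e]].
by exists x, y; rewrite e subrK.
Qed.

(* Multiplication by [x + y J], where [J] is the trace-zero operator with [J^2 = - D],
   is a similitude of ratio [x^2 + D y^2]. *)
Lemma card_fiber_scale_le (s t : F) : s != 0 ->
  (fiber t <= fiber (s * t)%R)%N.
Proof.
move=> s0; have [x [y xy]] := norm_form_surjective s.
pose M (v : F * F) := (x * v.1 + y * (- b * v.1 - 2 * c * v.2), x * v.2 + y * (2 * a * v.1 + b * v.2)).
have inj : injective M.
  move=> [u1 u2] [v1 v2] [] e1 e2.
  (* Applying the conjugate operator [x - y J] to the image of a vector multiplies that vector by
     [s]. This recovers both coordinates. *)
  have E1 : s * u1 = s * v1.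
    have h (w1 w2 : F) : s * w1 = x * (x * w1 + y * (- b * w1 - 2 * c * w2))
        - y * (- b * (x * w1 + y * (- b * w1 - 2 * c * w2)) - 2 * c * (x * w2 + y * (2 * a * w1 + b * w2))).
      by rewrite -xy /D; ring.
    by rewrite (h u1 u2) (h v1 v2) e1 e2.
  have E2 : s * u2 = s * v2.
    have h (w1 w2 : F) : s * w2 = x * (x * w2 + y * (2 * a * w1 + b * w2))
        - y * (2 * a * (x * w1 + y * (- b * w1 - 2 * c * w2)) + b * (x * w2 + y * (2 * a * w1 + b * w2))).
      by rewrite -xy /D; ring.
    by rewrite (h u1 u2) (h v1 v2) e1 e2.
  by rewrite (mulfI s0 E1) (mulfI s0 E2).
rewrite /fiber -(card_imset _ inj); apply/subset_leq_card/fintype.subsetP => _ /imsetP[v vt ->].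
move: vt; rewrite !inE => /eqP <-; apply/eqP.
by rewrite -xy /Q /M /D /=; ring.
Qed.

Lemma card_fiber_const (t : F) : t != 0 -> fiber (t) = fiber (1).
Proof.
move=> t0; apply/eqP; rewrite -!/(fiber _) eqn_leq.
have t1 : t^-1 != 0 by rewrite invr_eq0.
have := card_fiber_scale_le t t1; rewrite mulVf// => ->.
by have := card_fiber_scale_le 1 t0; rewrite mulr1.
Qed.

Lemma card_fibers : (fiber 0%R + (#|F|.-1) * fiber 1%R = #|F| ^ 2)%N.
Proof.
rewrite /fiber expnS expn1 -card_prod -[RHS]sum1_card (partition_big Q xpredT)//= (bigD1 0)//=.
congr (_ + _)%N; first by rewrite sum1dep_card; apply: eq_card => v; rewrite !inE.
have <- : #|[pred t : F | t != 0]| = #|F|.-1.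
  by have := cardC1 (0 : F) => <-; apply: eq_card => x; rewrite !inE.
rewrite -sum_nat_const; apply: eq_bigr => t t0.
transitivity (fiber t); first by rewrite (card_fiber_const t0).
by rewrite sum1dep_card.
Qed.

(** The extremal case is two lines through the origin. Counting by rows of constant [y]: if [a] is
    nonzero, the row [y = 0] has one point and every other row at most two roots; if [a = 0], the
    row [y = 0] may be full, but then every other row has at most one point. *)
Lemma card_isotropic_le : (fiber 0%R <= (2 * #|F|).-1)%N.
Proof.
have F0 : (0 < #|F|)%N by apply/card_gt0P; exists 0.
have split_y : fiber 0 = (\sum_(y : F) #|[set x : F | Q (x, y) == 0%R]%SET|)%N.
  rewrite /fiber -sum1_card (partition_big (fun v : F * F => v.2) xpredT)//=.
  apply: eq_bigr => y _; rewrite -(card_imset _ (f := fun x => (x, y))) ?sum1_card.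
    apply: eq_card => -[x z]; rewrite [LHS]inE /= inE.
    apply/andP/imsetP => [[h /eqP zy]|[w hw [-> ->]]].
      by exists x; rewrite ?zy// inE -zy.
    by move: hw; rewrite inE => ->.
  by move=> x1 x2 [].
rewrite split_y (bigD1 0)//=.
have cF : #|[pred t : F | t != 0]| = #|F|.-1.
  by have := cardC1 (0 : F) => <-; apply: eq_card => x; rewrite !inE.
have sc k : (\sum_(y : F | y != 0%R) k = #|F|.-1 * k)%N by rewrite -cF -sum_nat_const.
have [a0|a0] := eqVneq a 0.
  have b0 : b != 0.
    by apply: contraNneq D_neq0 => b0; rewrite /D a0 b0 mulr0 mul0r expr0n subrr.
  apply: (@leq_trans (#|F| + \sum_(y : F | y != 0) 1)); last first.
    by rewrite sc; case: #|F| F0 => // n _; lia.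
  apply: leq_add; first exact: max_card.
  apply: leq_sum => y y0; apply: (@leq_trans #|[set (- c * y / b)]%SET|); last by rewrite cards1.
  apply/subset_leq_card/fintype.subsetP => x; rewrite !inE /Q /= a0 mul0r add0r => /eqP e.
  have : y * (b * x + c * y) = 0 by rewrite -e; ring.
  move=> /eqP; rewrite mulf_eq0 (negbTE y0) /= => /eqP e2.
  by apply/eqP/(mulfI b0); rewrite [RHS]mulrC divfK// -[RHS]add0r -e2; ring.
apply: (@leq_trans (1 + \sum_(y : F | y != 0) 2)); last first.
  by rewrite sc; case: #|F| F0 => // n _; lia.
apply: leq_add.
  apply: (@leq_trans #|[set (0 : F)]%SET|); last by rewrite cards1.
  apply/subset_leq_card/fintype.subsetP => x; rewrite !inE /Q /=.
  by rewrite mulr0 expr0n /= mulr0 !addr0 mulf_eq0 (negbTE a0) /= sqrf_eq0.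
apply: leq_sum => y y0.
have [->|/finset.set0Pn[x0]] := eqVneq [set x : F | Q (x, y) == 0]%SET finset.set0; first by rewrite cards0.
rewrite inE /Q /= => /eqP e0.
apply: (@leq_trans #|[set x0; - (b * y / a) - x0]%SET|); last by rewrite cards2; case: eqP.
apply/subset_leq_card/fintype.subsetP => x; rewrite !inE /Q /= => /eqP e.
have : (x - x0) * (a * (x + x0) + b * y) = 0.
  by rewrite -[RHS](subrr 0) -{1}e -e0; ring.
move=> /eqP; rewrite mulf_eq0 subr_eq0 => /orP[->//|/eqP e2].
apply/orP; right; apply/eqP/(mulfI a0).
rewrite mulrBr mulrN mulrCA divff// mulr1.
by rewrite -[LHS]addr0 -[X in _ = X]add0r -{2}e2; ring.
Qed.

End Forms_over_fields.

Section Residue_counts.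
Variables (a1 b1 c1 : int).

Definition rho (d : nat) : nat :=
  (\sum_(u < d) \sum_(v < d) (d%:Z %| bqf a1 b1 c1 (u : nat)%:Z (v : nat)%:Z)%Z)%N.

Lemma bqf_eqmod (d : int) (x y x' y' : int) : (d %| x - x')%Z -> (d %| y - y')%Z ->
  (d %| bqf a1 b1 c1 x y - bqf a1 b1 c1 x' y')%Z.
Proof.
move=> dx dy.
have -> : bqf a1 b1 c1 x y - bqf a1 b1 c1 x' y' =
  (x - x') * (a1 * (x + x') + b1 * y) + (y - y') * (b1 * x' + c1 * (y + y')).
  by rewrite /bqf; ring.
by rewrite rpredD// dvdz_mulr.
Qed.

Lemma sum_chinese (m n : nat) (f : nat -> nat -> nat) : coprime m n ->
  (\sum_(u < m * n) f (u %% m) (u %% n) = \sum_(i < m) \sum_(j < n) f i j)%N.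
Proof.
move=> cmn.
have [m0|m0] := posnP m; first by subst m; rewrite mul0n !big_ord0.
have [n0|n0] := posnP n.
  by subst n; rewrite muln0 big_ord0 big1// => i _; rewrite big_ord0.
pose h (u : 'I_(m * n)) : 'I_m * 'I_n := (Ordinal (ltn_pmod u m0), Ordinal (ltn_pmod u n0)).
have hb : bijective h.
  apply: inj_card_bij; last by rewrite card_prod !card_ord.
  move=> u v [] e1 e2; apply/val_inj => /=.
  have := @chinese_remainder m n cmn u v.
  rewrite e1 e2 !eqxx /= => /eqP; rewrite !modn_small//.
rewrite pair_big /= (reindex h) /=; last exact: onW_bij.
by apply: eq_bigr.
Qed.

Lemma rho_mul (m n : nat) : coprime m n -> rho (m * n) = (rho m * rho n)%N.
Proof.
move=> cmn; rewrite /rho.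
have [m0|m0] := posnP m; first by subst m; rewrite mul0n !big_ord0.
have [n0|n0] := posnP n; first by subst n; rewrite muln0 !big_ord0 muln0.
pose g (k u v : nat) : nat := (k%:Z %| bqf a1 b1 c1 u%:Z v%:Z)%Z.
have gmod k u v : g k u v = g k (u %% k)%N (v %% k)%N.
  rewrite /g; congr nat_of_bool.
  have md (x : nat) : (k%:Z %| x%:Z - (x %% k)%N%:Z)%Z.
    by apply/dvdzP; exists (x %/ k)%N%:Z; rewrite {1}(divn_eq x k) PoszD PoszM; ring.
  have := bqf_eqmod (md u) (md v); set A := bqf _ _ _ _ _; set B := bqf _ _ _ _ _ => h.
  apply/idP/idP => h2.
    have -> : B = A - (A - B) by ring.
    by rewrite rpredB.
  have -> : A = B + (A - B) by ring.
  by rewrite rpredD.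
transitivity (\sum_(u < m * n) \sum_(v < m * n)
   g m (u %% m) (v %% m) * g n (u %% n) (v %% n))%N.
  apply: eq_bigr => u _; apply: eq_bigr => v _; rewrite -!gmod /g PoszM.
  by rewrite Gauss_dvdz// ?mulnb// /coprimez /gcdz /=; exact/eqP/congr1/eqP.
transitivity (\sum_(u < m * n) \sum_(k < m) \sum_(l < n)
   g m (u %% m) k * g n (u %% n) l)%N.
  by apply: eq_bigr => u _; rewrite -(sum_chinese (fun k l => g m (u %% m) k * g n (u %% n) l)%N cmn).
rewrite (sum_chinese (fun i j => \sum_(k < m) \sum_(l < n) g m i k * g n j l)%N cmn).
rewrite big_distrl /=; apply: eq_bigr => i _.
rewrite big_distrr /=; apply: eq_bigr => j _.
rewrite big_distrl /=; apply: eq_bigr => k _.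
by rewrite big_distrr.
Qed.

Lemma rho1 : rho 1 = 1%N.
Proof. by rewrite /rho !big_ord1 /= dvd1z. Qed.

Lemma rho_prod (s : seq nat) : uniq s -> all prime s ->
  rho (\prod_(p <- s) p) = (\prod_(p <- s) rho p)%N.
Proof.
elim: s => [|p s IH] /=; first by rewrite !big_nil rho1.
move=> /andP[ps us] /andP[pp sp]; rewrite !big_cons rho_mul ?IH//.
rewrite big_seq; apply: (big_ind (fun x => coprime p x)) => //.
- exact: coprimen1.
- by move=> x y cx cy; rewrite coprimeMr cx.
- move=> r rs; rewrite prime_coprime// dvdn_prime2//; last exact: (allP sp).
  by apply: contraNneq ps => ->.
Qed.

End Residue_counts.

Section Gauss_sum.
Variables (R : realType) (a1 b1 c1 : int) (p : nat).
Hypotheses (p_prime : prime p) (p_odd : odd p)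
  (p_Delta : ~~ (p%:Z %| bqf_Delta a1 b1 c1)%Z).
Let a : 'F_p := a1%:~R.
Let b : 'F_p := b1%:~R.
Let c : 'F_p := c1%:~R.
Let Q (v : 'F_p * 'F_p) : 'F_p := a * v.1 ^+ 2 + b * v.1 * v.2 + c * v.2 ^+ 2.
Let fiber (t : 'F_p) : nat := #|[set v : 'F_p * 'F_p | Q v == t]%SET|.

Let card_F : #|'F_p| = p. Proof. by rewrite card_Fp. Qed.

Lemma intr_Fp_eq0 (z : int) : ((z%:~R : 'F_p) == 0) = (p%:Z %| z)%Z.
Proof.
have natE (n : nat) : ((n%:R : 'F_p) == 0) = (p %| n)%N.
  by rewrite -(dvdn_pcharf (pchar_Fp p_prime)).
case: z => n; first by rewrite -[(Posz n)%:~R]/(n%:R) natE.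
by rewrite NegzE mulrNz oppr_eq0 -[n.+1%:~R]/(n.+1%:R) natE dvdzE abszN.
Qed.

Lemma sum_Fp (T : nmodType) (f : nat -> T) : \sum_(i < p) f i = \sum_(x : 'F_p) f x.
Proof. by rewrite -(big_mkord xpredT f) -{1}(Fp_cast p_prime) big_mkord. Qed.

Lemma sum_Fp2 (T : nmodType) (f : nat -> nat -> T) :
  \sum_(i < p) \sum_(j < p) f i j = \sum_(v : 'F_p * 'F_p) f v.1 v.2.
Proof.
rewrite (sum_Fp (fun i => \sum_(j < p) f i j)) .
transitivity (\sum_(x : 'F_p) \sum_(y : 'F_p) f x y); last by rewrite pair_big.
by apply: eq_bigr => x _; rewrite (sum_Fp (f x)).
Qed.

Lemma bqf_Fp (v : 'F_p * 'F_p) :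
  (bqf a1 b1 c1 (v.1 : nat)%:Z (v.2 : nat)%:Z)%:~R = Q v :> 'F_p.
Proof.
rewrite /bqf /Q !(intrD, intrM, rmorphXn) /=.
by rewrite -![(Posz _)%:~R]/(_%:R) !natr_Zp.
Qed.

Let D_neq0 : 4 * a * c - b ^+ 2 != 0.
Proof.
have -> : 4 * a * c - b ^+ 2 = (bqf_Delta a1 b1 c1)%:~R.
  by rewrite /bqf_Delta intrB !intrM expr2.
by rewrite intr_Fp_eq0.
Qed.

Let oddF : odd #|'F_p|. Proof. by rewrite card_F. Qed.

Lemma rho_fiber : rho a1 b1 c1 p = fiber 0.
Proof.
rewrite /rho (sum_Fp2 (fun u v => (p%:Z %| bqf a1 b1 c1 u%:Z v%:Z)%Z : nat)).
rewrite /fiber -sum1dep_card [RHS]big_mkcond /=; apply: (@eq_bigr nat 0%N addn) => v _.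
by rewrite -intr_Fp_eq0 bqf_Fp; case: eqP.
Qed.

Lemma rho_le : (rho a1 b1 c1 p <= (2 * p).-1)%N.
Proof. by have := @card_isotropic_le _ a b c oddF D_neq0; rewrite card_F rho_fiber. Qed.

(** All nonzero values are taken equally often, and the additive character sums to [-1] over the
    nonzero residues, so no evaluation of a quadratic Gauss sum is involved. *)
Lemma GQ_fiber : GQ R a1 b1 c1 p 1 = (fiber 0)%:R - (fiber 1)%:R.
Proof.
have p0 := prime_gt0 p_prime.
pose psi (t : 'F_p) : R[i] := e2pi ((t : nat)%:R / p%:R : R).
have E (z : int) : e2pi (z%:~R / p%:R : R) = psi z%:~R.
  rewrite /psi -[(z%:~R : 'F_p)%:R]/(((z%:~R : 'F_p) : nat)%:Z%:~R).
  apply: e2pi_eqmod => //; rewrite -intr_Fp_eq0 intrB.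
  by rewrite -[X in _ - X]/(((z%:~R : 'F_p) : nat)%:R) natr_Zp subrr.
rewrite /GQ.
under eq_bigr do under eq_bigr do rewrite mul1r E.
rewrite (sum_Fp2 (fun x y => psi (bqf a1 b1 c1 x%:Z y%:Z)%:~R)).
under eq_bigr do rewrite bqf_Fp.
have sum0 : \sum_(t : 'F_p) psi t = 0.
  rewrite /psi -(sum_Fp (fun n => e2pi (n%:R / p%:R : R))).
  have := @sum_e2pi_ord R p 1 p0; rewrite dvdz1 /=.
  under eq_bigr do rewrite mulr1.
  have -> : (p == 1%N) = false by have := prime_gt1 p_prime; lia.
  by [].
have -> : \sum_(v : 'F_p * 'F_p) psi (Q v) = \sum_(t : 'F_p) (fiber t)%:R * psi t.
  rewrite (partition_big Q xpredT)//=; apply: eq_bigr => t _.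
  rewrite (eq_bigr (fun=> psi t)); last by move=> v /eqP ->.
  rewrite /fiber -sum1dep_card natr_sum mulr_suml.
  by apply: eq_bigr => v _; rewrite mul1r.
have psi0 : psi 0 = 1 by rewrite /psi mul0r e2pi0.
rewrite (bigD1 0)//= psi0 mulr1; congr (_ + _).
rewrite (eq_bigr (fun t => (fiber 1)%:R * psi t)); last first.
  by move=> t t0; rewrite /fiber (card_fiber_const oddF D_neq0 t0).
rewrite -mulr_sumr.
by move: sum0; rewrite (bigD1 0)//= psi0 => /eqP; rewrite addrC addr_eq0 => /eqP ->; rewrite mulrN1.
Qed.

(** The total count [fiber 0 + (p - 1) * fiber 1 = p ^ 2] eliminates [fiber 1]. This matches the
    local factor of the stated main term, together with the factor at [p] of [totient q / q], with
    the sieve density. *)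
Lemma GQ_rho : (1 - GQ R a1 b1 c1 p 1 / p%:R ^+ 2) * (1 - p%:R^-1) =
  (1 - (rho a1 b1 c1 p)%:R / p%:R ^+ 2).
Proof.
have p0 : (p%:R : R[i]) != 0 by rewrite pnatr_eq0; have := prime_gt0 p_prime; lia.
have cf : (fiber 0%R + p.-1 * fiber 1%R = p ^ 2)%N by have := card_fibers oddF D_neq0; rewrite card_F.
rewrite GQ_fiber rho_fiber.
have h : (fiber 0)%:R + (p%:R - 1) * (fiber 1)%:R = p%:R ^+ 2 :> R[i].
  have pE : p%:R = p.-1%:R + 1 :> R[i] by rewrite natr1 prednK// prime_gt0.
  by rewrite {1}pE addrK -natrX -cf natrD natrM.
have -> : (fiber 0)%:R = p%:R ^+ 2 - (p%:R - 1) * (fiber 1)%:R :> R[i] by rewrite -h addrK.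
by field.
Qed.

End Gauss_sum.

(** * Weyl sums and short intervals *)

(** The index [m] stands for [k1 - k2 + s], shifted to remain a natural number, and [k] for [k2];
    the inner range is exactly the set of [k2] compatible with that difference, and is empty for
    [m = 0]. *)
Lemma pair_sum_by_difference (V : nmodType) (s : nat) (F : nat -> nat -> V) :
  \sum_(k1 < s) \sum_(k2 < s) F k1 k2 =
  \sum_(m < 2 * s) \sum_(s - m <= k < minn s (2 * s - m)) F (m + k - s)%N k.
Proof.
rewrite exchange_big /=.
have h2 m : \sum_(s - m <= k < minn s (2 * s - m)) F (m + k - s)%N k =
   \sum_(k < s | (s <= m + k < 2 * s)%N) F (m + k - s)%N k.
  rewrite -(big_mkord (fun k => (s <= m + k < 2 * s)%N) (fun k => F (m + k - s)%N k)).
  rewrite [RHS](@big_cat_nat _ _ _ (minn s (s - m)))//=; [|lia..].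
  rewrite [X in _ = X + _]big1_seq ?add0r; last first.
    by move=> k /andP[/andP[h1 _]]; rewrite mem_index_iota; lia.
  have [sm|sm] := leqP m s; last first.
    rewrite (_ : minn s (s - m) = s - m)%N; last by lia.
    rewrite [RHS](@big_cat_nat _ _ _ (minn s (2 * s - m)))//=; [|lia..].
    rewrite [X in _ = _ + X]big1_seq ?addr0; last first.
      by move=> k /andP[/andP[_ h1]]; rewrite mem_index_iota; lia.
    rewrite [RHS]big_seq_cond [LHS]big_seq; apply: eq_bigl => k.
    by rewrite mem_index_iota; lia.
  rewrite (_ : minn s (s - m) = s - m)%N; last by lia.
  rewrite (_ : minn s (2 * s - m) = s)%N; last by lia.
  rewrite [RHS]big_seq_cond [LHS]big_seq; apply: eq_bigl => k.
  by rewrite mem_index_iota; lia.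
under [RHS]eq_bigr do rewrite h2.
rewrite [RHS](exchange_big_dep xpredT)//=; apply: eq_bigr => k2 _.
rewrite -(big_mkord xpredT (fun k1 => F k1 k2)).
rewrite -(big_mkord (fun m => (s <= m + k2 < 2 * s)%N) (fun m => F (m + k2 - s)%N k2)).
have k2s := ltn_ord k2.
rewrite [RHS](@big_cat_nat _ _ _ (s - k2))//=; [|lia..].
rewrite [X in _ = X + _]big1_seq ?add0r; last first.
  by move=> k /andP[/andP[h1 _]]; rewrite mem_index_iota; lia.
rewrite [RHS](@big_cat_nat _ _ _ (2 * s - k2))//=; [|lia..].
rewrite [X in _ = _ + X]big1_seq ?addr0; last first.
  by move=> k /andP[/andP[_ h1]]; rewrite mem_index_iota; lia.
rewrite -{1}[(s - k2)%N]add0n big_addn.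
rewrite (_ : 2 * s - k2 - (s - k2) = s)%N; last by lia.
rewrite [RHS]big_seq_cond [LHS]big_seq; apply: congr_big => //.
  by move=> k; rewrite mem_index_iota; lia.
by move=> k _; congr (F _ _); lia.
Qed.

Lemma sum_injection_le (R : numDomainType) (T U : eqType) (f : T -> U) (s : seq T) (t : seq U)
    (F : U -> R) : uniq s -> uniq t -> {in s &, injective f} -> {in s, forall x, f x \in t} ->
  (forall y, 0 <= F y) -> \sum_(x <- s) F (f x) <= \sum_(y <- t) F y.
Proof.
move=> us ut fi ft F0; rewrite -(big_map f xpredT F).
have um : uniq (map f s) by rewrite map_inj_in_uniq.
rewrite [X in _ <= X](bigID (fun y => y \in map f s)) /= -[X in X <= _]addr0 lerD ?sumr_ge0//.
rewrite -[X in _ <= X]big_filter (@perm_big _ _ _ _ (map f s) [seq y <- t | y \in map f s])//.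
apply: uniq_perm => //; first exact: filter_uniq.
move=> y; rewrite mem_filter; case: (boolP (y \in map f s)) => //= /mapP[x xs ->].
by rewrite ft.
Qed.

Definition zrange (J : nat) : seq int := [seq i%:Z - J%:Z | i <- iota 0 (2 * J).+1].

Lemma mem_zrange (J : nat) (x : int) : (x \in zrange J) = (`|x| <= J%:Z).
Proof.
apply/mapP/idP => [[ i ]|h].
  by rewrite mem_iota => ih ->; lia.
by exists (absz (x + J%:Z)); [rewrite mem_iota; lia|lia].
Qed.

Lemma zrange_uniq (J : nat) : uniq (zrange J).
Proof. by rewrite map_inj_uniq ?iota_uniq// => i j; lia. Qed.

Section Weyl.
Variables (R : realType) (a1 b1 c1 : int).
Hypothesis Delta_gt0 : 0 < bqf_Delta a1 b1 c1.

(** It dominates the coefficient sums [2 |a1| + |b1|] and [|b1| + 2 |c1|] of both partial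
    derivatives of the form. *)
Definition bqf_height : nat := (2 * (`|a1| + `|b1| + `|c1|))%N.

(* Weyl differencing turns the square of the sum into a double sum of products of two
   geometric sums, with ratios the two partial derivatives of the form at the difference vector. *)
Lemma weyl_box_bound (q : nat) (h : int) (d K s t : nat) (x0 y0 : int) : (0 < q)%N -> (0 < d)%N ->
  (s <= K)%N -> (t <= K)%N ->
  normc (\sum_(k < s) \sum_(l < t)
    e2pi ((h * bqf a1 b1 c1 (x0 + d%:Z * (k : nat)%:Z) (y0 + d%:Z * (l : nat)%:Z))%:~R / q%:R : R))
  <= \sum_(j <- zrange (bqf_height * d ^ 2 * K)) gsum_bound q K%:R (h * j).
Proof.
move=> q0 d0 sK tK.
set Q := bqf a1 b1 c1.
pose E (z : int) : R[i] := e2pi (z%:~R / q%:R : R).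
have ED x y : E (x + y) = E x * E y by rewrite /E intrD mulrDl e2piD.
have EN x : E (- x) = (E x)^*%C by rewrite /E mulrNz mulNr e2piN.
set S := \sum_(k < s) _; set B := \sum_(j <- _) _.
have gb0 r : 0 <= gsum_bound q (K%:R : R) r.
  rewrite /gsum_bound; case: ifP => // _.
  have m0 := @modz_ge0 r q%:Z; have mq := @ltz_pmod r q%:Z.
  by rewrite addr_ge0// divr_ge0// ?mulr_ge0// ler0z; lia.
have B0 : 0 <= B by apply: sumr_ge0.
have Sc : (S^*)%C = \sum_(k < s) \sum_(l < t)
    E (- (h * Q (x0 + d%:Z * (k : nat)%:Z) (y0 + d%:Z * (l : nat)%:Z))).
  rewrite rmorph_sum; apply: eq_bigr => k _; rewrite rmorph_sum; apply: eq_bigr => l _.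
  by rewrite EN.
pose f (k l : nat) := h * Q (x0 + d%:Z * k%:Z) (y0 + d%:Z * l%:Z).
have SS : S * (S^*)%C = \sum_(k1 < s) \sum_(k2 < s) \sum_(l1 < t) \sum_(l2 < t)
    E (f k1 l1 - f k2 l2).
  rewrite Sc mulr_suml; apply: eq_bigr => k1 _.
  rewrite mulr_sumr; apply: eq_bigr => k2 _.
  rewrite mulr_suml; apply: eq_bigr => l1 _.
  by rewrite mulr_sumr; apply: eq_bigr => l2 _; rewrite ED.
(* These are [d ^ 2] times the partial derivatives of the form at the difference vector
   [(m - s, n - t)]. *)
pose L1 (m n : nat) : int := d%:Z ^+ 2 * (2 * a1 * (m%:Z - s%:Z) + b1 * (n%:Z - t%:Z)).
pose L2 (m n : nat) : int := d%:Z ^+ 2 * (b1 * (m%:Z - s%:Z) + 2 * c1 * (n%:Z - t%:Z)).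
(* For a fixed difference vector the phase is affine in [k] and [l]: its constant part has norm 1,
   and its linear part factors into two geometric sums. *)
have SS2 : S * (S^*)%C = \sum_(m < 2 * s) \sum_(n < 2 * t)
    E (f 0%N 0%N - f 0%N 0%N + (h * (Q (x0 + d%:Z * ((m : nat)%:Z - s%:Z)) (y0 + d%:Z * ((n : nat)%:Z - t%:Z)) - Q x0 y0))) *
    ((\sum_(s - m <= k < minn s (2 * s - m)) e2pi ((h * L1 m n)%:~R / q%:R * k%:R : R)) *
     (\sum_(t - n <= l < minn t (2 * t - n)) e2pi ((h * L2 m n)%:~R / q%:R * l%:R : R))).
  rewrite SS (pair_sum_by_difference s (fun k1 k2 => \sum_(l1 < t) \sum_(l2 < t) E (f k1 l1 - f k2 l2))).
  apply: eq_bigr => m _.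
  under eq_bigr do rewrite (pair_sum_by_difference t (fun l1 l2 => E (f _ l1 - f _ l2))).
  rewrite exchange_big /=; apply: eq_bigr => n _.
  rewrite mulr_suml mulr_sumr big_seq [RHS]big_seq; apply: eq_bigr => k; rewrite mem_index_iota => kb.
  rewrite !mulr_sumr big_seq [RHS]big_seq; apply: eq_bigr => l; rewrite mem_index_iota => lb.
  have e1 (z : int) (i : nat) : e2pi (z%:~R / q%:R * i%:R : R) = E (z * i%:Z).
    by rewrite /E intrM -[(Posz i)%:~R]/(i%:R); congr e2pi; ring.
  rewrite !e1 -!ED; congr E.
  rewrite {1}/f.
  have -> : h * Q (x0 + d%:Z * (m + k - s)%N%:Z) (y0 + d%:Z * (n + l - t)%N%:Z) = h * Q (x0 + d%:Z * ((m : nat)%:Z - s%:Z) + d%:Z * k%:Z)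
       (y0 + d%:Z * ((n : nat)%:Z - t%:Z) + d%:Z * l%:Z).
    have -> : (m + k - s)%N%:Z = (m : nat)%:Z - s%:Z + k%:Z by lia.
    have -> : (n + l - t)%N%:Z = (n : nat)%:Z - t%:Z + l%:Z by lia.
    by congr (h * Q _ _); ring.
  by rewrite /f /L1 /L2 /Q /bqf; ring.
have nE z : normc (E z) = 1 by rewrite /E normc_e2pi.
have S2 : normc S ^+ 2 <= B ^+ 2.
  rewrite expr2 -{2}(normc_conj S) -normcM SS2.
  apply: (@le_trans _ _ (\sum_(m < 2 * s) \sum_(n < 2 * t)
     gsum_bound q (K%:R : R) (h * L1 m n) * gsum_bound q K%:R (h * L2 m n))).
    apply: le_trans (normc_sum _ _ _) _; apply: ler_sum => m _.
    apply: le_trans (normc_sum _ _ _) _; apply: ler_sum => n _.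
    rewrite !normcM nE mul1r; apply: ler_pM; rewrite ?normc_ge0//.
      by apply: geometric_e2pi_bound => //; rewrite ler_nat; lia.
    by apply: geometric_e2pi_bound => //; rewrite ler_nat; lia.
  pose J := (bqf_height * d ^ 2 * K)%N.
  have -> : B ^+ 2 = \sum_(jj <- [seq (i, j) | i <- zrange J, j <- zrange J])
      gsum_bound q (K%:R : R) (h * jj.1) * gsum_bound q K%:R (h * jj.2).
    rewrite big_allpairs expr2 mulr_suml; apply: eq_bigr => i _.
    by rewrite mulr_sumr.
  have -> : \sum_(m < 2 * s) \sum_(n < 2 * t)
     gsum_bound q (K%:R : R) (h * L1 m n) * gsum_bound q K%:R (h * L2 m n) =
     \sum_(mn <- [seq (m, n) | m <- iota 0 (2 * s), n <- iota 0 (2 * t)])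
     gsum_bound q (K%:R : R) (h * (L1 mn.1 mn.2, L2 mn.1 mn.2).1) * gsum_bound q K%:R (h * (L1 mn.1 mn.2, L2 mn.1 mn.2).2).
    rewrite big_allpairs.
    rewrite -(big_mkord xpredT (fun m => \sum_(n < 2 * t)
     gsum_bound q (K%:R : R) (h * L1 m n) * gsum_bound q K%:R (h * L2 m n))) /index_iota !subn0.
    apply: eq_bigr => m _.
    by rewrite -(big_mkord xpredT (fun n => gsum_bound q (K%:R : R) (h * L1 m n) * gsum_bound q K%:R (h * L2 m n))) /index_iota !subn0.
  (* The map from difference vectors to frequency pairs is linear of determinant [d ^ 4 * Delta],
     hence injective. Its image lies in the square of the frequency range, so the double sum is at
     most [B ^ 2], and the square root taken afterwards leaves a single sum over [j]. *)
  apply: (sum_injection_le (f := fun mn => (L1 mn.1 mn.2, L2 mn.1 mn.2))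
     (F := fun jj => gsum_bound q (K%:R : R) (h * jj.1) * gsum_bound q K%:R (h * jj.2))).
  - by apply: allpairs_uniq; rewrite ?iota_uniq// => -[x y] [x' y'].
  - by apply: allpairs_uniq; rewrite ?zrange_uniq// => -[x y] [x' y'].
  - move=> [m n] [m' n'] _ _ [] e1 e2.
    have dz : d%:Z ^+ 2 != 0 by rewrite expf_neq0//; lia.
    have {}e1 := mulfI dz e1; have {}e2 := mulfI dz e2.
    pose u : int := m%:Z - m'%:Z; pose v : int := n%:Z - n'%:Z.
    have f1 : 2 * a1 * u + b1 * v = 0.
      by have := e1; rewrite /u /v /=; move/eqP; rewrite -subr_eq0 => /eqP <-; ring.
    have f2 : b1 * u + 2 * c1 * v = 0.
      by have := e2; rewrite /u /v /=; move/eqP; rewrite -subr_eq0 => /eqP <-; ring.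
    have Dn : bqf_Delta a1 b1 c1 != 0 by rewrite gt_eqF.
    have u0 : u = 0.
      apply: (mulfI Dn); rewrite mulr0.
      have -> : bqf_Delta a1 b1 c1 * u = 2 * c1 * (2 * a1 * u + b1 * v) - b1 * (b1 * u + 2 * c1 * v).
        by rewrite /bqf_Delta; ring.
      by rewrite f1 f2 !mulr0 subrr.
    have v0 : v = 0.
      apply: (mulfI Dn); rewrite mulr0.
      have -> : bqf_Delta a1 b1 c1 * v = 2 * a1 * (b1 * u + 2 * c1 * v) - b1 * (2 * a1 * u + b1 * v).
        by rewrite /bqf_Delta; ring.
      by rewrite f1 f2 !mulr0 subrr.
    by move: u0 v0; rewrite /u /v => u0 v0; congr (_, _); lia.
  - move=> _ /allpairsP[[m n] [mi ni ->]].
    have mi' : (m < 2 * s)%N by move: mi; rewrite mem_iota.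
    have ni' : (n < 2 * t)%N by move: ni; rewrite mem_iota.
    have K1 : `|m%:Z - s%:Z| <= K%:Z by clear -mi' sK; lia.
    have K2 : `|n%:Z - t%:Z| <= K%:Z by clear -ni' tK; lia.
    have JE : J%:Z = d%:Z ^+ 2 * (2 * (`|a1| + `|b1| + `|c1|) * K%:Z).
      by rewrite /J /bqf_height !PoszM !PoszD !abszE; ring.
    have n1 (x : int) : 0 <= `|x| by [].
    suff [h1 h2] : L1 m n \in zrange J /\ L2 m n \in zrange J by apply: allpairs_f.
    rewrite !mem_zrange JE /L1 /L2; split; rewrite normrM ger0_norm ?sqr_ge0// ler_wpM2l ?sqr_ge0//.
      apply: le_trans (ler_normD _ _) _; rewrite !normrM.
      apply: (@le_trans _ _ (`|2 : int| * `|a1| * K%:Z + `|b1| * K%:Z)).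
        by apply: lerD; apply: ler_wpM2l.
      have := n1 a1; have := n1 b1; have := n1 c1; have : 0 <= K%:Z by [].
      by rewrite (_ : `|2%:Z| = 2)//; move: (Num.norm a1) (Num.norm b1) (Num.norm c1) => x y z; clear; nia.
    apply: le_trans (ler_normD _ _) _; rewrite !normrM.
    apply: (@le_trans _ _ (`|b1| * K%:Z + `|2 : int| * `|c1| * K%:Z)).
      by apply: lerD; apply: ler_wpM2l.
    have := n1 a1; have := n1 b1; have := n1 c1; have : 0 <= K%:Z by [].
    by rewrite (_ : `|2%:Z| = 2)//; move: (Num.norm a1) (Num.norm b1) (Num.norm c1) => x y z; clear; nia.
  - by move=> jj; rewrite mulr_ge0.
by move: S2; rewrite ler_sqr ?nnegrE ?normc_ge0.
Qed.

End Weyl.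

(** * Averaging the Weyl bounds over the frequencies *)

Section Dual_sum.
Variable R : realType.

Definition harmonic_sum (n : nat) : R := \sum_(1 <= k < n) k%:R^-1.

Lemma harmonic_sum_ge0 n : 0 <= harmonic_sum n.
Proof. by apply: sumr_ge0 => k _; rewrite invr_ge0. Qed.

Lemma harmonic_sum_le (n : nat) : (0 < n)%N -> harmonic_sum n <= 1 + ln n%:R.
Proof.
case: n => // n _.
have step (k : nat) : k.+2%:R^-1 <= ln k.+2%:R - ln k.+1%:R :> R.
  rewrite -ln_div ?posrE ?ltr0n// -[X in _ <= X]opprK -lnV ?posrE ?divr_gt0 ?ltr0n// invf_div.
  have h : k.+1%:R / k.+2%:R = 1 + (- k.+2%:R^-1) :> R.
    have -> : k.+1%:R = k.+2%:R - 1 :> R by rewrite -[k.+2%:R]natr1 addrK.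
    by rewrite mulrBl divff ?pnatr_eq0// mul1r.
  rewrite h lerNr; apply: le_ln1Dx.
  by rewrite ltrN2 invf_lt1 ?ltr0n// ltr1n.
have main m : \sum_(1 <= k < m.+2) (k%:R^-1 : R) <= 1 + ln m.+1%:R.
  elim: m => [|m IH]; first by rewrite big_nat1 invr1 ln1 addr0.
  rewrite big_nat_recr//; apply: le_trans (lerD IH (step m)) _.
  by rewrite le_eqVlt; apply/orP; left; apply/eqP; move: (ln _) (ln _) => u v; ring.
rewrite /harmonic_sum; case: n => [|n]; first by rewrite big_geq// ln1 addr0.
apply: le_trans (main n) _; rewrite lerD2l ler_ln ?posrE ?ltr0n// ler_nat; lia.
Qed.

Lemma minD_le (x y z : R) : 0 <= x -> 0 <= y -> 0 <= z ->
  Num.min x (y + z) <= Num.min x y + Num.min x z.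
Proof.
move=> x0 y0 z0.
by case: (leP x y) => h1; case: (leP x z) => h2; case: (leP x (y + z)) => h3; lra.
Qed.

Lemma gsum_bound_ge0 (q : nat) (K : R) (r : int) : (0 < q)%N -> 0 <= K -> 0 <= gsum_bound q K r.
Proof.
move=> q0 K0; rewrite /gsum_bound; case: ifP => // _.
have m0 := @modz_ge0 r q%:Z; have mq := @ltz_pmod r q%:Z.
by rewrite addr_ge0// divr_ge0// ?mulr_ge0// ler0z; lia.
Qed.

Lemma gsum_bound_eqmod (q : nat) (K : R) (r s : int) : (q%:Z %| r - s)%Z ->
  gsum_bound q K r = gsum_bound q K s.
Proof.
move=> /dvdzP[k kE].
have -> : r = k * q%:Z + s by rewrite -kE; ring.
by rewrite /gsum_bound modzMDl rpredDl// dvdz_mull.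
Qed.

Lemma gsum_boundN (q : nat) (K : R) (r : int) : (0 < q)%N ->
  gsum_bound q K (- r) = gsum_bound q K r.
Proof.
move=> q0; rewrite /gsum_bound rpredN; case: ifPn => // qr.
have mE : (- r %% q%:Z)%Z = q%:Z - (r %% q%:Z)%Z.
  have -> : - r = (- (r %/ q%:Z)%Z - 1) * q%:Z + (q%:Z - (r %% q%:Z)%Z).
    by rewrite {1}(divz_eq r q%:Z); ring.
  rewrite modzMDl modz_small//.
  have m0 := @modz_ge0 r q%:Z; have mq := @ltz_pmod r q%:Z.
  have : (r %% q%:Z)%Z != 0 by apply: contra qr => /eqP h; apply/dvdz_mod0P.
  by lia.
rewrite mE; have -> : q%:Z - (q%:Z - (r %% q%:Z)%Z) = (r %% q%:Z)%Z by ring.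
by rewrite addrC.
Qed.

Lemma sum_gsum_bound (q : nat) (K : R) : (0 < q)%N ->
  \sum_(r < q) gsum_bound q K (r : nat)%:Z = K + 4 * q%:R * harmonic_sum q.
Proof.
case: q => // q _; rewrite big_ord_recl /= {1}/gsum_bound dvdz0; congr (_ + _).
transitivity (\sum_(1 <= r < q.+1) (2 * q.+1%:R / r%:R + 2 * q.+1%:R / (q.+1 - r)%N%:R) : R).
  rewrite big_add1 /= big_mkord; apply: eq_bigr => r _.
  rewrite /bump /= add1n /gsum_bound ifN; last first.
    by apply/negP => /dvdz_mod0P; rewrite modz_small; have := ltn_ord r; lia.
  rewrite modz_small; last by have := ltn_ord r; lia.
  by rewrite subzn//; have := ltn_ord r; lia.
rewrite big_split /= [X in _ + X]big_nat_rev /= -!mulr_sumr.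
have -> : \sum_(1 <= i < q.+1) (q.+1 - (1 + q.+1 - i.+1))%:R^-1 = harmonic_sum q.+1.
  rewrite /harmonic_sum big_nat [RHS]big_nat; apply: eq_bigr => i ib; congr (_%:R^-1); lia.
by rewrite -/(harmonic_sum q.+1); ring.
Qed.

(** Multiplication by the unit [a] permutes the residues modulo [q], so over a block of length [q]
    the factor [a] has no effect. *)
Lemma sum_gsum_bound_mul (q : nat) (K : R) (a : int) (m : nat) : (0 < q)%N -> coprimez a q%:Z ->
  \sum_(0 <= r < q) gsum_bound q K (a * (m * q + r)%N%:Z) = K + 4 * q%:R * harmonic_sum q.
Proof.
move=> q0 caq; rewrite -sum_gsum_bound// big_mkord.
have lt (r : 'I_q) : (absz (a * (r : nat)%:Z %% q%:Z)%Z < q)%N.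
  have m0 := @modz_ge0 (a * (r : nat)%:Z) q%:Z; have mq := @ltz_pmod (a * (r : nat)%:Z) q%:Z.
  by lia.
pose h (r : 'I_q) : 'I_q := Ordinal (lt r).
have m0 z : 0 <= (z %% q%:Z)%Z by apply: modz_ge0; lia.
have hi : injective h.
  move=> r s /(congr1 val) /= e.
  have {}e : (a * (r : nat)%:Z = a * (s : nat)%:Z %[mod q%:Z])%Z.
    by have := m0 (a * (r : nat)%:Z); have := m0 (a * (s : nat)%:Z); move: e; lia.
  have : (q%:Z %| a * ((r : nat)%:Z - (s : nat)%:Z))%Z.
    by rewrite mulrBr; move/eqP: e; rewrite eqz_mod_dvd.
  rewrite Gauss_dvdzr; last by rewrite coprimez_sym.
  move=> /dvdzP[k kE]; apply: val_inj => /=.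
  move: (ltn_ord r) (ltn_ord s) kE; move: (nat_of_ord r) (nat_of_ord s) => x y.
  clear; case: (ltrgtP k 0) => [k0|k0|->] xq yq; last by lia.
    by have : k * q%:Z <= - q%:Z; [nia|lia].
  by have : q%:Z <= k * q%:Z; [nia|lia].
rewrite [RHS](reindex_inj hi); apply: eq_bigr => r _ /=.
apply: gsum_bound_eqmod.
rewrite gez0_abs//.
have -> : a * (m * q + r)%N%:Z - (a * (r : nat)%:Z %% q%:Z)%Z =
  (a * m%:Z + (a * (r : nat)%:Z %/ q%:Z)%Z) * q%:Z.
  by rewrite PoszD PoszM mulrDr {1}(divz_eq (a * (r : nat)%:Z) q%:Z); ring.
exact: dvdz_mull.
Qed.

(** An integer [k] arises as a product [h * j] at most as often as it has divisors [h]. *)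
Lemma sum_products_le (q J T : nat) (F : nat -> R) : (forall k, 0 <= F k) ->
  (forall k, (0 < k < q * J)%N -> (size (divisors k) <= T)%N) ->
  \sum_(1 <= h < q) \sum_(1 <= j < J.+1) F (h * j)%N <= T%:R * \sum_(0 <= k < q * J) F k.
Proof.
move=> F0 hT.
have -> : \sum_(1 <= h < q) \sum_(1 <= j < J.+1) F (h * j)%N =
   \sum_(1 <= h < q) \sum_(1 <= j < J.+1) \sum_(0 <= k < q * J) (k == (h * j)%N)%:R * F k.
  rewrite big_nat [RHS]big_nat; apply: eq_bigr => h hb.
  rewrite big_nat [RHS]big_nat; apply: eq_bigr => j jb.
  rewrite (bigD1_seq (h * j)%N) ?iota_uniq//=; last by rewrite mem_index_iota; nia.
  by rewrite eqxx mul1r big1 ?addr0// => k /negbTE ->; rewrite mul0r.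
have -> : \sum_(1 <= h < q) \sum_(1 <= j < J.+1) \sum_(0 <= k < q * J) (k == (h * j)%N)%:R * F k
  = \sum_(0 <= k < q * J) (\sum_(1 <= h < q) \sum_(1 <= j < J.+1) (k == (h * j)%N)%:R) * F k.
  under eq_bigr do rewrite exchange_big.
  rewrite exchange_big /=; apply: eq_bigr => k _.
  by rewrite mulr_suml; apply: eq_bigr => h _; rewrite mulr_suml.
rewrite mulr_sumr big_nat [X in _ <= X]big_nat; apply: ler_sum => k /andP[_ kb].
rewrite ler_wpM2r//.
have [->|k0] := posnP k.
  rewrite big_nat big1 ?ler0n// => h hb; rewrite big_nat big1// => j jb.
  by case: eqP => //; nia.
apply: (@le_trans _ _ (\sum_(1 <= h < q) (h %| k)%N%:R)).
  rewrite big_nat [X in _ <= X]big_nat; apply: ler_sum => h hb.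
  case: (boolP (h %| k)%N) => hk.
    have [kh|kh] := boolP ((k %/ h)%N \in index_iota 1 J.+1).
      rewrite (bigD1_seq (k %/ h)%N) ?iota_uniq//= big1 ?addr0.
        by rewrite ler_nat; case: (_ == _).
      move=> j /negbTE jk; case: eqP => // kE.
      by move: jk; rewrite kE mulKn ?eqxx//; lia.
    rewrite big_seq big1 ?ler0n// => j jb; case: eqP => // kE.
    by move: kh; rewrite kE mulKn ?jb//; lia.
  rewrite big1// => j _; case: eqP => // kE.
  by move: hk; rewrite kE dvdn_mulr.
rewrite -natr_sum ler_nat; apply: leq_trans (hT k _); last by rewrite k0.
rewrite (_ : (\sum_(1 <= h < q) (h %| k) = size [seq h <- index_iota 1 q | (h %| k)])%N).
  apply: uniq_leq_size; first by rewrite filter_uniq// iota_uniq.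
  by move=> h; rewrite mem_filter -dvdn_divisors// => /andP[].
by rewrite size_filter -sum1_count [RHS]big_mkcond; apply: eq_bigr => h _; case: (h %| k)%N.
Qed.

(** The term [j = 0] gives the summand with [K]. Otherwise the product [k = h j] is taken as a
    single variable, at the cost [T] of its factorisations, and [k] is cut into blocks of length
    [q]. On each block the geometric bounds at [a k] have mean about [log q], because [a] is a unit,
    while the kernel of the short interval is essentially constant. *)
Lemma dual_sum_bound (q J K l T : nat) (a : int) : (0 < q)%N -> coprimez a q%:Z -> (K <= q)%N ->
  (forall k, (0 < k < q * J)%N -> (size (divisors k) <= T)%N) ->
  \sum_(1 <= h < q) Num.min (2 * l%:R + 1) (gsum_bound q 0 h%:Z) *
     (\sum_(j <- zrange J) gsum_bound q K%:R (a * h%:Z * j))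
  <= q%:R * (8 * K%:R * harmonic_sum q +
     4 * T%:R * (1 + 4 * harmonic_sum q) * (2 * l%:R + 1 + 2 * J%:R * harmonic_sum J)) :> R.
Proof.
move=> q0 caq Kq hT.
have q0R : (0 : R) < q%:R by rewrite ltr0n.
have H0 := harmonic_sum_ge0 q.
pose g r : R := gsum_bound q K%:R r.
have g0 r : 0 <= g r by apply: gsum_bound_ge0.
have gN r : g (- r) = g r by apply: gsum_boundN.
pose A (h : int) := \sum_(j <- zrange J) g (a * h * j).
have zrE (F : int -> R) : \sum_(j <- zrange J) F j = F 0 + \sum_(1 <= j < J.+1) (F j%:Z + F (- j%:Z)).
  rewrite /zrange big_map -[iota 0 (2 * J).+1]/(iota 0 (2 * J).+1).
  have -> : iota 0 (2 * J).+1 = index_iota 0 (2 * J).+1 by rewrite /index_iota subn0.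
  rewrite (@big_cat_nat _ _ _ J)//=; last by lia.
  rewrite [X in _ + X]big_ltn ?subrr; last by lia.
  rewrite big_split /= addrCA; congr (_ + _); rewrite addrC; congr (_ + _).
    rewrite -[J.+1]add1n big_addn.
    rewrite (_ : ((2 * J).+1 - J = J.+1)%N); last by lia.
    by apply: eq_bigr => i _; congr F; lia.
  rewrite [RHS]big_add1 /= big_nat_rev /= big_nat [RHS]big_nat.
  by apply: eq_bigr => i ib; congr F; lia.
have AE h : A h = K%:R + 2 * \sum_(1 <= j < J.+1) g (a * h * j%:Z).
  rewrite /A zrE mulr0; congr (_ + _); first by rewrite /g /gsum_bound dvdz0.
  rewrite mulr_sumr; apply: eq_bigr => j _; rewrite mulrN gN; ring.
pose m (h : nat) : R := Num.min (2 * l%:R + 1) (2 * q%:R / h%:R).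
have l0 : (0 : R) <= 2 * l%:R + 1 by rewrite addr_ge0// mulr_ge0.
have m0 h : 0 <= m h by rewrite /m le_min l0 divr_ge0// mulr_ge0.
(* Only the pole of the kernel at 0 is kept: the inner sum [A] is even and periodic modulo [q], so
   the pole at [q] gives the same contribution under [h -> q - h]. *)
have S1 : \sum_(1 <= h < q) Num.min (2 * l%:R + 1) (gsum_bound q 0 h%:Z) * A h%:Z <=
    2 * \sum_(1 <= h < q) m h * A h%:Z.
  have A0 h : 0 <= A h by apply: sumr_ge0.
  apply: (@le_trans _ _ (\sum_(1 <= h < q) (m h * A h%:Z + m (q - h)%N * A h%:Z))).
    rewrite big_nat [X in _ <= X]big_nat; apply: ler_sum => h hb.
    rewrite -mulrDl ler_wpM2r// /gsum_bound ifN; last first.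
      by apply/negP => /dvdz_mod0P; rewrite modz_small; lia.
    rewrite modz_small; last by lia.
    rewrite subzn; last by lia.
    rewrite -[(Posz h)%:~R]/(h%:R : R) -[(Posz (q - h))%:~R]/((q - h)%N%:R : R) /m.
    have x0 : 0 <= 2 * q%:R / h%:R :> R by rewrite divr_ge0// mulr_ge0.
    have y0 : 0 <= 2 * q%:R / (q - h)%N%:R :> R by rewrite divr_ge0// mulr_ge0.
    exact: minD_le.
  rewrite big_split /= -[X in _ <= X * _]/(1 + 1) mulrDl mul1r lerD2l.
  rewrite big_nat_rev /= big_nat [X in _ <= X]big_nat.
  apply: ler_sum => h hb.
  have -> : (q - (1 + q - h.+1) = h)%N by lia.
  rewrite ler_wpM2l// le_eqVlt; apply/orP; left; apply/eqP.
  rewrite !AE; congr (_ + 2 * _); apply: eq_bigr => j _.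
  rewrite -[RHS]gN; apply: gsum_bound_eqmod.
  have -> : (1 + q - h.+1)%N%:Z = q%:Z - h%:Z by lia.
  have -> : a * (q%:Z - h%:Z) * j%:Z - - (a * h%:Z * j%:Z) = a * j%:Z * q%:Z by ring.
  exact: dvdz_mull.
have S2 : \sum_(1 <= h < q) m h * K%:R <= 2 * q%:R * K%:R * harmonic_sum q.
  rewrite -mulr_suml mulrAC ler_wpM2r// /harmonic_sum mulr_sumr.
  by apply: ler_sum => h _; rewrite /m ge_min lexx orbT.
(* Since [j <= J], the kernel bound [q / h] is at most [q J / k] for [k = h j], so it becomes a
   function of [k] alone; on the block of index [i > 0] it is at most [2 J / i]. *)
pose M (k : nat) : R := Num.min (2 * l%:R + 1) (2 * q%:R * J%:R / k%:R).
have M0 k : 0 <= M k by rewrite /M le_min l0 divr_ge0// !mulr_ge0.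
pose G : R := K%:R + 4 * q%:R * harmonic_sum q.
have G0 : 0 <= G by rewrite addr_ge0// !mulr_ge0.
have S3 : \sum_(1 <= h < q) \sum_(1 <= j < J.+1) m h * g (a * h%:Z * j%:Z) <=
    T%:R * (G * (2 * l%:R + 1 + 2 * J%:R * harmonic_sum J)).
  apply: (@le_trans _ _ (\sum_(1 <= h < q) \sum_(1 <= j < J.+1) M (h * j)%N * g (a * (h * j)%N%:Z))).
    rewrite big_nat [X in _ <= X]big_nat; apply: ler_sum => h hb.
    rewrite big_nat [X in _ <= X]big_nat; apply: ler_sum => j jb.
    rewrite PoszM mulrA ler_wpM2r// /M /m le_min ge_min lexx /= ge_min; apply/orP; right.
    have h0 : (0 : R) < h%:R by rewrite ltr0n; lia.
    have j0 : (0 : R) < j%:R by rewrite ltr0n; lia.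
    rewrite natrM ler_pdivlMr ?mulr_gt0// mulrA divfK ?gt_eqF// ler_wpM2l ?mulr_ge0//.
    by rewrite ler_nat; lia.
  apply: le_trans (@sum_products_le q J T (fun k => M k * g (a * k%:Z)) _ hT) _.
    by move=> k; rewrite mulr_ge0.
  rewrite ler_wpM2l// mulnC big_nat_mul.
  have blk i : \sum_(0 <= j < q) M (i * q + j)%N * g (a * (i * q + j)%N%:Z) <=
      G * (if i == 0%N then 2 * l%:R + 1 else 2 * J%:R / i%:R).
    rewrite /G -(@sum_gsum_bound_mul q K%:R a i)// mulr_suml.
    apply: ler_sum => j _; rewrite mulrC ler_wpM2l//.
    case: eqP => [->|i0]; first by rewrite /M ge_min lexx.
    rewrite /M ge_min; apply/orP; right.
    have i0R : (0 : R) < i%:R by rewrite ltr0n; lia.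
    have k0 : (0 : R) < (i * q + j)%N%:R by rewrite ltr0n; nia.
    rewrite ler_pdivrMr// [X in _ <= X]mulrAC ler_pdivlMr// natrD natrM.
    have : (0 : R) <= j%:R by [].
    have : (0 : R) <= J%:R by [].
    move: (j%:R : R) (J%:R : R) (i%:R : R) (q%:R : R) => jj JJ ii qq; nra.
  have shift i (F : nat -> R) : \sum_(i * q <= j < i.+1 * q) F j = \sum_(0 <= j < q) F (i * q + j)%N.
    rewrite -{1}[(i * q)%N]add0n big_addn mulSn addnK.
    by apply: eq_bigr => j _; rewrite addnC.
  apply: (@le_trans _ _ (\sum_(0 <= i < J) G * (if i == 0%N then 2 * l%:R + 1 else 2 * J%:R / i%:R))).
    by apply: ler_sum => i _; rewrite shift.
  rewrite -mulr_sumr ler_wpM2l//.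
  case: (J) => [|J']; first by rewrite big_geq// addr_ge0// mulr_ge0// harmonic_sum_ge0.
  rewrite big_ltn//= lerD2l /harmonic_sum mulr_sumr big_nat [X in _ <= X]big_nat.
  by apply: ler_sum => i ib; case: eqP => //; lia.
have S4 : \sum_(1 <= h < q) m h * A h%:Z <= 2 * q%:R * K%:R * harmonic_sum q +
   2 * (T%:R * (G * (2 * l%:R + 1 + 2 * J%:R * harmonic_sum J))).
  under eq_bigr do rewrite AE mulrDr.
  rewrite big_split /=; apply: lerD => //.
  apply: le_trans (_ : 2 * \sum_(1 <= h < q) \sum_(1 <= j < J.+1) m h * g (a * h%:Z * j%:Z) <= _).
    rewrite mulr_sumr; apply: ler_sum => h _.
    by rewrite mulrCA -mulr_sumr.
  by rewrite ler_wpM2l.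
apply: le_trans S1 _.
have G1 : G <= q%:R * (1 + 4 * harmonic_sum q).
  have : K%:R <= q%:R :> R by rewrite ler_nat.
  by rewrite /G; nra.
have HJ := harmonic_sum_ge0 J.
have z0 : 0 <= T%:R * (2 * l%:R + 1 + 2 * J%:R * harmonic_sum J) :> R.
  by rewrite mulr_ge0// addr_ge0// !mulr_ge0.
have e0 : 0 <= q%:R * K%:R * harmonic_sum q by rewrite !mulr_ge0.
have := ler_wpM2r z0 G1; move: S4.
move: (\sum_(_ <= _ < _) _) => X; move: (2 * l%:R + 1 + _) => Z; clear -e0; lra.
Qed.

End Dual_sum.

(** * Equidistribution of the values of the form on a residue class *)

Section Class_sums.
Variables (R : realType) (a1 b1 c1 : int).
Hypothesis Delta_gt0 : 0 < bqf_Delta a1 b1 c1.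

Lemma abel_summation (C : comNzRingType) (K : nat) (f e : nat -> C) : f K = 0 ->
  \sum_(k < K) f k * e k = \sum_(s < K) (f s - f s.+1) * \sum_(k < s.+1) e k.
Proof.
have main : \sum_(k < K) f k * e k =
    \sum_(s < K) (f s - f s.+1) * (\sum_(k < s.+1) e k) + f K * \sum_(k < K) e k.
  elim: K => [|K IH]; first by rewrite !big_ord0 mulr0 addr0.
  by rewrite big_ord_recr /= IH [in RHS]big_ord_recr /= big_ord_recr /=; ring.
by move=> fK; rewrite main fK mul0r addr0.
Qed.

Definition mixed_difference (W : nat -> nat -> R) (s t : nat) : R :=
  W s t - W s.+1 t - (W s t.+1 - W s.+1 t.+1).

Lemma abel_summation2 (K : nat) (W : nat -> nat -> R) (e : nat -> nat -> R[i]) :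
  (forall l, W K l = 0) -> (forall k, W k K = 0) ->
  \sum_(k < K) \sum_(l < K) (W k l)%:C * e k l =
  \sum_(s < K) \sum_(t < K) (mixed_difference W s t)%:C * \sum_(k < s.+1) \sum_(l < t.+1) e k l.
Proof.
move=> W1 W2.
transitivity (\sum_(k < K) \sum_(t < K) (W k t - W k t.+1)%:C * \sum_(l < t.+1) e k l).
  apply: eq_bigr => k _.
  rewrite (@abel_summation _ K (fun l => (W k l)%:C) (e k)); last by rewrite W2.
  by apply: eq_bigr => t _; rewrite rmorphB.
rewrite exchange_big [RHS]exchange_big /=; apply: eq_bigr => t _.
rewrite (@abel_summation _ K (fun k => (W k t - W k t.+1)%:C) (fun k => \sum_(l < t.+1) e k l)); last first.
  by rewrite !W1 subrr.
apply: eq_bigr => s _; rewrite /mixed_difference -rmorphB; congr (_%:C * _); ring.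
Qed.

(** Abel summation in both variables writes the sum as a combination of unweighted sums over boxes
    [[0, s] x [0, t]]. Each obeys the same Weyl bound with side [K], so only the total mixed
    variation of the weight enters. *)
Lemma weighted_class_bound (q : nat) (h : int) (d K : nat) (x0 y0 : int) (W : nat -> nat -> R) (V : R) :
  (0 < q)%N -> (0 < d)%N ->
  (forall l, W K l = 0) -> (forall k, W k K = 0) ->
  \sum_(s < K) \sum_(t < K) `|mixed_difference W s t| <= V ->
  normc (\sum_(k < K) \sum_(l < K) (W k l)%:C *
    e2pi ((h * bqf a1 b1 c1 (x0 + d%:Z * (k : nat)%:Z) (y0 + d%:Z * (l : nat)%:Z))%:~R / q%:R : R))
  <= V * \sum_(j <- zrange (bqf_height a1 b1 c1 * d ^ 2 * K)) gsum_bound q K%:R (h * j).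
Proof.
move=> q0 d0 W1 W2 WV.
rewrite (@abel_summation2 K W (fun k l => e2pi ((h * bqf a1 b1 c1 (x0 + d%:Z * k%:Z) (y0 + d%:Z * l%:Z))%:~R / q%:R : R)))//.
set B := \sum_(j <- zrange _) _.
have B0 : 0 <= B by apply: sumr_ge0 => j _; apply: gsum_bound_ge0.
apply: (@le_trans _ _ (\sum_(s < K) \sum_(t < K) `|mixed_difference W s t| * B)); last first.
  apply: le_trans (_ : (\sum_(s < K) \sum_(t < K) `|mixed_difference W s t|) * B <= _); last first.
    by rewrite ler_wpM2r.
  by rewrite mulr_suml; apply: ler_sum => s _; rewrite mulr_suml.
apply: le_trans (normc_sum _ _ _) _; apply: ler_sum => s _.
apply: le_trans (normc_sum _ _ _) _; apply: ler_sum => t _.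
rewrite normcM normc_real ler_wpM2l//.
exact: weyl_box_bound.
Qed.

Definition short_count (q l : nat) (t : int) : nat := count (fun b : int => (q%:Z %| t - b)%Z) (zrange l).

Lemma short_count_fourier (q l : nat) (t : int) : (0 < q)%N ->
  (q%:R : R[i]) * (short_count q l t)%:R =
  \sum_(h < q) (\sum_(b <- zrange l) e2pi ((- ((h : nat)%:Z * b))%:~R / q%:R : R)) *
     e2pi (((h : nat)%:Z * t)%:~R / q%:R : R).
Proof.
move=> q0.
have -> : (short_count q l t)%:R = \sum_(b <- zrange l) ((q%:Z %| t - b)%Z)%:R :> R[i].
  by rewrite /short_count -sum1_count natr_sum big_mkcond /=; apply: eq_bigr => b _; case: ifP.
rewrite mulr_sumr.
under [RHS]eq_bigr do rewrite mulr_suml.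
rewrite exchange_big /=; apply: eq_bigr => b _.
transitivity (\sum_(h < q) e2pi ((h : nat)%:R * (t - b)%:~R / q%:R : R)).
  by rewrite sum_e2pi_ord//; case: ifP => _; rewrite ?mulr1 ?mulr0.
apply: eq_bigr => h _; rewrite -e2piD; congr e2pi.
rewrite -mulrDl -intrD; congr (_ / _).
by rewrite -[(h : nat)%:R]/((Posz h)%:~R) -intrM; congr (_%:~R); ring.
Qed.

Lemma size_zrange l : size (zrange l) = (2 * l).+1.
Proof. by rewrite size_map size_iota. Qed.

Lemma short_kernel_bound (q l h : nat) : (0 < h < q)%N ->
  normc (\sum_(b <- zrange l) e2pi ((- (h%:Z * b))%:~R / q%:R : R)) <=
  Num.min (2 * l%:R + 1) (gsum_bound q 0 h%:Z).
Proof.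
move=> hb; have q0 : (0 < q)%N by lia.
rewrite le_min; apply/andP; split.
  apply: le_trans (normc_sum _ _ _) _.
  under eq_bigr do rewrite normc_e2pi.
  by rewrite big_const_seq count_predT iter_addr_0 size_zrange -addn1 natrD natrM.
rewrite /zrange big_map.
have -> : \sum_(i <- iota 0 (2 * l).+1) e2pi ((- (h%:Z * (i%:Z - l%:Z)))%:~R / q%:R : R) =
   e2pi ((h%:Z * l%:Z)%:~R / q%:R : R) * \sum_(0 <= i < (2 * l).+1) e2pi ((- h%:Z)%:~R / q%:R * i%:R : R).
  rewrite mulr_sumr /index_iota subn0; apply: eq_bigr => i _.
  rewrite -e2piD; congr e2pi.
  rewrite !(intrM, intrB, mulrNz) -![(Posz _)%:~R]/(_%:R); ring.
rewrite normcM normc_e2pi mul1r.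
apply: le_trans (@geometric_e2pi_bound R q (2 * l).+1%:R (- h%:Z) 0 (2 * l).+1 q0 _) _.
  by rewrite subn0.
rewrite gsum_boundN// /gsum_bound ifN; last first.
  by apply/negP => /dvdz_mod0P; rewrite modz_small; lia.
rewrite ifN//.
by apply/negP => /dvdz_mod0P; rewrite modz_small; lia.
Qed.

(** After Fourier expansion of the short interval modulo [q], the frequency 0 is the subtracted
    mean. The factor [q] in the dual sum cancels against the normalisation of the expansion. *)
Lemma class_equidistribution (q l d K T : nat) (a x0 y0 : int) (W : nat -> nat -> R) (V : R) :
  (0 < q)%N -> (0 < d)%N -> coprimez a q%:Z -> (K <= q)%N ->
  (forall k, (0 < k < q * (bqf_height a1 b1 c1 * d ^ 2 * K))%N -> (size (divisors k) <= T)%N) ->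
  (forall l, W K l = 0) -> (forall k, W k K = 0) ->
  \sum_(s < K) \sum_(t < K) `|mixed_difference W s t| <= V ->
  `| \sum_(k < K) \sum_(m < K) W k m *
      (short_count q l (a * bqf a1 b1 c1 (x0 + d%:Z * (k : nat)%:Z) (y0 + d%:Z * (m : nat)%:Z)))%:R
    - (2 * l%:R + 1) / q%:R * \sum_(k < K) \sum_(m < K) W k m |
  <= V * (8 * K%:R * harmonic_sum R q + 4 * T%:R * (1 + 4 * harmonic_sum R q) *
      (2 * l%:R + 1 + 2 * (bqf_height a1 b1 c1 * d ^ 2 * K)%N%:R *
          harmonic_sum R (bqf_height a1 b1 c1 * d ^ 2 * K))).
Proof.
move=> q0 d0 caq Kq hT W1 W2 WV.
set Q := fun k m : nat => bqf a1 b1 c1 (x0 + d%:Z * k%:Z) (y0 + d%:Z * m%:Z).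
set J := (bqf_height a1 b1 c1 * d ^ 2 * K)%N.
have q0R : (0 : R) < q%:R by rewrite ltr0n.
have V0 : 0 <= V by apply: le_trans WV; apply: sumr_ge0 => s _; apply: sumr_ge0.
pose Dh (h : nat) : R[i] := \sum_(b <- zrange l) e2pi ((- (h%:Z * b))%:~R / q%:R : R).
pose Sh (h : nat) : R[i] := \sum_(k < K) \sum_(m < K) (W k m)%:C * e2pi ((h%:Z * a * Q k m)%:~R / q%:R : R).
set S := \sum_(k < K) \sum_(m < K) W k m * _.
set SW := \sum_(k < K) \sum_(m < K) W k m.
have qS : (q%:R * S)%:C = \sum_(0 <= h < q) Dh h * Sh h.
  rewrite rmorphM /= rmorph_sum mulr_sumr big_mkord.
  under eq_bigr do rewrite rmorph_sum mulr_sumr.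
  under [RHS]eq_bigr do rewrite mulr_sumr.
  rewrite [RHS]exchange_big /=; apply: eq_bigr => k _.
  under [RHS]eq_bigr do rewrite mulr_sumr.
  rewrite [RHS]exchange_big /=; apply: eq_bigr => m _.
  rewrite rmorphM /= mulrCA.
  have -> : (q%:R : R)%:C * ((short_count q l (a * Q k m))%:R : R)%:C =
     (q%:R : R[i]) * (short_count q l (a * Q k m))%:R by rewrite !rmorph_nat.
  rewrite short_count_fourier// mulr_sumr; apply: eq_bigr => h _.
  by rewrite mulrCA [(h : nat)%:Z * (a * _)]mulrA.
have D0 : Dh 0%N = (2 * l%:R + 1 : R)%:C.
  rewrite /Dh (eq_bigr (fun=> 1)); last by move=> b _; rewrite mul0r oppr0 mul0r e2pi0.
  rewrite big_const_seq count_predT iter_addr_0 size_zrange.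
  by rewrite -addn1 natrD natrM rmorphD rmorphM /= !rmorph_nat.
have S0 : Sh 0%N = SW%:C.
  rewrite /Sh rmorph_sum; apply: eq_bigr => k _; rewrite rmorph_sum; apply: eq_bigr => m _.
  by rewrite !mul0r e2pi0 mulr1.
have main : (q%:R * S - (2 * l%:R + 1) * SW)%:C = \sum_(1 <= h < q) Dh h * Sh h.
  have E0 : \sum_(0 <= h < q) Dh h * Sh h = Dh 0%N * Sh 0%N + \sum_(1 <= h < q) Dh h * Sh h.
    by rewrite big_ltn.
  have sub_C (x y : R) : (x - y)%:C = x%:C - y%:C :> R[i] by exact: rmorphB.
  have mul_C (x y : R) : (x * y)%:C = x%:C * y%:C :> R[i] by exact: rmorphM.
  by rewrite sub_C qS E0 D0 S0 mul_C addrAC subrr add0r.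
have bd : `|q%:R * S - (2 * l%:R + 1) * SW| <= V * (\sum_(1 <= h < q)
    Num.min (2 * l%:R + 1) (gsum_bound q 0 h%:Z) * (\sum_(j <- zrange J) gsum_bound q K%:R (a * h%:Z * j))).
  rewrite -normc_real main; apply: le_trans (normc_sum _ _ _) _.
  rewrite mulr_sumr big_nat [X in _ <= X]big_nat; apply: ler_sum => h hb.
  rewrite normcM mulrCA; apply: ler_pM; rewrite ?normc_ge0//.
    exact: short_kernel_bound.
  rewrite [a * h%:Z]mulrC /Sh.
  exact: weighted_class_bound.
have := @dual_sum_bound R q J K l T a q0 caq Kq hT.
move=> /(ler_wpM2l V0) /(le_trans bd).
have -> : S - (2 * l%:R + 1) / q%:R * SW = (q%:R * S - (2 * l%:R + 1) * SW) / q%:R.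
  by field; rewrite gt_eqF.
rewrite normrM normfV (gtr0_norm q0R) ler_pdivrMr// => /le_trans; apply.
by rewrite mulrCA [X in _ <= X]mulrC.
Qed.

End Class_sums.

(** * Lattice points in ellipses *)

Section Half_circle.
Variables (R : realType) (r : R).
Hypothesis r_gt0 : 0 < r.

Definition half_chord (y : R) : R := Num.sqrt (r ^+ 2 - y ^+ 2).

(* Area under the upper half circle of radius [r] between abscissas [0] and [y],
   in terms of the angle [asin (y / r)]; the area beyond [r] is frozen. *)
Definition sector_area (u : R) : R := r ^+ 2 / 2 * (u + sin u * cos u).
Definition chord_area (y : R) : R := sector_area (asin (Num.min 1 (y / r))).

Lemma half_chord_ge0 y : 0 <= half_chord y. Proof. exact: sqrtr_ge0. Qed.

Lemma half_chord0 y : r <= y -> half_chord y = 0.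
Proof.
move=> ry; apply/eqP; rewrite sqrtr_eq0 subr_le0 ler_sqr ?nnegrE//; first exact: ltW.
by apply: le_trans ry; exact: ltW.
Qed.

Lemma half_chord_le y : half_chord y <= r.
Proof.
rewrite -[X in _ <= X]ger0_norm ?(ltW r_gt0)// -sqrtr_sqr ler_wsqrtr//.
by rewrite lerBlDr lerDl sqr_ge0.
Qed.

(** With [k = r ^ 2 * cos v] the function is the area minus the linear function of [y = r sin u]
    whose slope is the chord at [v]; the sign of the derivative then compares area and rectangle. *)
Lemma is_derive_sector (k u : R) :
  is_derive u 1 (fun u => sector_area u - k * sin u) (r ^+ 2 * cos u ^+ 2 - k * cos u).
Proof.
rewrite /sector_area.
apply: is_derive_eq.
rewrite /GRing.scale /=.
have := cos2Dsin2 u; move: (cos u) (sin u) => c s h.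
have s2 : s ^+ 2 = 1 - c ^+ 2 by rewrite -h; ring.
by field: s2.
Qed.

(** Monotone comparison of an area with its inner and outer rectangles. The mean value theorem is
    applied in the angle variable, where everything is smooth, whereas [asin] is not differentiable
    at the end of the diameter. *)
Lemma chord_area_step (y z : R) : 0 <= y <= z ->
  (z - y) * half_chord z <= chord_area z - chord_area y <= (z - y) * half_chord y.
Proof.
move=> /andP[y0 yz].
have rn0 : r != 0 by rewrite gt_eqF.
have pi2 := pi_ge2 R.
suff main (a b : R) : 0 <= a <= b -> b <= r ->
    (b - a) * half_chord b <= chord_area b - chord_area a <= (b - a) * half_chord a.
  have [zr|rz] := leP z r; first by apply: main => //; rewrite y0.
  have cz : chord_area z = chord_area r.
    rewrite /chord_area divff// minxx min_l// ler_pdivlMr// mul1r; exact: ltW.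
  rewrite (half_chord0 (ltW rz)) mulr0 cz.
  have [yr|ry] := leP y r.
    have := main y r; rewrite y0 yr lexx half_chord0// mulr0 => /(_ isT isT) /andP[-> h] /=.
    by apply: le_trans h _; rewrite ler_wpM2r ?half_chord_ge0// lerD2r ltW.
  have -> : chord_area y = chord_area r.
    rewrite /chord_area divff// minxx min_l// ler_pdivlMr// mul1r; exact: ltW.
  by rewrite subrr lexx (half_chord0 (ltW ry)) mulr0 lexx.
move=> /andP[a0 ab] br.
have ar : a <= r by apply: le_trans br.
have b0 : 0 <= b by apply: le_trans ab.
have un (x : R) : 0 <= x <= r -> [/\ -1 <= x / r <= 1, 0 <= asin (x / r) <= pi / 2,
    r * sin (asin (x / r)) = x & r * cos (asin (x / r)) = half_chord x].
  move=> /andP[x0 xr].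
  have xr0 : 0 <= x / r by rewrite divr_ge0// ltW.
  have xr1 : x / r <= 1 by rewrite ler_pdivrMr// mul1r.
  have xb : -1 <= x / r <= 1 by rewrite xr1 andbT; lra.
  have sE : sin (asin (x / r)) = x / r by apply: asinK; rewrite in_itv.
  split => //.
  - rewrite asin_lepi2// andbT leNgt; apply/negP => neg.
    have : sin (asin (x / r)) < 0.
      rewrite -(sin0 R) ltr_sin ?in_itv//=.
        by rewrite asin_geNpi2// asin_lepi2.
      by apply/andP; split; lra.
    by rewrite sE; lra.
  - by rewrite sE mulrC divfK.
  - rewrite cos_asin// /half_chord -{1}[r]ger0_norm ?(ltW r_gt0)// -sqrtr_sqr -sqrtrM ?sqr_ge0//.
    congr Num.sqrt; by field.
have mn (x : R) : 0 <= x <= r -> Num.min 1 (x / r) = x / r.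
  by move=> /un[/andP[_ h] _ _ _]; rewrite min_r.
have a0r : 0 <= a <= r by rewrite a0.
have b0r : 0 <= b <= r by rewrite b0.
have [_ /andP[ua0 ua2] sa ca] := un a a0r; have [_ /andP[ub0 ub2] sb cb] := un b b0r.
rewrite /chord_area !mn//.
set u := asin (a / r) in ua0 ua2 sa ca *; set v := asin (b / r) in ub0 ub2 sb cb *.
have uv : u <= v.
  rewrite leNgt; apply/negP => vu.
  have : sin v < sin u by rewrite ltr_sin ?in_itv//=; apply/andP; split; lra.
  rewrite -(ltr_pM2l r_gt0) sa sb; lra.
have cosle (x y' : R) : 0 <= x -> x <= y' -> y' <= pi / 2 -> cos y' <= cos x.
  move=> x0 xy y2; rewrite leNgt ltr_cos ?in_itv/=; [by rewrite -leNgt|apply/andP; split; lra..].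
have cospos (x : R) : 0 <= x -> x <= pi / 2 -> 0 <= cos x.
  by move=> x0 x2; apply: cos_ge0_pihalf; apply/andP; split; lra.
have r20 : 0 <= r ^+ 2 by rewrite sqr_ge0.
apply/andP; split.
- have [w /andP[uw wv] E] := @MVT_everywhere R (fun u => sector_area u - r ^+ 2 * cos v * sin u) _ u v uv
     (fun x => @is_derive_sector (r ^+ 2 * cos v) x).
  have c1 : cos v <= cos w by apply: cosle => //; lra.
  have c0 : 0 <= cos w by apply: cospos; lra.
  have : 0 <= (r ^+ 2 * cos w ^+ 2 - r ^+ 2 * cos v * cos w) * (v - u).
    apply: mulr_ge0; last by lra.
    have -> : r ^+ 2 * cos w ^+ 2 - r ^+ 2 * cos v * cos w = r ^+ 2 * (cos w * (cos w - cos v)) by ring.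
    by rewrite !mulr_ge0//; lra.
  rewrite -E -cb -sa -sb; move: (sector_area v) (sector_area u) => X Y.
  have -> : (r * sin v - r * sin u) * (r * cos v) = r ^+ 2 * cos v * sin v - r ^+ 2 * cos v * sin u by ring.
  lra.
- have [w /andP[uw wv] E] := @MVT_everywhere R (fun v => sector_area v - r ^+ 2 * cos u * sin v) _ u v uv
     (fun x => @is_derive_sector (r ^+ 2 * cos u) x).
  have c1 : cos w <= cos u by apply: cosle => //; lra.
  have c0 : 0 <= cos w by apply: cospos; lra.
  have : 0 <= - (r ^+ 2 * cos w ^+ 2 - r ^+ 2 * cos u * cos w) * (v - u).
    apply: mulr_ge0; last by lra.
    have -> : - (r ^+ 2 * cos w ^+ 2 - r ^+ 2 * cos u * cos w) = r ^+ 2 * (cos w * (cos u - cos w)) by ring.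
    by rewrite !mulr_ge0//; lra.
  rewrite mulNr -E -ca -sa -sb; move: (sector_area v) (sector_area u) => X Y.
  have -> : (r * sin v - r * sin u) * (r * cos u) = r ^+ 2 * cos u * sin v - r ^+ 2 * cos u * sin u by ring.
  lra.
Qed.

Lemma chord_area0 : chord_area 0 = 0.
Proof.
rewrite /chord_area mul0r min_r ?ler01// /sector_area.
have -> : asin 0 = 0 :> R.
  have pi2 := pi_ge2 R.
  by rewrite -{1}(sin0 R) sinK// in_itv/=; apply/andP; split; lra.
by rewrite sin0 mul0r addr0 mulr0.
Qed.

Lemma chord_area_beyond y : r <= y -> chord_area y = pi * r ^+ 2 / 4.
Proof.
move=> ry; have pi2 := pi_ge2 R.
rewrite /chord_area min_l; last by rewrite ler_pdivlMr// mul1r.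
have -> : asin 1 = pi / 2 :> R.
  rewrite -{1}(sin_pihalf R) sinK// in_itv/=; apply/andP; split; lra.
by rewrite /sector_area cos_pihalf mulr0 addr0; field.
Qed.

(** A Riemann sum of a decreasing function over a quarter disc. The missing piece [[0, y0]] and the
    first term are each at most [h r], and they pull in opposite directions. *)
Lemma half_chord_sum (y0 h : R) (K : nat) : 0 < h -> 0 <= y0 <= h -> r <= y0 + h * K%:R ->
  `| h * (\sum_(k < K) half_chord (y0 + h * k%:R)) - pi * r ^+ 2 / 4 | <= h * r.
Proof.
move=> h0 /andP[y00 y0h] rK.
have ygeq0 (k : nat) : 0 <= y0 + h * k%:R by rewrite addr_ge0// mulr_ge0// ltW.
have step (k : nat) : h * half_chord (y0 + h * k.+1%:R) <=
    chord_area (y0 + h * k.+1%:R) - chord_area (y0 + h * k%:R) <= h * half_chord (y0 + h * k%:R).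
  have e : y0 + h * k.+1%:R - (y0 + h * k%:R) = h by rewrite -natr1; ring.
  have := @chord_area_step (y0 + h * k%:R) (y0 + h * k.+1%:R); rewrite e; apply.
  by rewrite ygeq0/= -natr1 mulrDr mulr1 addrA lerDl ltW.
have lo n : chord_area (y0 + h * n%:R) - chord_area y0 <= h * \sum_(k < n) half_chord (y0 + h * k%:R).
  elim: n => [|n IH]; first by rewrite big_ord0 !mulr0 addr0 subrr.
  by rewrite big_ord_recr /= mulrDr; have /andP[_ s2] := step n; lra.
have hi n : h * \sum_(k < n) half_chord (y0 + h * k.+1%:R) <= chord_area (y0 + h * n%:R) - chord_area y0.
  elim: n => [|n IH]; first by rewrite big_ord0 !mulr0 addr0 subrr.
  by rewrite big_ord_recr /= mulrDr; have /andP[s1 _] := step n; lra.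
have ca0 : 0 <= chord_area y0 <= h * r.
  have := @chord_area_step 0 y0; rewrite lexx y00 subr0 chord_area0 subr0 => /(_ isT) /andP[s1 s2].
  rewrite (le_trans _ s1) ?mulr_ge0 ?half_chord_ge0//= (le_trans s2)//.
  by rewrite ler_pM ?half_chord_ge0// half_chord_le.
have r0 := ltW r_gt0.
case: K rK => [|K] rK.
  rewrite big_ord0 mulr0 sub0r normrN ger0_norm ?divr_ge0 ?mulr_ge0 ?pi_ge0//.
  rewrite mulr0 addr0 in rK.
  by have /andP[_] := ca0; rewrite chord_area_beyond.
have cK : chord_area (y0 + h * K.+1%:R) = pi * r ^+ 2 / 4 by rewrite chord_area_beyond.
have := lo K.+1; rewrite cK => l1.
have := hi K => h1.
have cKle : chord_area (y0 + h * K%:R) <= pi * r ^+ 2 / 4.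
  rewrite -cK -subr_ge0; have /andP[s1 _] := step K; apply: le_trans s1.
  by rewrite mulr_ge0 ?half_chord_ge0// ltW.
have f0 : h * half_chord (y0 + h * 0%:R) <= h * r by rewrite ler_wpM2l ?half_chord_le// ltW.
have recl : \sum_(k < K.+1) half_chord (y0 + h * k%:R) =
   half_chord (y0 + h * 0%:R) + \sum_(k < K) half_chord (y0 + h * k.+1%:R) by rewrite big_ord_recl.
rewrite recl mulrDr in l1 *.
have /andP[c1 c2] := ca0.
rewrite ler_norml; apply/andP; split; lra.
Qed.

End Half_circle.

Lemma sum_interval_ord (K i j : nat) : (\sum_(k < K) (i <= k <= j)%N = minn K j.+1 - i)%N.
Proof.
elim: K => [|K IH]; first by rewrite big_ord0; lia.
by rewrite big_ord_recr /= IH; case: (leqP i K); case: (leqP K j); lia.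
Qed.

Lemma count_integers (R : realType) (K : nat) (al be : R) : al <= be ->
  (forall k : int, al <= k%:~R <= be -> 0 <= k < K%:Z) ->
  `| \sum_(k < K) (al <= k%:R <= be)%R%:R - (be - al) | <= 1.
Proof.
move=> ab inK.
set A := Num.ceil al; set B := Num.floor be.
have e (k : nat) : (al <= k%:R <= be) = (A <= k%:Z <= B).
  by rewrite -[k%:R]/((Posz k)%:~R) -ceil_le_int -floor_ge_int.
have -> : \sum_(k < K) (al <= k%:R <= be)%R%:R = (\sum_(k < K) (A <= (k : nat)%:Z <= B)%R)%N%:R :> R.
  by rewrite natr_sum; apply: eq_bigr => k _; rewrite e.
have /andP[A1 A2] := ceil_itv al; have /andP[B1 B2] := floor_itv be.
rewrite -/A -/B in A1 A2 B1 B2.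
rewrite intrB in A1; rewrite intrD in B2.
have [AB|BA] := leP A B.
  have ABR : (A%:~R : R) <= B%:~R by rewrite ler_int.
  have hA : 0 <= A < K%:Z by apply: inK; apply/andP; split; lra.
  have hB : 0 <= B < K%:Z by apply: inK; apply/andP; split; lra.
  have [i Ai] : exists i : nat, A = i%:Z by exists (absz A); lia.
  have [j Bj] : exists j : nat, B = j%:Z by exists (absz B); lia.
  have -> : (\sum_(k < K) (A <= (k : nat)%:Z <= B)%R = j.+1 - i)%N.
    rewrite Ai Bj; under eq_bigr do rewrite !lez_nat.
    rewrite sum_interval_ord; move: hB; rewrite Bj; lia.
  rewrite natrB; last by move: AB; rewrite Ai Bj; lia.
  rewrite -natr1; move: A1 A2 B1 B2; rewrite Ai Bj -![(Posz _)%:~R]/(_%:R : R) => *.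
  by rewrite ler_norml; apply/andP; split; lra.
have -> : (\sum_(k < K) (A <= (k : nat)%:Z <= B)%R = 0)%N.
  by rewrite big1// => k _; case: (boolP (_ <= _ <= _)) => // /andP[h1 h2]; move: BA; rewrite ltNge (le_trans h1 h2).
have BAR : (B%:~R : R) + 1 <= A%:~R by rewrite -[1]/(1%:~R) -intrD ler_int; lia.
rewrite ler_norml; apply/andP; split; lra.
Qed.

(** A class modulo [d] is enumerated from [w - d M] by [2 M + 1] steps. For [d > 1] this overshoots
    the box, but the index range then has a length independent of [d]. *)
Lemma class_index_range (d M : nat) (w k : int) : (0 < d)%N -> (0 < M)%N -> 0 <= w < d%:Z ->
  `|w - d%:Z * M%:Z + d%:Z * k| <= M%:Z -> 0 <= k < (2 * M).+1%:Z.
Proof.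
move=> d_gt0 M_gt0 wd h; have d1 : 1 <= d%:Z by lia.
have M1 : 1 <= M%:Z by lia.
have h1 : w + d%:Z * (k - M%:Z) <= M%:Z by have -> : w + d%:Z * (k - M%:Z) = w - d%:Z * M%:Z + d%:Z * k by [ring]; lia.
have h2 : - M%:Z <= w + d%:Z * (k - M%:Z) by have -> : w + d%:Z * (k - M%:Z) = w - d%:Z * M%:Z + d%:Z * k by [ring]; lia.
have [k0|k0] := leP (- M%:Z) (k - M%:Z); last first.
  have : d%:Z * (k - M%:Z) <= d%:Z * (- M%:Z - 1) by rewrite ler_wpM2l//; lia.
  have : M%:Z <= d%:Z * M%:Z by rewrite -{1}[M%:Z]mul1r ler_wpM2r.
  by lia.
have [k1|k1] := leP (k - M%:Z) M%:Z; first by lia.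
have : d%:Z * (M%:Z + 1) <= d%:Z * (k - M%:Z) by rewrite ler_wpM2l//; lia.
have : M%:Z <= d%:Z * M%:Z by rewrite -{1}[M%:Z]mul1r ler_wpM2r.
by lia.
Qed.

Section Ellipse.
Variables (R : realType) (a1 b1 c1 : int).
Hypotheses (a1_gt0 : 0 < a1) (Delta_gt0 : 0 < bqf_Delta a1 b1 c1).
Let Q := bqf a1 b1 c1.
Let D := bqf_Delta a1 b1 c1.

Lemma bqf_square_x (x y : int) : 4 * a1 * Q x y = (2 * a1 * x + b1 * y) ^+ 2 + D * y ^+ 2.
Proof. by rewrite /Q /D /bqf /bqf_Delta; ring. Qed.

Lemma bqf_square_y (x y : int) : 4 * c1 * Q x y = (b1 * x + 2 * c1 * y) ^+ 2 + D * x ^+ 2.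
Proof. by rewrite /Q /D /bqf /bqf_Delta; ring. Qed.

Lemma bqf_ge0 (x y : int) : 0 <= Q x y.
Proof.
have h : 0 <= 4 * a1 * Q x y.
  by rewrite bqf_square_x addr_ge0 ?sqr_ge0// mulr_ge0 ?sqr_ge0// ltW.
by rewrite -(pmulr_rge0 _ (_ : 0 < 4 * a1))//; lia.
Qed.

Lemma sqr_le_abs (x : int) (M : nat) : x ^+ 2 <= M%:Z ^+ 2 -> `|x| <= M%:Z.
Proof. by move=> h; rewrite -ler_sqr ?nnegrE// real_normK ?num_real. Qed.

Lemma bqf_le_box (M : nat) (n x y : int) : 4 * a1 * n <= M%:Z ^+ 2 -> 4 * c1 * n <= M%:Z ^+ 2 ->
  Q x y <= n -> `|x| <= M%:Z /\ `|y| <= M%:Z.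
Proof.
move=> h1 h2 Qn.
have c1_gt0 : 0 < c1.
  have : 0 < 4 * a1 * c1.
    have := Delta_gt0; rewrite /bqf_Delta; have := sqr_ge0 b1; lia.
  by rewrite pmulr_rgt0//; lia.
have D1 : 1 <= D by have := Delta_gt0; rewrite -/D; lia.
have sq (z : int) : z ^+ 2 <= D * z ^+ 2.
  by rewrite -{1}[z ^+ 2]mul1r ler_wpM2r// sqr_ge0.
split; apply: sqr_le_abs; apply: le_trans (sq _) _.
  apply: le_trans h2; apply: le_trans (_ : 4 * c1 * Q x y <= _).
    by rewrite bqf_square_y lerDr sqr_ge0.
  by rewrite ler_wpM2l//; lia.
apply: le_trans h1; apply: le_trans (_ : 4 * a1 * Q x y <= _).
  by rewrite bqf_square_x lerDr sqr_ge0.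
by rewrite ler_wpM2l//; lia.
Qed.

Lemma bqf_le_real (X Y : int) (n : nat) : (Q X Y <= n%:Z) =
  ((2 * a1%:~R * X%:~R + b1%:~R * Y%:~R) ^+ 2 + D%:~R * Y%:~R ^+ 2 <= 4 * a1%:~R * n%:R :> R).
Proof.
have a4 : 0 < 4 * a1 by clear -a1_gt0; lia.
rewrite -(ler_pM2l a4) bqf_square_x -(ler_int R).
have gen (D' A B : int) : ((A ^+ 2 + D' * B ^+ 2)%:~R : R) = A%:~R ^+ 2 + D'%:~R * B%:~R ^+ 2.
  by rewrite intrD intrM !expr2 !intrM.
have genA (A B A' B' : int) : ((2 * A * B + A' * B')%:~R : R) = 2 * A%:~R * B%:~R + A'%:~R * B'%:~R.
  by rewrite intrD !intrM.
by rewrite gen genA !intrM.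
Qed.

Variables (d M : nat) (u v : int).
Hypotheses (d_gt0 : (0 < d)%N) (u_lt : 0 <= u < d%:Z) (v_lt : 0 <= v < d%:Z) (M_gt0 : (0 < M)%N).
Let x (k : nat) : int := u - d%:Z * M%:Z + d%:Z * k%:Z.
Let y (l : nat) : int := v - d%:Z * M%:Z + d%:Z * l%:Z.

Definition ellipse_count (n : nat) : R :=
  \sum_(k < (2 * M).+1) \sum_(l < (2 * M).+1)
    (Q (u - d%:Z * M%:Z + d%:Z * (k : nat)%:Z) (v - d%:Z * M%:Z + d%:Z * (l : nat)%:Z) <= n%:Z)%R%:R.

(** The ellipse is sliced into rows of constant [y]. A row meets the class in its length over [d],
    up to an error of 1, and only rows with [|y| <= r] occur. The row lengths are scaled chords of a
    circle, summed along an arithmetic progression of step [d]. *)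
Lemma ellipse_count_asymptotic (n : nat) : (0 < n)%N ->
  4 * a1 * n%:Z <= M%:Z ^+ 2 -> 4 * c1 * n%:Z <= M%:Z ^+ 2 ->
  `| ellipse_count n - 2 * pi * n%:R / (Num.sqrt D%:~R * d%:R ^+ 2) |
  <= (4 + 4 * Num.sqrt a1%:~R) * Num.sqrt n%:R * 2 + 1.
Proof.
move=> n0 hM1 hM2.
have DR : (0 : R) < D%:~R by rewrite ltr0z.
have aR : (0 : R) < a1%:~R by rewrite ltr0z.
have aR1 : (1 : R) <= a1%:~R by rewrite -[1]/(1%:~R) ler_int; lia.
have DR1 : (1 : R) <= D%:~R by rewrite -[1]/(1%:~R) ler_int; have := Delta_gt0; rewrite -/D; lia.
have nR : (0 : R) < n%:R by rewrite ltr0n.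
have dR : (0 : R) < d%:R by rewrite ltr0n.
have dR1 : (1 : R) <= d%:R by rewrite ler1n.
(* The largest [|y|] on the ellipse, from [4 a1 Q = (2 a1 x + b1 y) ^ 2 + D y ^ 2]. *)
pose r : R := Num.sqrt (4 * a1%:~R * n%:R / D%:~R).
have r2 : r ^+ 2 = 4 * a1%:~R * n%:R / D%:~R.
  by rewrite sqr_sqrtr// divr_ge0 ?(ltW DR)// !mulr_ge0// ltW.
have r0 : 0 < r by rewrite sqrtr_gt0 divr_gt0// !mulr_gt0.
have rM : r <= M%:R.
  rewrite -[M%:R]ger0_norm// -sqrtr_sqr ler_wsqrtr// ler_pdivrMr//.
  apply: (@le_trans _ _ (M%:R ^+ 2)); last by rewrite ler_peMr// sqr_ge0.
  have : ((4 * a1 * n%:Z)%:~R : R) <= (M%:Z ^+ 2)%:~R by rewrite ler_int.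
  by rewrite !intrM.
pose sD : R := Num.sqrt D%:~R.
have sD0 : 0 < sD by rewrite sqrtr_gt0.
have sD2 : sD ^+ 2 = D%:~R by rewrite sqr_sqrtr// ltW.
set K := (2 * M).+1.
pose hc := half_chord r.
have row (l : nat) : `| \sum_(k < K) (Q (x k) (y l) <= n%:Z)%R%:R - sD * hc (y l)%:~R / (a1%:~R * d%:R) |
    <= (`|(y l)%:~R| <= r)%R%:R.
  pose E : R := r ^+ 2 - (y l)%:~R ^+ 2.
  have DE : D%:~R * E = 4 * a1%:~R * n%:R - D%:~R * (y l)%:~R ^+ 2.
    by rewrite /E r2; field; rewrite gt_eqF.
  have QE (X : int) : (Q X (y l) <= n%:Z) =
      ((2 * a1%:~R * X%:~R + b1%:~R * (y l)%:~R) ^+ 2 <= D%:~R * E :> R).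
    by rewrite bqf_le_real DE lerBrDr.
  have [E0|E0] := ltP E 0.
    have -> : hc (y l)%:~R = 0 by apply/eqP; rewrite sqrtr_eq0 ltW.
    rewrite mulr0 mul0r subr0 big1 ?normr0 ?ler0n// => k _.
    rewrite QE leNgt (_ : _ < _ = true)//.
    by apply: lt_le_trans (sqr_ge0 _); rewrite pmulr_rlt0.
  have yr : `|(y l)%:~R| <= r.
    by rewrite -ler_sqr ?nnegrE ?(ltW r0)// real_normK ?num_real// -subr_ge0.
  rewrite yr.
  pose s : R := sD * hc (y l)%:~R.
  have s0 : 0 <= s by rewrite mulr_ge0 ?sqrtr_ge0.
  have s2 : s ^+ 2 = D%:~R * E by rewrite exprMn sD2 sqr_sqrtr.
  pose c : R := 2 * a1%:~R * (u - d%:Z * M%:Z)%:~R + b1%:~R * (y l)%:~R.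
  pose al : R := (- c - s) / (2 * a1%:~R * d%:R).
  pose be : R := (- c + s) / (2 * a1%:~R * d%:R).
  have den : 0 < 2 * a1%:~R * d%:R :> R by rewrite !mulr_gt0.
  have equiv (k : int) : (al <= k%:~R <= be) = (Q (u - d%:Z * M%:Z + d%:Z * k) (y l) <= n%:Z).
    rewrite QE -s2.
    have -> : 2 * a1%:~R * (u - d%:Z * M%:Z + d%:Z * k)%:~R + b1%:~R * (y l)%:~R
        = 2 * a1%:~R * d%:R * k%:~R + c :> R.
      rewrite /c [(u - d%:Z * M%:Z + d%:Z * k)%:~R]intrD [(d%:Z * k)%:~R]intrM.
      by rewrite -[d%:Z%:~R]/(d%:R : R); ring.
    have nsq (z : R) : (z ^+ 2 <= s ^+ 2) = (`|z| <= s).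
      by rewrite -[z ^+ 2]real_normK ?num_real// ler_sqr ?nnegrE.
    rewrite nsq.
    rewrite ler_norml /al /be ler_pdivrMr// ler_pdivlMr//.
    by congr (_ && _); rewrite mulrC; move: (2 * _ * _ * _) => z; apply/idP/idP; lra.
  have := @count_integers R K al be.
  have -> : be - al = s / (a1%:~R * d%:R) by rewrite /al /be; field; rewrite !gt_eqF.
  have sumE : \sum_(k < K) (al <= k%:R <= be)%R%:R = \sum_(k < K) (Q (x k) (y l) <= n%:Z)%R%:R :> R.
    by apply: eq_bigr => k _; have := equiv (Posz k) => ->.
  rewrite sumE.
  apply.
    by rewrite /al /be ler_wpM2r ?invr_ge0 ?(ltW den)//; lra.
  move=> k; rewrite equiv => /(bqf_le_box hM1 hM2)[h _].
  exact: class_index_range d_gt0 M_gt0 u_lt h.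
have rows : `| ellipse_count n - \sum_(l < K) sD * hc (y l)%:~R / (a1%:~R * d%:R) | <= 2 * r + 1.
  rewrite /ellipse_count exchange_big /= -sumrB.
  apply: le_trans (ler_norm_sum _ _ _) _.
  apply: (@le_trans _ _ (\sum_(l < K) (`|(y l)%:~R| <= r)%R%:R)); first by apply: ler_sum => l _; exact: row.
  pose al : R := (- (v - d%:Z * M%:Z)%:~R - r) / d%:R.
  pose be : R := (- (v - d%:Z * M%:Z)%:~R + r) / d%:R.
  have equiv (k : int) : (al <= k%:~R <= be) = (`|(v - d%:Z * M%:Z + d%:Z * k)%:~R| <= r).
    rewrite ler_norml /al /be ler_pdivrMr// ler_pdivlMr// [k%:~R * d%:R]mulrC.
    rewrite [(v - d%:Z * M%:Z + d%:Z * k)%:~R]intrD [(d%:Z * k)%:~R]intrM -[d%:Z%:~R]/(d%:R : R).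
    have gen (z z' r' : R) : ((- z' - r' <= z) && (z <= - z' + r')) = ((- r' <= z' + z) && (z' + z <= r')).
      by congr (_ && _); apply/idP/idP; lra.
    exact: gen.
  have := @count_integers R K al be.
  have sumE : \sum_(k < K) (al <= k%:R <= be)%R%:R = \sum_(k < K) (`|(y k)%:~R| <= r)%R%:R :> R.
    by apply: eq_bigr => k _; have := equiv (Posz k) => ->.
  rewrite sumE.
  have -> : be - al = 2 * r / d%:R by rewrite /al /be; field; rewrite gt_eqF.
  move=> /(_ _ _)/ler_normlW h.
  have : \sum_(l < K) (`|(y l)%:~R| <= r)%R%:R - 2 * r / d%:R <= 1.
    apply: h; first by rewrite /al /be ler_wpM2r ?invr_ge0 ?(ltW dR)//; lra.
    move=> k; rewrite equiv => h; apply: (class_index_range d_gt0 M_gt0 v_lt).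
    have := le_trans h rM; rewrite -intr_norm -[M%:R]/((Posz M)%:~R) ler_int.
    by [].
  have : 2 * r / d%:R <= 2 * r by rewrite ler_pdivrMr// ler_peMr// mulr_ge0// ltW.
  lra.
have evenhc z : hc (- z) = hc z by rewrite /hc /half_chord sqrrN.
have sums : `| d%:R * (\sum_(l < K) hc (y l)%:~R) - pi * r ^+ 2 / 2 | <= 2 * (d%:R * r).
  (* The rows with [y >= 0] start at the offset [v], those with [y < 0] at [d - v] after reflection.
     Both offsets lie in [[0, d]], so each half is a quarter-disc sum. *)
  have split_l : \sum_(l < K) hc (y l)%:~R = \sum_(l < M) hc ((d%:Z - v)%:~R + d%:R * l%:R) +
      \sum_(l < M.+1) hc (v%:~R + d%:R * l%:R).
    rewrite -(big_mkord xpredT (fun l => hc (y l)%:~R)) (@big_cat_nat _ _ _ M)//=; last by rewrite /K; clear; lia.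
    congr (_ + _).
      rewrite big_nat_rev /= big_mkord; apply: eq_bigr => l _.
      rewrite -evenhc add0n; congr hc.
      rewrite /y -mulrNz -[(l : nat)%:R]/((Posz l)%:~R) -[d%:R]/((Posz d)%:~R) -intrM -intrD; congr (_%:~R).
      have -> : (M - l.+1)%N%:Z = M%:Z - (l : nat)%:Z - 1 by have := ltn_ord l; clear; lia.
      by ring.
    rewrite -{1}[M]add0n big_addn (_ : K - M = M.+1)%N; last by rewrite /K; clear; lia.
    rewrite big_mkord; apply: eq_bigr => l _; congr hc.
    rewrite /y -[(l : nat)%:R]/((Posz l)%:~R) -[d%:R]/((Posz d)%:~R) -intrM -intrD; congr (_%:~R).
    by rewrite PoszD; ring.
  have vR : 0 <= (v%:~R : R) <= d%:R.
    by case/andP: v_lt => v0 vd; rewrite ler0z v0 -[d%:R]/((Posz d)%:~R) ler_int ltW.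
  have dvE : (d%:Z - v)%:~R = d%:R - v%:~R :> R by rewrite intrB.
  have M0R : (0 : R) <= M%:R by [].
  have h1 := @half_chord_sum R r r0 (d%:Z - v)%:~R d%:R M dR.
  have h2 := @half_chord_sum R r r0 v%:~R d%:R M.+1 dR vR.
  have {}h1 : `|d%:R * (\sum_(l < M) hc ((d%:Z - v)%:~R + d%:R * l%:R)) - pi * r ^+ 2 / 4| <= d%:R * r.
    apply: h1; rewrite dvE; first by case/andP: vR => *; apply/andP; split; lra.
    by case/andP: vR => *; apply: le_trans rM _; nra.
  have {}h2 : `|d%:R * (\sum_(l < M.+1) hc (v%:~R + d%:R * l%:R)) - pi * r ^+ 2 / 4| <= d%:R * r.
    by apply: h2; case/andP: vR => *; apply: le_trans rM _; rewrite -natr1; nra.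
  rewrite split_l mulrDr.
  move: h1 h2; rewrite !ler_norml => /andP[p1 p2] /andP[p3 p4]; apply/andP; split; lra.
have -> : 2 * pi * n%:R / (sD * d%:R ^+ 2) = sD / (a1%:~R * d%:R ^+ 2) * (pi * r ^+ 2 / 2).
  rewrite r2 -sD2; field; by rewrite !gt_eqF.
have sE : \sum_(l < K) sD * hc (y l)%:~R / (a1%:~R * d%:R) =
   sD / (a1%:~R * d%:R ^+ 2) * (d%:R * \sum_(l < K) hc (y l)%:~R).
  rewrite -mulr_suml -mulr_sumr; field; by rewrite !gt_eqF.
rewrite sE in rows.
set f : R := sD / (a1%:~R * d%:R ^+ 2) in rows *.
have f0 : 0 <= f by rewrite divr_ge0 ?(ltW sD0)// mulr_ge0 ?sqr_ge0// ltW.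
have e2 : `|f * (d%:R * (\sum_(l < K) hc (y l)%:~R)) - f * (pi * r ^+ 2 / 2)| <= f * (2 * (d%:R * r)).
  by rewrite -mulrBr normrM (ger0_norm f0) ler_wpM2l.
have tri : `|ellipse_count n - f * (pi * r ^+ 2 / 2)| <= 2 * r + 1 + f * (2 * (d%:R * r)).
  have -> : ellipse_count n - f * (pi * r ^+ 2 / 2) = (ellipse_count n - f * (d%:R * \sum_(l < K) hc (y l)%:~R)) +
     (f * (d%:R * (\sum_(l < K) hc (y l)%:~R)) - f * (pi * r ^+ 2 / 2)) by ring.
  by apply: le_trans (ler_normD _ _) _; apply: lerD.
apply: le_trans tri _.
pose sa : R := Num.sqrt a1%:~R; pose sn : R := Num.sqrt n%:R.
have sa0 : 0 < sa by rewrite sqrtr_gt0.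
have sn0 : 0 < sn by rewrite sqrtr_gt0.
have sDr : sD * r = 2 * sa * sn.
  rewrite /sD /r -sqrtrM ?(ltW DR)// mulrC divfK ?gt_eqF// -mulrA sqrtrM// sqrtrM ?(ltW aR)//.
  have -> : Num.sqrt 4 = 2 :> R by rewrite (_ : 4 = 2 ^+ 2) ?sqrtr_sqr ?ger0_norm//; ring.
  by rewrite mulrA.
have sD1 : 1 <= sD by rewrite -[1](sqrtr1 R) ler_wsqrtr.
have rle : r <= 2 * sa * sn by rewrite -sDr ler_peMl// ltW.
have sa2 : sa ^+ 2 = a1%:~R by rewrite sqr_sqrtr// ltW.
have fle : f * (2 * (d%:R * r)) <= 4 * sn * sa.
  have -> : f * (2 * (d%:R * r)) = 2 * (sD * r) / (a1%:~R * d%:R) by rewrite /f; field; rewrite !gt_eqF.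
  rewrite sDr ler_pdivrMr ?mulr_gt0//.
  have : 1 <= a1%:~R * d%:R :> R by rewrite mulr_ege1.
  have : 0 < sn * sa by rewrite mulr_gt0.
  nra.
have : 0 < sn * sa by rewrite mulr_gt0.
rewrite -/sa -/sn; nra.
Qed.

End Ellipse.

(** * Smooth weights *)

Section Weight.
Variables (R : realType) (X : R) (C : nat -> R) (w : R -> R).
Hypotheses (X_gt0 : 0 < X) (hw : weight X C w).

Lemma weight_ge0 (x : R) : 0 <= w x. Proof. by case: hw. Qed.

Lemma weight_is_derive (j : nat) (x : R) : is_derive x 1 (derive1n j w) (derive1n j.+1 w x).
Proof.
case: hw => _ sm _ _ _; apply: DeriveDef; first exact: sm.
by rewrite derive1nS derive1E.
Qed.

Lemma weight_eq0 (x : R) : ~~ (X <= x <= 2 * X) -> w x = 0.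
Proof.
case: hw => _ _ supp _ _ xX; apply/eqP; apply: contraNT xX => wx.
have /supp : closure [set x | w x != 0] x by apply: subset_closure.
by rewrite /= in_itv.
Qed.

Lemma weight_derive_eq0 (j : nat) (x : R) : 2 * X < x -> derive1n j w x = 0.
Proof.
elim: j x => [|j IH] x xX; first by apply: weight_eq0; apply/negP => /andP[_]; lra.
rewrite derive1nS derive1E (@near_eq_derive _ _ _ _ (cst 0)) ?derive_cst//.
by apply: filterS (@open_gt R (2 * X) x xX) => y yX; rewrite IH.
Qed.

Lemma weight_C_ge0 (j : nat) : (1 <= j)%N -> 0 <= C j.
Proof.
case: hw => _ _ _ _ h j1; have := h j j1 0 => /(le_trans (normr_ge0 _)).
by rewrite pmulr_lge0// invr_gt0 exprn_gt0.
Qed.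

Lemma weight_lipschitz (x y : R) : `|w y - w x| <= C 1 / X * `|y - x|.
Proof.
wlog xy : x y / x <= y.
  move=> h; have [xy|/ltW yx] := leP x y; first exact: h.
  by rewrite distrC [X in _ <= _ * X]distrC; apply: h.
have [c _ ->] := MVT_everywhere xy (fun z => weight_is_derive 0 z).
rewrite normrM ler_wpM2r//; case: hw => _ _ _ _ h.
by have := h 1%N isT c; rewrite expr1.
Qed.

(** The derivative bounds start at order 1, so the size of [w] comes from [w 0 = 0] and the
    Lipschitz constant [C 1 / X] over a distance of at most [2 X]. *)
Lemma weight_le (x : R) : w x <= 2 * C 1.
Proof.
have C0 := weight_C_ge0 (isT : (1 <= 1)%N).
have [/andP[x1 x2]|xX] := boolP (X <= x <= 2 * X); last by rewrite weight_eq0// mulr_ge0.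
have w0 : w 0 = 0 by apply: weight_eq0; apply/negP => /andP[h0 _]; move: X_gt0; rewrite ltNge h0.
have := weight_lipschitz 0 x; rewrite w0 !subr0 ger0_norm ?weight_ge0// ger0_norm; last by lra.
move=> /le_trans; apply; rewrite mulrAC ler_pdivrMr//.
by rewrite -mulrA [X in _ <= X]mulrCA ler_wpM2l.
Qed.

(** * The mixed second difference of the weight composed with the form *)

Section Mixed.
Variables (a1 b1 c1 : int).
Hypotheses (a1_gt0 : 0 < a1) (c1_gt0 : 0 < c1) (Delta_gt0 : 0 < bqf_Delta a1 b1 c1).
Let a : R := a1%:~R.
Let b : R := b1%:~R.
Let c : R := c1%:~R.
Let QR (x y : R) : R := a * x ^+ 2 + b * x * y + c * y ^+ 2.

Definition mixed_constant : R := 4 * (a1%:~R + c1%:~R) * C 2 + `|b1%:~R| * C 1.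

Lemma is_derive_QRx (x y : R) : is_derive x 1 (fun x => QR x y) (2 * a * x + b * y).
Proof.
rewrite /QR; apply: is_derive_eq.
by rewrite /GRing.scale /=; ring.
Qed.

Lemma is_derive_QRy (x y : R) : is_derive y 1 (fun y => QR x y) (b * x + 2 * c * y).
Proof.
rewrite /QR; apply: is_derive_eq.
by rewrite /GRing.scale /=; ring.
Qed.

Lemma is_derive_lin (x y : R) : is_derive y 1 (fun y => 2 * a * x + b * y) b.
Proof.
apply: is_derive_eq.
by rewrite /GRing.scale /=; ring.
Qed.

(** The expression is the mixed partial derivative of [w (Q x y)]. Completing the square bounds the
    squares of the partial derivatives of [Q] by [4 a Q] and [4 c Q], so their product is at most
    [2 (a + c) Q]. This is at most [4 (a + c) X] wherever [w''] can be nonzero, and is compensated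
    by [C 2 / X ^ 2]. *)
Lemma weight_second_partial (x y : R) :
  `|derive1n 2 w (QR x y) * (b * x + 2 * c * y) * (2 * a * x + b * y) + derive1n 1 w (QR x y) * b|
  <= mixed_constant / X.
Proof.
have a0 : 0 < a by rewrite ltr0z.
have c0 : 0 < c by rewrite ltr0z.
have D0 : 0 < 4 * a * c - b ^+ 2.
  have := Delta_gt0; rewrite -(ltr_int R) /bqf_Delta intrB !intrM.
  by rewrite expr2.
have C2 := weight_C_ge0 (isT : (1 <= 2)%N).
have [_ _ _ _ h] := hw.
have h1 := h 1%N isT (QR x y); have h2 := h 2%N isT (QR x y).
rewrite expr1 in h1.
set L1 := 2 * a * x + b * y; set L2 := b * x + 2 * c * y.
have q1 : L1 ^+ 2 <= 4 * a * QR x y.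
  have -> : 4 * a * QR x y = L1 ^+ 2 + (4 * a * c - b ^+ 2) * y ^+ 2 by rewrite /QR /L1; ring.
  by rewrite lerDl mulr_ge0 ?sqr_ge0// ltW.
have q2 : L2 ^+ 2 <= 4 * c * QR x y.
  have -> : 4 * c * QR x y = L2 ^+ 2 + (4 * a * c - b ^+ 2) * x ^+ 2 by rewrite /QR /L2; ring.
  by rewrite lerDl mulr_ge0 ?sqr_ge0// ltW.
have L12 : `|L2 * L1| <= 2 * (a + c) * QR x y.
  have amgm (p q s t : R) : p ^+ 2 <= 2 * s -> q ^+ 2 <= 2 * t -> `|q * p| <= s + t.
    move=> ps qt; have := sqr_ge0 (p + q); have := sqr_ge0 (p - q) => g1 g2.
    by rewrite ler_norml; apply/andP; split; nra.
  have -> : 2 * (a + c) * QR x y = 2 * a * QR x y + 2 * c * QR x y by ring.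
  by apply: amgm; [apply: le_trans q1 _|apply: le_trans q2 _]; rewrite le_eqVlt; apply/orP; left; apply/eqP; ring.
rewrite /mixed_constant mulrDl; apply: le_trans (ler_normD _ _) _; apply: lerD; last first.
  by rewrite normrM mulrC -mulrA ler_wpM2l.
rewrite -mulrA normrM.
have [QX|QX] := ltP (2 * X) (QR x y).
  rewrite weight_derive_eq0// normr0 mul0r divr_ge0 ?(ltW X_gt0)// !mulr_ge0// addr_ge0// ltW//.
apply: le_trans (_ : C 2 * X ^- 2 * (2 * (a + c) * (2 * X)) <= _).
  apply: ler_pM => //; apply: le_trans L12 _.
  by rewrite ler_wpM2l// mulr_ge0// addr_ge0// ltW.
rewrite le_eqVlt; apply/orP; left; apply/eqP; rewrite -/a -/c; field.
by rewrite gt_eqF.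
Qed.

(** The mean value theorem in [x] and then in [y] gives [d ^ 2] times the mixed partial derivative
    at an intermediate point. *)
Lemma weight_mixed_difference (d : nat) (x0 y0 : int) (s t : nat) :
  `|mixed_difference (fun k l => w (bqf a1 b1 c1 (x0 + d%:Z * k%:Z) (y0 + d%:Z * l%:Z))%:~R) s t|
  <= d%:R ^+ 2 * (mixed_constant / X).
Proof.
pose x (k : nat) : R := x0%:~R + d%:R * k%:R.
pose y (k : nat) : R := y0%:~R + d%:R * k%:R.
have QE k l : (bqf a1 b1 c1 (x0 + d%:Z * k%:Z) (y0 + d%:Z * l%:Z))%:~R = QR (x k) (y l).
  have cast (z : int) (k' : nat) : (z + d%:Z * k'%:Z)%:~R = z%:~R + d%:R * k'%:R :> R.
    by rewrite intrD intrM.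
  rewrite /bqf /QR /x /y -!cast; move: (x0 + _) (y0 + _) => u v.
  by rewrite !expr2 !(intrD, intrM).
have stepx : x s <= x s.+1 by rewrite lerD2l ler_wpM2l// ler_nat.
have stepy : y t <= y t.+1 by rewrite lerD2l ler_wpM2l// ler_nat.
have dx : x s.+1 - x s = d%:R by rewrite /x -[s.+1%:R]natr1; ring.
have dy : y t.+1 - y t = d%:R by rewrite /y -[t.+1%:R]natr1; ring.
have wcomp (f df g : R -> R) (z dg : R) : is_derive (g z) 1 f (df (g z)) -> is_derive z 1 g dg ->
    is_derive z 1 (fun z => f (g z)) (df (g z) * dg).
  by move=> h1 h2; exact: (@is_derive1_comp R f g z _ _ h1 h2).
have der1 (z : R) : is_derive z 1 (fun z => w (QR z (y t.+1)) - w (QR z (y t)))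
   (derive1n 1 w (QR z (y t.+1)) * (2 * a * z + b * y t.+1) - derive1n 1 w (QR z (y t)) * (2 * a * z + b * y t)).
  have k1 := wcomp w (derive1n 1 w) (fun z => QR z (y t.+1)) z _ (weight_is_derive 0 _) (is_derive_QRx z (y t.+1)).
  have k2 := wcomp w (derive1n 1 w) (fun z => QR z (y t)) z _ (weight_is_derive 0 _) (is_derive_QRx z (y t)).
  exact: (is_deriveB k1 k2).
have [xi _ E1] := MVT_everywhere stepx der1.
have der2 (z : R) : is_derive z 1 (fun z => derive1n 1 w (QR xi z) * (2 * a * xi + b * z))
   (derive1n 2 w (QR xi z) * (b * xi + 2 * c * z) * (2 * a * xi + b * z) + derive1n 1 w (QR xi z) * b).
  have k1 := wcomp (derive1n 1 w) (derive1n 2 w) (fun z => QR xi z) z _ (weight_is_derive 1 _) (is_derive_QRy xi z).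
  have k2 := is_derive_lin xi z.
  apply: (is_derive_eq (is_deriveM k1 k2)).
  by rewrite /GRing.scale /=; ring.
have [eta _ E2] := MVT_everywhere stepy der2.
rewrite /mixed_difference !QE.
have -> : w (QR (x s) (y t)) - w (QR (x s.+1) (y t)) - (w (QR (x s) (y t.+1)) - w (QR (x s.+1) (y t.+1)))
   = w (QR (x s.+1) (y t.+1)) - w (QR (x s.+1) (y t)) - (w (QR (x s) (y t.+1)) - w (QR (x s) (y t))) by ring.
rewrite E1 E2 dx dy normrM normrM (ger0_norm (ler0n _ _)) -mulrA mulrC -expr2.
by rewrite ler_wpM2l ?sqr_ge0// weight_second_partial.
Qed.

End Mixed.

Local Notation mu := (@lebesgue_measure R).

Lemma weight_continuous : continuous w.
Proof.
move=> x; apply/differentiable_continuous/derivable1_diffP.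
by case: (weight_is_derive 0 x).
Qed.

Lemma integrable_continuous_itv (f : R -> R) (u v : R) : continuous f ->
  mu.-integrable `[u, v[ (EFin \o f).
Proof.
move=> cf; apply: (@integrableS _ _ _ mu `[u, v]) => //.
  by apply: subset_itvl; rewrite bnd_simp.
apply: continuous_compact_integrable; first exact: segment_compact.
exact: continuous_subspaceT.
Qed.

Lemma weight_integral_step (n : nat) :
  `| \int[mu]_(x in `[n%:R, n.+1%:R[) w x - w n%:R | <= C 1 / X.
Proof.
have m1 : fine (mu (`[n%:R, n.+1%:R[ : set R)) = 1.
  by rewrite lebesgue_measure_itv /= lte_fin ltr_nat ltnSn /= -natr1 addrAC subrr add0r.
have cst_int (k : R) : \int[mu]_(x in `[n%:R, n.+1%:R[) k = k.
  by rewrite Rintegral_cst// m1 mulr1.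
have ci (k : R) : mu.-integrable `[n%:R, n.+1%:R[ (EFin \o (fun _ : R => k)).
  by apply: integrable_continuous_itv => x; exact: cvg_cst.
have wi := integrable_continuous_itv n%:R n.+1%:R weight_continuous.
have bd (x : R) : x \in `[n%:R, n.+1%:R[ -> `|w x - w n%:R| <= C 1 / X.
  rewrite in_itv /= => /andP[x1 x2].
  apply: le_trans (weight_lipschitz _ _) _; rewrite ler_piMr//.
    by rewrite divr_ge0 ?weight_C_ge0// ltW.
  by rewrite ger0_norm ?subr_ge0// lerBlDr addrC natr1 ltW.
rewrite ler_distl; apply/andP; split.
  rewrite -[X in X <= _]cst_int; apply: le_Rintegral => // x xI.
  by have := bd x xI; rewrite ler_distl => /andP[].
rewrite -[X in _ <= X]cst_int; apply: le_Rintegral => // x xI.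
by have := bd x xI; rewrite ler_distl => /andP[].
Qed.

Lemma weight_integral_sum (N : nat) : 2 * X < N%:R ->
  `| \int[mu]_(x in `[0, +oo[) w x - \sum_(n < N) w n%:R | <= N%:R * (C 1 / X).
Proof.
move=> XN.
have -> : \int[mu]_(x in `[0, +oo[) w x = \int[mu]_(x in `[0, N%:R[) w x.
  have -> : `[0, N%:R[%classic = `[0, +oo[ `&` `[0, N%:R[ :> set R.
    by rewrite setIC; apply/esym/setIidPl; apply: subset_itvl.
  rewrite Rintegral_mkcondr; apply: eq_Rintegral => x /set_mem /=; rewrite in_itv /= andbT => x0.
  rewrite patchE; case: ifPn => // /negP xN; apply: weight_eq0; apply/negP => /andP[_ x2]; apply: xN.
  by apply/mem_set; rewrite /= in_itv /= x0 /=; exact: le_lt_trans x2 XN.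
move: XN => _; elim: N => [|N IH].
  by rewrite big_ord0 mul0r set_itvco0 Rintegral_set0 subr0 normr0.
have -> : \int[mu]_(x in `[0, N.+1%:R[) w x =
   \int[mu]_(x in `[0, N%:R[) w x + \int[mu]_(x in `[N%:R, N.+1%:R[) w x.
  rewrite -Rintegral_setU//.
  - by rewrite -itv_bndbnd_setU// bnd_simp// ler_nat.
  - by rewrite -itv_bndbnd_setU ?bnd_simp ?ler_nat//; apply: integrable_continuous_itv weight_continuous.
  - apply/disj_setPS => y [/=]; rewrite 2!in_itv/= => /andP[_ yx] /andP[].
    by rewrite leNgt yx.
rewrite big_ord_recr /= opprD addrACA -[N.+1%:R]natr1 mulrDl mul1r.
apply: le_trans (ler_normD _ _) _; apply: lerD => //.
by have := weight_integral_step N; rewrite natr1.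
Qed.

End Weight.

Section Class_weight.
Variables (R : realType) (a1 b1 c1 : int) (X : R) (C : nat -> R) (w : R -> R).
Hypotheses (a1_gt0 : 0 < a1) (c1_gt0 : 0 < c1) (Delta_gt0 : 0 < bqf_Delta a1 b1 c1).
Hypotheses (X_gt1 : 1 < X) (hw : weight X C w).
Variables (N M : nat).
Hypotheses (N_gt : 2 * X < N%:R) (M_gt0 : (0 < M)%N)
  (M_a : 4 * a1 * N%:Z <= M%:Z ^+ 2) (M_c : 4 * c1 * N%:Z <= M%:Z ^+ 2).
Let Q := bqf a1 b1 c1.
Let K := (2 * M).+1.
Let X_gt0 : 0 < X. Proof. exact: lt_trans X_gt1. Qed.

Lemma weight_bqf_eq0 (x y : int) : ~~ ((`|x| <= M%:Z) && (`|y| <= M%:Z)) -> w (Q x y)%:~R = 0.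
Proof.
move=> xy; apply: (weight_eq0 hw); apply/negP => /andP[_ Q2].
have QN : Q x y <= N%:Z.
  by rewrite -(ler_int R); apply: le_trans Q2 _; exact: ltW.
by have [h1 h2] := bqf_le_box a1_gt0 Delta_gt0 M_a M_c QN; move: xy; rewrite h1 h2.
Qed.

Variables (d : nat) (u v : int).
Hypotheses (d_gt0 : (0 < d)%N) (u_lt : 0 <= u < d%:Z) (v_lt : 0 <= v < d%:Z).
Let x (k : nat) : int := u - d%:Z * M%:Z + d%:Z * k%:Z.
Let y (l : nat) : int := v - d%:Z * M%:Z + d%:Z * l%:Z.
Let W (k l : nat) : R := w (Q (x k) (y l))%:~R.

(** The index [K = 2 M + 1] is the first one past the enumerated range; the vanishing of the weight
    there is the boundary condition of both Abel summations. *)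
Lemma class_edge (z : int) : 0 <= z < d%:Z -> ~~ (`|z - d%:Z * M%:Z + d%:Z * K%:Z| <= M%:Z).
Proof.
move=> zd; apply/negP => h; have := class_index_range d_gt0 M_gt0 zd h.
by rewrite ltxx andbF.
Qed.

Lemma class_edge_left (l : nat) : W K l = 0.
Proof. by apply: weight_bqf_eq0; rewrite (negbTE (class_edge u_lt)). Qed.

Lemma class_edge_right (k : nat) : W k K = 0.
Proof. by apply: weight_bqf_eq0; rewrite (negbTE (class_edge v_lt)) andbF. Qed.

Lemma class_variation : \sum_(s < K) \sum_(t < K) `|mixed_difference W s t| <=
  K%:R ^+ 2 * (d%:R ^+ 2 * (mixed_constant C a1 b1 c1 / X)).
Proof.
apply: (@le_trans _ _ (\sum_(s < K) \sum_(t < K) (d%:R ^+ 2 * (mixed_constant C a1 b1 c1 / X)))).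
  apply: ler_sum => s _; apply: ler_sum => t _.
  exact: (weight_mixed_difference X_gt0 hw a1_gt0 c1_gt0 Delta_gt0).
move: (d%:R ^+ 2 * _) => B.
by rewrite !sumr_const !card_ord -[B *+ K]mulr_natl -[_ *+ K]mulr_natl mulrA -expr2.
Qed.

(** Lattice points are grouped by the value of [Q]. Abel summation writes this sum, and the sum of
    [w] over the integers, with the same differences [w s - w (s + 1)], against [ellipse_count] and
    against [s] respectively. Comparison is then termwise. *)
Lemma class_weight_sum :
  `| \sum_(k < K) \sum_(l < K) W k l - 2 * pi / (Num.sqrt (bqf_Delta a1 b1 c1)%:~R * d%:R ^+ 2)
       * \int[lebesgue_measure]_(x in `[0, +oo[) w x |
  <= N%:R * (C 1 / X) * ((4 + 4 * Num.sqrt a1%:~R) * Num.sqrt N%:R * 2 + 9).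
Proof.
set I := \int[_]_(x in _) _.
set kap := 2 * pi / _.
have Qge0 z z' : 0 <= Q z z' by exact: bqf_ge0.
have C0 : 0 <= C 1 / X by rewrite divr_ge0 ?(weight_C_ge0 X_gt0 hw)// ltW.
have wN : w N%:R = 0.
  by apply: (weight_eq0 hw); apply/negP => /andP[_]; rewrite leNgt N_gt.
pose r (n : nat) : R := \sum_(k < K) \sum_(l < K) (Q (x k) (y l) == n%:Z)%:R.
have Wn (z z' : int) : w (Q z z')%:~R = \sum_(n < N) w n%:R * (Q z z' == (n : nat)%:Z)%:R.
  have [n Qn] : exists n : nat, Q z z' = n%:Z by exists (absz (Q z z')); have := Qge0 z z'; lia.
  rewrite Qn; have [nN|nN] := ltnP n N.
    rewrite (bigD1 (Ordinal nN))//= eqxx mulr1 big1 ?addr0// => i /eqP iN.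
    by case: eqP => [[e]|_]; rewrite ?mulr0//; case: iN; exact/val_inj.
  rewrite big1; last by move=> i _; case: eqP => [[e]|_]; rewrite ?mulr0//; have := ltn_ord i; lia.
  apply: (weight_eq0 hw); apply/negP => /andP[_ n2].
  have := lt_le_trans N_gt (_ : N%:R <= n%:R); rewrite ler_nat => /(_ nN).
  by rewrite ltNge n2.
have S2 : \sum_(k < K) \sum_(l < K) W k l = \sum_(n < N) w n%:R * r n.
  rewrite /W; under eq_bigr do under eq_bigr do rewrite Wn.
  under eq_bigr do rewrite exchange_big.
  rewrite exchange_big /=; apply: eq_bigr => n _.
  by rewrite /r mulr_sumr; apply: eq_bigr => k _; rewrite mulr_sumr.
have cnt (s : nat) : \sum_(n < s.+1) r n = ellipse_count R a1 b1 c1 d M u v s.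
  rewrite /r /ellipse_count exchange_big /=; apply: eq_bigr => k _.
  rewrite exchange_big /=; apply: eq_bigr => l _.
  rewrite -/(x k) -/(y l).
  have [n Qn] : exists n : nat, Q (x k) (y l) = n%:Z by exists (absz (Q (x k) (y l))); have := Qge0 (x k) (y l); lia.
  rewrite -/Q Qn lez_nat; have [nN|nN] := ltnP n s.+1.
    rewrite (bigD1 (Ordinal nN))//= eqxx big1 ?addr0; last first.
      by move=> i /eqP iN; case: eqP => [[e]|_] //; case: iN; exact/val_inj.
    by rewrite -ltnS nN.
  rewrite big1; last by move=> i _; case: eqP => [[e]|_] //; have := ltn_ord i; lia.
  by rewrite leqNgt nN.
have S3 : \sum_(k < K) \sum_(l < K) W k l = \sum_(s < N) (w s%:R - w s.+1%:R) * ellipse_count R a1 b1 c1 d M u v s.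
  rewrite S2 (@abel_summation R N (fun n => w n%:R) r)//.
  by apply: eq_bigr => s _; rewrite cnt.
have w0 : w 0%:R = 0.
  apply: (weight_eq0 hw); apply/negP => /andP[h0 _]; move: X_gt0; rewrite ltNge.
  by rewrite h0.
(* The value [n = 0] is removed, which is free since [w 0 = 0], so that the partial counts are
   exactly [s] and not [s + 1]. *)
have S4 : \sum_(n < N) w n%:R = \sum_(s < N) (w s%:R - w s.+1%:R) * s%:R.
  have -> : \sum_(n < N) w n%:R = \sum_(n < N) w n%:R * ((0 < n)%N)%:R.
    by apply: eq_bigr => -[[|n] nN] _ /=; rewrite ?mulr1// w0 mul0r.
  rewrite (@abel_summation R N (fun n => w n%:R) (fun n => ((0 < n)%N)%:R))//.
  apply: eq_bigr => s _; congr (_ * _).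
  by rewrite big_ord_recl /= add0r (eq_bigr (fun=> 1))// sumr_const card_ord.
have lip (s : nat) : `|w s%:R - w s.+1%:R| <= C 1 / X.
  apply: le_trans (weight_lipschitz hw _ _) _.
  by rewrite -natr1 opprD addrA subrr sub0r normrN1 mulr1.
have pi4 : pi <= 4 :> R by have := pihalf_lt2 R; lra.
set Dl := bqf_Delta a1 b1 c1 in kap *.
have D1 : 1 <= Num.sqrt Dl%:~R :> R.
  have Dl1 : (1 : R) <= Dl%:~R by rewrite -[1]/(1%:~R) ler_int; have := Delta_gt0; rewrite -/Dl; lia.
  by rewrite -[X in X <= _](sqrtr1 R) ler_wsqrtr.
have d1 : 1 <= d%:R ^+ 2 :> R by rewrite exprn_ege1// ler1n.
have kap0 : 0 <= kap by rewrite divr_ge0 ?mulr_ge0 ?pi_ge0 ?sqrtr_ge0.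
have kap8 : kap <= 8.
  rewrite ler_pdivrMr; last by rewrite mulr_gt0//; lra.
  have : 1 <= Num.sqrt Dl%:~R * d%:R ^+ 2 :> R by rewrite mulr_ege1.
  lra.
set E := (4 + 4 * Num.sqrt a1%:~R) * Num.sqrt N%:R * 2 + 1 : R.
have E0 : 0 <= E by rewrite addr_ge0// !mulr_ge0 ?addr_ge0 ?mulr_ge0 ?sqrtr_ge0.
have sqN (s : nat) : (s < N)%N -> 4 * a1 * s%:Z <= M%:Z ^+ 2 /\ 4 * c1 * s%:Z <= M%:Z ^+ 2.
  move=> sN; split; [apply: le_trans M_a|apply: le_trans M_c]; rewrite ler_wpM2l//; clear -sN a1_gt0 c1_gt0; lia.
have e1 : `|\sum_(k < K) \sum_(l < K) W k l - kap * \sum_(n < N) w n%:R| <= N%:R * (C 1 / X) * E.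
  rewrite S3 S4 mulr_sumr -sumrB.
  apply: le_trans (ler_norm_sum _ _ _) _.
  apply: (@le_trans _ _ (\sum_(s < N) (C 1 / X) * E)); last first.
    by rewrite sumr_const card_ord -[_ *+ N]mulr_natl mulrA.
  apply: ler_sum => -[s sN] _ /=.
  rewrite mulrCA -mulrBr normrM.
  (* The ellipse asymptotic requires a positive level; at level 0 the difference vanishes because
     [1 < X]. *)
  case: s sN => [|s] sN.
    have -> : w 0%:R - w 1%:R = 0.
      rewrite w0 (weight_eq0 hw) ?subrr//; apply/negP => /andP[h1 _].
      by move: X_gt1; rewrite ltNge h1.
    by rewrite normr0 mul0r mulr_ge0.
  apply: ler_pM => //.
  have [m1 m2] := sqN s.+1 sN.
  have := @ellipse_count_asymptotic R a1 b1 c1 a1_gt0 Delta_gt0 d M u v d_gt0 u_lt v_lt M_gt0 s.+1 isT m1 m2.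
  rewrite -/Dl mulrAC -/kap => /le_trans; apply.
  rewrite lerD2r ler_wpM2r// ler_wpM2l ?addr_ge0 ?mulr_ge0 ?sqrtr_ge0//.
  by rewrite ler_wsqrtr// ler_nat ltnW.
have e2 : `|kap * (\sum_(n < N) w n%:R) - kap * I| <= 8 * (N%:R * (C 1 / X)).
  rewrite -mulrBr normrM (ger0_norm kap0); apply: ler_pM => //.
  rewrite distrC; exact: weight_integral_sum X_gt0 hw _ N_gt.
have -> : \sum_(k < K) \sum_(l < K) W k l - kap * I =
  (\sum_(k < K) \sum_(l < K) W k l - kap * \sum_(n < N) w n%:R) + (kap * (\sum_(n < N) w n%:R) - kap * I) by ring.
apply: le_trans (ler_normD _ _) _; apply: le_trans (lerD e1 e2) _.
by rewrite /E le_eqVlt; apply/orP; left; apply/eqP; ring.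
Qed.

End Class_weight.

(** * The sieve over prime divisors *)

Section Subsets.

Fixpoint sublists (T : Type) (s : seq T) : seq (seq T) :=
  if s is x :: s' then sublists s' ++ map (cons x) (sublists s') else [:: [::]].

Lemma size_sublists (T : Type) (s : seq T) : size (sublists s) = (2 ^ size s)%N.
Proof. by elim: s => //= x s IH; rewrite size_cat size_map IH expnS mul2n addnn. Qed.

Lemma sublists_subseq (T : eqType) (s A : seq T) : A \in sublists s -> subseq A s.
Proof.
elim: s A => [|x s IH] A; first by rewrite inE => /eqP ->.
rewrite [sublists _]/= mem_cat => /orP[/IH h|/mapP[B /IH h ->]].
  exact: subseq_trans h (subseq_cons _ _).
by rewrite /= eqxx.
Qed.

Lemma prod_1B_sublists (R : comNzRingType) (T : Type) (s : seq T) (f : T -> R) :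
  \prod_(p <- s) (1 - f p) = \sum_(A <- sublists s) (-1) ^+ size A * \prod_(p <- A) f p.
Proof.
elim: s => [|x s IH] /=; first by rewrite big_nil big_seq1 big_nil expr0 mulr1.
rewrite big_cons IH big_cat big_map /= mulrBl mul1r; congr (_ + _).
rewrite -mulNr mulr_sumr; apply: eq_bigr => A _.
by rewrite big_cons exprS; ring.
Qed.

Lemma dvdn_prod_primes (A : seq nat) (n : nat) : uniq A -> all prime A ->
  (\prod_(p <- A) p %| n)%N = all (fun p => (p %| n)%N) A.
Proof.
move=> uA pA; apply/idP/allP => [h p pA'|h]; last exact: prod_primes_dvdn.
by apply: dvdn_trans h; rewrite (big_rem p)//= dvdn_mulr.
Qed.

Lemma prime_ndvd_prod (p : nat) (s : seq nat) : prime p -> all prime s -> p \notin s ->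
  ~~ (p %| \prod_(r <- s) r)%N.
Proof.
move=> pp; elim: s => [|r s IH] /=; first by rewrite big_nil dvdn1; case: p pp => [|[|]].
rewrite inE negb_or => /andP[rp sp] /andP[pr ps].
by rewrite big_cons Euclid_dvdM// negb_or IH// dvdn_prime2// pr.
Qed.

(** The left side is the number of terms of the inclusion-exclusion; the divisor bound then makes it
    smaller than any power of [q]. *)
Lemma expn2_size_primes (q : nat) : (0 < q)%N -> (2 ^ size (primes q) <= size (divisors q))%N.
Proof.
move=> q0.
have dbl (p m : nat) : prime p -> (0 < m)%N -> ~~ (p %| m)%N ->
    (2 * size (divisors m) <= size (divisors (p * m)))%N.
  move=> pp m0 pm; have p0 := prime_gt0 pp.
  have -> : (2 * size (divisors m) = size (divisors m ++ map (muln p) (divisors m)))%N.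
    by rewrite size_cat size_map; lia.
  apply: uniq_leq_size.
    rewrite cat_uniq divisors_uniq map_inj_uniq ?divisors_uniq ?andbT; last first.
      by move=> x y /eqP; rewrite eqn_pmul2l// => /eqP.
    apply/hasPn => _ /mapP[x _ ->]; apply/negP; rewrite /= -dvdn_divisors// => h.
    by move: pm; rewrite (dvdn_trans _ h)// dvdn_mulr.
  move=> x; rewrite mem_cat -!dvdn_divisors ?muln_gt0 ?p0// => /orP[h|/mapP[y]].
    by rewrite dvdn_mull.
  by rewrite -dvdn_divisors// => h ->; rewrite dvdn_pmul2l.
have main (s : seq nat) : uniq s -> all prime s -> (2 ^ size s <= size (divisors (\prod_(p <- s) p)))%N.
  elim: s => [|p s IH] /=; first by rewrite big_nil.
  move=> /andP[ps us] /andP[pp sp]; rewrite big_cons expnS.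
  apply: leq_trans (dbl p _ pp _ _); first by rewrite leq_mul2l IH.
    by rewrite big_seq prodn_cond_gt0// => r rs; apply/prime_gt0/(allP sp).
  exact: prime_ndvd_prod.
have pr : all prime (primes q) by apply/allP => p; rewrite mem_primes => /and3P[].
apply: leq_trans (main _ (primes_uniq q) pr) _.
have dq : (\prod_(p <- primes q) p %| q)%N.
  apply: prod_primes_dvdn => //; first exact: primes_uniq.
  by move=> p; rewrite mem_primes => /and3P[].
apply: uniq_leq_size; first exact: divisors_uniq.
move=> x; rewrite -!dvdn_divisors//; first by move=> h; apply: dvdn_trans dq.
by apply: dvdn_gt0 dq.
Qed.

Lemma coprime_prod_primes (R : comNzRingType) (q : nat) (n : int) : (0 < q)%N ->
  (coprimez n q%:Z)%:R = \prod_(p <- primes q) (1 - ((p%:Z %| n)%Z)%:R) :> R.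
Proof.
move=> q0; rewrite /coprimez /gcdz /=.
case: (boolP (coprime `|n| q)) => cq.
  have -> : (Posz (gcdn `|n| q) == 1) by move: cq; rewrite /coprime => /eqP ->.
  rewrite big_seq big1// => p; rewrite mem_primes => /and3P[pp _ pq].
  case: (boolP (p%:Z %| n)%Z) => pn; last by rewrite subr0.
  have : (p %| gcdn `|n| q)%N by rewrite dvdn_gcd pq andbT.
  by move: cq; rewrite /coprime => /eqP ->; rewrite dvdn1 => /eqP p1; move: pp; rewrite p1.
have -> : (Posz (gcdn `|n| q) == 1) = false.
  by apply/negP => /eqP [] e; move: cq; rewrite /coprime e eqxx.
have g1 : (1 < gcdn `|n| q)%N.
  by rewrite ltn_neqAle eq_sym gcdn_gt0 q0 orbT andbT.
pose p := pdiv (gcdn `|n| q).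
have pp : prime p by apply: pdiv_prime.
have pg : (p %| gcdn `|n| q)%N by apply: pdiv_dvd.
have /andP[pn pq] : (p %| `|n|)%N && (p %| q)%N by rewrite -dvdn_gcd.
rewrite (big_rem p) ?mem_primes ?pp ?q0 ?pq//=.
have -> : (p%:Z %| n)%Z by rewrite dvdzE.
by rewrite subrr mul0r.
Qed.

Lemma prod_dvdz_indicator (R : comNzRingType) (A : seq nat) (n : int) : uniq A -> all prime A ->
  \prod_(p <- A) ((p%:Z %| n)%Z)%:R = (((\prod_(p <- A) p)%N%:Z %| n)%Z)%:R :> R.
Proof.
move=> uA pA; rewrite dvdzE /= dvdn_prod_primes//.
elim: A {uA pA} => [|p A IH]; first by rewrite big_nil.
by rewrite big_cons IH /= dvdzE /= -natrM mulnb.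
Qed.

Lemma sum_zrange_classes (R : comNzRingType) (d M : nat) (g : int -> R) : (0 < d)%N -> (0 < M)%N ->
  (forall x : int, M%:Z < `|x| -> g x = 0) ->
  \sum_(x <- zrange M) g x =
  \sum_(u < d) \sum_(k < (2 * M).+1) g ((u : nat)%:Z - d%:Z * M%:Z + d%:Z * (k : nat)%:Z).
Proof.
move=> d0 M0 g0.
have -> : \sum_(u < d) \sum_(k < (2 * M).+1) g ((u : nat)%:Z - d%:Z * M%:Z + d%:Z * (k : nat)%:Z) =
   \sum_(0 <= i < (2 * M).+1 * d) g (i%:Z - d%:Z * M%:Z).
  have shift i (F : nat -> R) : \sum_(i * d <= j < i.+1 * d) F j = \sum_(j < d) F (i * d + j)%N.
    rewrite -{1}[(i * d)%N]add0n big_addn mulSn addnK big_mkord.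
    by apply: eq_bigr => j _; rewrite addnC.
  rewrite exchange_big big_nat_mul big_mkord; apply: eq_bigr => k _.
  rewrite shift; apply: eq_bigr => u _; congr g.
  by rewrite PoszD PoszM; ring.
rewrite -[RHS](big_map (fun i : nat => i%:Z - d%:Z * M%:Z) xpredT g).
set t := map _ _.
have ut : uniq t by rewrite map_inj_uniq ?iota_uniq// => i j /addIr [].
rewrite [RHS](bigID (fun x => x \in zrange M)) /= [X in _ = _ + X]big1 ?addr0; last first.
  by move=> x; rewrite mem_zrange -ltNge => /g0.
rewrite -[RHS]big_filter; apply: perm_big; apply: uniq_perm; first exact: zrange_uniq.
  exact: filter_uniq.
move=> x; rewrite mem_filter mem_zrange; case: (boolP (`|x| <= M%:Z)) => //= xM.
apply/esym/mapP; exists (absz (x + d%:Z * M%:Z)).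
  have dM : M%:Z <= d%:Z * M%:Z by rewrite -{1}[M%:Z]mul1r ler_wpM2r//; lia.
  have : (((2 * M).+1 * d)%N%:Z = 2 * (d%:Z * M%:Z) + d%:Z) by rewrite PoszM -addn1 PoszD PoszM; ring.
  rewrite mem_index_iota; move: (d%:Z * M%:Z) dM xM d0 => z zM xM d0 e.
  by rewrite -(ltz_nat _ ((2 * M).+1 * d)) e; lia.
have dM : M%:Z <= d%:Z * M%:Z by rewrite -{1}[M%:Z]mul1r ler_wpM2r//; lia.
by move: (d%:Z * M%:Z) dM xM => z zM xM; lia.
Qed.

End Subsets.

(** * The sum [SQ] over a box of lattice points *)

Section Box_sum.
Variables (R : realType) (a1 b1 c1 : int) (X : R) (C : nat -> R) (w : R -> R).
Hypotheses (a1_gt0 : 0 < a1) (c1_gt0 : 0 < c1) (Delta_gt0 : 0 < bqf_Delta a1 b1 c1).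
Hypotheses (X_gt1 : 1 < X) (hw : weight X C w).
Variables (N M : nat).
Hypotheses (N_gt : 2 * X < N%:R) (M_gt0 : (0 < M)%N)
  (M_a : 4 * a1 * N%:Z <= M%:Z ^+ 2) (M_c : 4 * c1 * N%:Z <= M%:Z ^+ 2).
Let Q := bqf a1 b1 c1.
Let box := [seq (x, y) | x <- zrange M, y <- zrange M].

Lemma box_uniq : uniq box.
Proof. by apply: allpairs_uniq; rewrite ?zrange_uniq// => -[? ?] [? ?]. Qed.

Definition box_count (n : nat) : nat := count (fun xy : int * int => Q xy.1 xy.2 == n%:Z) box.

(** The bound [M] confines all solutions to the box, so the solution set is finite and [fset_set]
    does not fall back to its empty default. *)
Lemma rQ_box_count (n : nat) : (n < N)%N -> rQ a1 b1 c1 n%:Z = box_count n.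
Proof.
move=> nN; rewrite /rQ /box_count -size_filter.
set s := [seq xy <- box | _].
have us : uniq s by rewrite filter_uniq// box_uniq.
have -> : [set xy : int * int | bqf a1 b1 c1 xy.1 xy.2 = n%:Z] = [set` [fset x in s]%fset].
  apply/seteqP; split => -[x y] /=.
    move=> e; rewrite inE /= mem_filter /= /Q e eqxx /=.
    have QN : bqf a1 b1 c1 x y <= N%:Z by rewrite e; lia.
    have [h1 h2] := bqf_le_box a1_gt0 Delta_gt0 M_a M_c QN.
    by apply: allpairs_f; rewrite mem_zrange.
  by rewrite inE /= mem_filter => /andP[/eqP].
by rewrite set_fsetK card_fseq undup_id.
Qed.

Lemma weight_level_sum (g : int -> R) (x y : int) :
  w (Q x y)%:~R * g (Q x y) = \sum_(n < N) w n%:R * g (n : nat)%:Z * (Q x y == (n : nat)%:Z)%:R.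
Proof.
have [n Qn] : exists n : nat, Q x y = n%:Z.
  by exists (absz (Q x y)); have := bqf_ge0 a1_gt0 Delta_gt0 x y; rewrite -/Q; lia.
rewrite Qn; have [nN|nN] := ltnP n N.
  rewrite (bigD1 (Ordinal nN))//= eqxx mulr1 big1 ?addr0// => i /eqP iN.
  by case: eqP => [[e]|_]; rewrite ?mulr0//; case: iN; exact/val_inj.
rewrite big1; last by move=> i _; case: eqP => [[e]|_]; rewrite ?mulr0//; have := ltn_ord i; lia.
rewrite (weight_eq0 hw) ?mul0r//; apply/negP => /andP[_ n2].
have := lt_le_trans N_gt (_ : N%:R <= n%:R); rewrite ler_nat => /(_ nN).
by rewrite ltNge n2.
Qed.

Lemma box_level_sum (g : int -> R) :
  \sum_(xy <- box) w (Q xy.1 xy.2)%:~R * g (Q xy.1 xy.2) =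
  \sum_(n < N) w n%:R * g (n : nat)%:Z * (box_count n)%:R.
Proof.
under eq_bigr do rewrite weight_level_sum.
rewrite exchange_big /=; apply: eq_bigr => n _.
rewrite -mulr_sumr; congr (_ * _).
by rewrite /box_count -sum1_count natr_sum [RHS]big_mkcond /=; apply: eq_bigr => xy _; case: ifP.
Qed.

(** The support of [w] lies below [N], so the sums over sets are genuine finite sums. Since [b] is
    [a Q] modulo [q] and [a] is a unit, [b] is prime to [q] exactly when [Q] is; the condition thus
    leaves the sum over [b], which becomes a plain count. *)
Lemma SQ_box (beta : R) (q : nat) (a : int) : (0 < q)%N -> coprimez a q%:Z ->
  SQ a1 b1 c1 beta q a w = \sum_(xy <- box) w (Q xy.1 xy.2)%:~R *
    ((coprimez (Q xy.1 xy.2) q%:Z)%:R *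
     (short_count q (Num.truncn (Lq beta q)) (a * Q xy.1 xy.2))%:R).
Proof.
move=> q0 caq; set l := Num.truncn _.
have L0 : 0 <= Lq beta q by exact: powR_ge0.
have inner (b : int) : \sum_(n \in [set n : int | (n * a = b %[mod q%:Z])%Z])
      (rQ a1 b1 c1 n)%:R * w n%:~R =
    \sum_(xy <- box) w (Q xy.1 xy.2)%:~R * ((q%:Z %| a * Q xy.1 xy.2 - b)%Z)%:R.
  pose r : seq int := [seq n <- [seq Posz i | i <- iota 0 N] | (q%:Z %| a * n - b)%Z].
  have ur : uniq r by rewrite filter_uniq// map_inj_uniq ?iota_uniq// => i j [].
  have modE (n : int) : (n * a = b %[mod q%:Z])%Z <-> (q%:Z %| a * n - b)%Z.
    by rewrite -eqz_mod_dvd mulrC; split => [/eqP|/eqP].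
  rewrite -(@fsbig_widen _ _ _ _ [set` r]).
  - rewrite -fsbig_seq// big_filter big_map -[iota 0 N]/(iota 0 N).
    have -> : iota 0 N = index_iota 0 N by rewrite /index_iota subn0.
    rewrite big_mkcond big_mkord (box_level_sum (fun n => ((q%:Z %| a * n - b)%Z)%:R)).
    apply: eq_bigr => n _; rewrite -(rQ_box_count (ltn_ord n)).
    by case: ifP => _; rewrite ?mulr1 ?mulr0 ?mul0r// mulrC.
  - by move=> n /=; rewrite mem_filter => /andP[h _]; apply/modE.
  - move=> n /= [/modE qn nr]; rewrite (weight_eq0 hw) ?mulr0//.
    apply/negP => /andP[X1 X2]; apply: nr; rewrite mem_filter qn /=.
    have n0 : 0 < n by rewrite -(ltr_int R); apply: lt_le_trans X1; exact: lt_trans X_gt1.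
    have nN : n < N%:Z by rewrite -(ltr_int R); apply: le_lt_trans N_gt.
    by apply/mapP; exists (absz n); [rewrite mem_iota; lia|lia].
rewrite /SQ.
under eq_fsbigr do rewrite inner.
have -> : [set b : int | `|b|%:~R <= Lq beta q /\ coprimez b q%:Z] =
   [set` [seq b <- zrange l | coprimez b q%:Z]].
  have e (b : int) : ((`|b|%:~R : R) <= Lq beta q) = (b \in zrange l).
    rewrite mem_zrange -abszE -[(Posz _)%:~R]/(_%:R : R) lez_nat /l truncn_ge_nat//.
  apply/seteqP; split => b => [[h1 h2]|].
    by suff : b \in [seq b <- zrange l | coprimez b q%:Z] by []; rewrite mem_filter h2 -e.
  suff : b \in [seq b <- zrange l | coprimez b q%:Z] -> (`|b|%:~R <= Lq beta q) /\ coprimez b q%:Z by [].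
  by rewrite mem_filter => /andP[h1 h2]; split=> //; rewrite e.
rewrite -fsbig_seq; last by rewrite filter_uniq// zrange_uniq.
rewrite big_filter exchange_big /=; apply: eq_bigr => -[x y] _ /=.
rewrite -mulr_sumr; congr (_ * _).
rewrite /short_count -sum1_count natr_sum mulr_sumr big_mkcond [RHS]big_mkcond /=.
apply: eq_bigr => b _; case: (boolP (q%:Z %| a * Q x y - b)%Z) => qb; last by case: ifP.
have -> : coprimez b q%:Z = coprimez (Q x y) q%:Z.
  have [k kE] := dvdzP qb.
  have -> : b = - k * q%:Z + a * Q x y by rewrite mulNr -kE; ring.
  by rewrite coprimez_sym /coprimez gcdzMDl -/(coprimez _ _) coprimezMr coprimez_sym caq coprimez_sym.
by case: (coprimez _ _); rewrite ?mulr1.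
Qed.

(** The identity [4 a1 Q = (2 a1 x + b1 y) ^ 2 + Delta y ^ 2] embeds the solutions injectively into
    representations by a diagonal form. *)
Lemma box_count_le (n : nat) : (0 < n)%N ->
  (box_count n <= size (divisors (4 * `|a1| * n)) ^ 2 * (2 * (8 * `|bqf_Delta a1 b1 c1|).+1))%N.
Proof.
move=> n0; rewrite /box_count -size_filter.
pose f (xy : int * int) := (2 * a1 * xy.1 + b1 * xy.2, xy.2).
rewrite -(size_map f); apply: size_representations.
- by rewrite absz_gt0 gt_eqF.
- by rewrite !muln_gt0 n0 andbT /= absz_gt0 gt_eqF.
- rewrite map_inj_uniq ?filter_uniq ?box_uniq// => -[x y] [x' y'] [] e1 e2.
  rewrite e2 in e1 *; congr (_, _).
  have a2 : 2 * a1 != 0 by rewrite mulf_neq0// gt_eqF.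
  by apply: (mulfI a2); move: e1 => /addIr.
- move=> z /mapP[[x y]]; rewrite mem_filter /= => /andP[/eqP Qn _] ->{z}.
  rewrite /f /=; rewrite (gez0_abs (ltW Delta_gt0)).
  rewrite -(bqf_square_x a1 b1 c1 x y) -/Q Qn !PoszM.
  by rewrite (gez0_abs (ltW a1_gt0)).
Qed.

Lemma count_class_nat (q : nat) (a b : int) : (0 < q)%N -> coprimez a q%:Z ->
  (count (fun n : nat => (q%:Z %| (a * n%:Z - b)%R)%Z) (iota 0 N) <= (N %/ q).+1)%N.
Proof.
move=> q0 caq; rewrite -size_filter -(size_map (fun n => n %/ q)%N) -[X in (_ <= X)%N](size_iota 0).
apply: uniq_leq_size.
  rewrite map_inj_in_uniq ?filter_uniq ?iota_uniq// => m n.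
  rewrite !mem_filter => /andP[hm _] /andP[hn _] e.
  have : (q%:Z %| a * (m%:Z - n%:Z))%Z.
    have -> : a * (m%:Z - n%:Z) = (a * m%:Z - b) - (a * n%:Z - b) by ring.
    by rewrite rpredB.
  rewrite Gauss_dvdzr; last by rewrite coprimez_sym.
  rewrite -eqz_mod_dvd => /eqP; rewrite !modz_nat => -[mn].
  by rewrite (divn_eq m q) (divn_eq n q) e mn.
move=> z /mapP[n]; rewrite mem_filter !mem_iota => /andP[_ nN] ->{z}.
by rewrite /= add0n ltnS leq_div2r//; lia.
Qed.

Lemma count_multiples_zrange (d l : nat) : (0 < d)%N ->
  (count (fun b : int => (d%:Z %| b)%Z) (zrange l) <= (2 * (l %/ d)).+1)%N.
Proof.
move=> d0; rewrite -size_filter -(size_map (fun b => (b %/ d%:Z)%Z)) -(size_zrange (l %/ d)).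
apply: uniq_leq_size.
  rewrite map_inj_in_uniq ?filter_uniq ?zrange_uniq// => m n.
  rewrite !mem_filter => /andP[hm _] /andP[hn _] e.
  by rewrite -(divzK hm) -(divzK hn) e.
move=> z /mapP[b]; rewrite mem_filter !mem_zrange => /andP[/dvdzP[k ->] kl] ->{z}.
rewrite mulzK; last by lia.
have : (`|k| * d <= l)%N by move: kl; rewrite normrM; lia.
by rewrite -leq_divRL//; lia.
Qed.

(** As [d] divides [q], the congruence modulo [q] descends to [d] and transfers divisibility from
    [Q] to [b]. This leaves [2 (l / d) + 1] values of [b], each with at most [N / q + 1] values [n],
    and each [n] has multiplicity at most [B]. *)
Lemma box_tail (q l d B : nat) (a : int) : (0 < q)%N -> (0 < d)%N -> (d %| q)%N -> coprimez a q%:Z ->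
  (forall n, (0 < n < N)%N -> (box_count n <= B)%N) ->
  0 <= \sum_(xy <- box) w (Q xy.1 xy.2)%:~R *
      (((d%:Z %| Q xy.1 xy.2)%Z)%:R * (short_count q l (a * Q xy.1 xy.2))%:R)
   <= 2 * C 1 * B%:R * ((2 * (l %/ d)).+1 * (N %/ q).+1)%N%:R.
Proof.
move=> q0 d0 dq caq hB; apply/andP; split.
  by apply: sumr_ge0 => xy _; rewrite mulr_ge0 ?(weight_ge0 hw)// mulr_ge0.
have X_gt0 : 0 < X by exact: lt_trans X_gt1.
have C0 : 0 <= C 1 by apply: (weight_C_ge0 X_gt0 hw).
rewrite (box_level_sum (fun n => ((d%:Z %| n)%Z)%:R * (short_count q l (a * n))%:R)).
have w0 : w 0%:R = 0.
  by apply: (weight_eq0 hw); apply/negP => /andP[h0 _]; move: X_gt0; rewrite ltNge h0.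
apply: (@le_trans _ _ (\sum_(n < N) 2 * C 1 * B%:R *
   (((d%:Z %| (n : nat)%:Z)%Z)%:R * (short_count q l (a * (n : nat)%:Z))%:R))).
  apply: ler_sum => -[n nN] _ /=; case: n nN => [|n] nN.
    by rewrite w0 !mul0r !mulr_ge0.
  rewrite mulrAC; apply: ler_wpM2r; first by rewrite mulr_ge0.
  by apply: ler_pM => //; rewrite ?(weight_ge0 hw) ?(weight_le X_gt0 hw)// ler_nat hB.
rewrite -mulr_sumr ler_wpM2l ?mulr_ge0//.
under eq_bigr do rewrite -natrM.
rewrite -natr_sum ler_nat.
rewrite -(big_mkord xpredT (fun n => (d%:Z %| n%:Z)%Z * short_count q l (a * n%:Z)%R)%N).
have -> : index_iota 0 N = iota 0 N by rewrite /index_iota subn0.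
apply: (@leq_trans (\sum_(n <- iota 0 N) \sum_(b <- zrange l | (d%:Z %| b)%Z) (q%:Z %| (a * n%:Z - b)%R)%Z)%N).
  apply: leq_sum => n _; case: (boolP (d%:Z %| n%:Z)%Z) => dn; last by rewrite mul0n.
  rewrite mul1n /short_count -sum1_count big_mkcond [X in (_ <= X)%N]big_mkcond /=.
  apply: leq_sum => b _; case: (boolP (q%:Z %| a * n%:Z - b)%Z) => qb //.
  have db : (d%:Z %| b)%Z.
    have -> : b = a * n%:Z - (a * n%:Z - b) by ring.
    apply: rpredB; first by rewrite dvdz_mull.
    by apply: dvdz_trans qb.
  by rewrite db.
rewrite exchange_big /=.
apply: (@leq_trans (\sum_(b <- zrange l | (d%:Z %| b)%Z) (N %/ q).+1)%N).
  apply: leq_sum => b _; apply: leq_trans (count_class_nat b q0 caq).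
  by rewrite -sum1_count [X in (_ <= X)%N]big_mkcond /=; apply: leq_sum => n _; case: ifP.
rewrite big_const_seq iter_addn_0 mulnC leq_mul2r count_multiples_zrange// orbT.
Qed.

Lemma box_classes (d : nat) (g : int -> R) : (0 < d)%N ->
  \sum_(xy <- box) w (Q xy.1 xy.2)%:~R * (((d%:Z %| Q xy.1 xy.2)%Z)%:R * g (Q xy.1 xy.2)) =
  \sum_(u < d) \sum_(v < d) ((d%:Z %| Q (u : nat)%:Z (v : nat)%:Z)%Z)%:R *
    \sum_(k < (2 * M).+1) \sum_(m < (2 * M).+1)
      (fun x y => w (Q x y)%:~R * g (Q x y))
        ((u : nat)%:Z - d%:Z * M%:Z + d%:Z * (k : nat)%:Z) ((v : nat)%:Z - d%:Z * M%:Z + d%:Z * (m : nat)%:Z).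
Proof.
move=> d0.
have dE (z z' : int) : (d%:Z %| z - z')%Z -> (d%:Z %| z)%Z = (d%:Z %| z')%Z.
  by move=> h; rewrite -(subrK z' z) rpredDl.
have w0 x y : ~~ ((`|x| <= M%:Z) && (`|y| <= M%:Z)) -> w (Q x y)%:~R = 0.
  exact: (weight_bqf_eq0 a1_gt0 Delta_gt0 hw N_gt M_a M_c).
pose F (x y : int) : R := w (Q x y)%:~R * (((d%:Z %| Q x y)%Z)%:R * g (Q x y)).
rewrite big_allpairs /= -/(F _ _).
rewrite (@sum_zrange_classes R d M (fun x => \sum_(y <- zrange M) F x y))//; last first.
  by move=> x xM; rewrite big1// => y _; rewrite /F w0 ?mul0r// leNgt xM.
transitivity (\sum_(u < d) \sum_(k < (2 * M).+1) \sum_(v < d) \sum_(m < (2 * M).+1)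
   F ((u : nat)%:Z - d%:Z * M%:Z + d%:Z * (k : nat)%:Z) ((v : nat)%:Z - d%:Z * M%:Z + d%:Z * (m : nat)%:Z)).
  apply: eq_bigr => u _; apply: eq_bigr => k _.
  rewrite (@sum_zrange_classes R d M (fun y => F _ y))// => y yM.
  by rewrite /F w0 ?mul0r//; apply/negP => /andP[_]; rewrite leNgt yM.
apply: eq_bigr => u _; rewrite exchange_big /=; apply: eq_bigr => v _.
rewrite mulr_sumr; apply: eq_bigr => k _; rewrite mulr_sumr; apply: eq_bigr => m _.
rewrite /F; set x := _ + d%:Z * _; set y := _ + d%:Z * _.
rewrite (dE (Q x y) (Q (u : nat)%:Z (v : nat)%:Z)); first by ring.
have -> : Q x y - Q (u : nat)%:Z (v : nat)%:Z =
  (x - (u : nat)%:Z) * (a1 * (x + (u : nat)%:Z) + b1 * y) + (y - (v : nat)%:Z) * (b1 * (u : nat)%:Z + c1 * (y + (v : nat)%:Z)).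
  by rewrite /Q /bqf; ring.
have ex : x - (u : nat)%:Z = d%:Z * ((k : nat)%:Z - M%:Z) by rewrite /x; ring.
have ey : y - (v : nat)%:Z = d%:Z * ((m : nat)%:Z - M%:Z) by rewrite /y; ring.
by rewrite ex ey rpredD// !dvdz_mulr.
Qed.

End Box_sum.

Lemma harmonic_sum_mono (R : realType) (m n : nat) : (m <= n)%N -> harmonic_sum R m <= harmonic_sum R n.
Proof.
move=> mn; rewrite /harmonic_sum; have [m1|m1] := leqP m 1.
  by rewrite big_geq// sumr_ge0// => k _; rewrite invr_ge0.
rewrite (big_cat_nat (n := m) (ltnW m1) mn) /= lerDl sumr_ge0// => k _.
Qed.

Section Sieve.
Variables (R : realType) (a1 b1 c1 : int) (X : R) (C : nat -> R) (w : R -> R).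
Hypotheses (a1_gt0 : 0 < a1) (c1_gt0 : 0 < c1) (Delta_gt0 : 0 < bqf_Delta a1 b1 c1).
Hypotheses (X_gt1 : 1 < X) (hw : weight X C w).
Variables (N M : nat).
Hypotheses (N_gt : 2 * X < N%:R) (M_gt0 : (0 < M)%N)
  (M_a : 4 * a1 * N%:Z <= M%:Z ^+ 2) (M_c : 4 * c1 * N%:Z <= M%:Z ^+ 2).
Variables (q l D T B : nat) (a : int).
Let Q := bqf a1 b1 c1.
Let K := (2 * M).+1.
Let J := (bqf_height a1 b1 c1 * D ^ 2 * K)%N.
Let box := [seq (x, y) | x <- zrange M, y <- zrange M].
Hypotheses (q_gt0 : (0 < q)%N) (q_coprime : coprimez (2 * bqf_Delta a1 b1 c1 * a) q%:Z).
Hypotheses (D_gt0 : (0 < D)%N) (K_le : (K <= q)%N)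
  (T_bound : forall k, (0 < k < q * J)%N -> (size (divisors k) <= T)%N)
  (B_bound : forall n, (0 < n < N)%N -> (box_count a1 b1 c1 M n <= B)%N).

Let X_gt0 : 0 < X. Proof. exact: lt_trans X_gt1. Qed.
Let C1_ge0 : 0 <= C 1. Proof. exact: (weight_C_ge0 X_gt0 hw). Qed.
Let C2_ge0 : 0 <= C 2. Proof. exact: (weight_C_ge0 X_gt0 hw). Qed.

Lemma coprimez_unit_a : coprimez a q%:Z.
Proof. by move: q_coprime; rewrite coprimezMl => /andP[]. Qed.

Lemma prime_divisor_odd_ndvd (p : nat) : p \in primes q ->
  [/\ prime p, odd p & ~~ (p%:Z %| bqf_Delta a1 b1 c1)%Z].
Proof.
rewrite mem_primes => /and3P[pp _ pq].
have p2D : ~~ (p%:Z %| 2 * bqf_Delta a1 b1 c1)%Z.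
  apply/negP => h; move: q_coprime; rewrite coprimezMl => /andP[+ _].
  rewrite /coprimez => /eqP g1.
  have : (p%:Z %| gcdz (2 * bqf_Delta a1 b1 c1) q%:Z)%Z by rewrite dvdz_gcd h dvdzE.
  by rewrite g1 dvdzE dvdn1 => /eqP /= p1; move: pp; rewrite p1.
split=> //.
  case: (even_prime pp) => // p2; move: p2D; rewrite p2 dvdz_mulr//.
by apply: contra p2D => h; rewrite dvdz_mull.
Qed.

(** The area of the ellipse [Q <= 1]. *)
Definition class_constant : R := 2 * pi / Num.sqrt (bqf_Delta a1 b1 c1)%:~R.
Definition local_density : R := \prod_(p <- primes q) (1 - (rho a1 b1 c1 p)%:R / p%:R ^+ 2).

(** [Z] is the proportion of residues modulo [q] hit by the short interval. [V] is the mixed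
    variation of the weight, [E1] the contribution of the nonzero frequencies and [E2] the lattice
    point error, the first two taken at the largest small modulus [D]. *)
Let Z : R := (2 * l%:R + 1) / q%:R.
Let I : R := \int[lebesgue_measure]_(x in `[0, +oo[) w x.
Let V : R := K%:R ^+ 2 * (D%:R ^+ 2 * (mixed_constant C a1 b1 c1 / X)).
Let E1 : R := V * (8 * K%:R * harmonic_sum R q + 4 * T%:R * (1 + 4 * harmonic_sum R q) *
      (2 * l%:R + 1 + 2 * J%:R * harmonic_sum R J)).
Let E2 : R := N%:R * (C 1 / X) * ((4 + 4 * Num.sqrt a1%:~R) * Num.sqrt N%:R * 2 + 9).
Let sifted (d : nat) : R := \sum_(xy <- box) w (Q xy.1 xy.2)%:~R *
      (((d%:Z %| Q xy.1 xy.2)%Z)%:R * (short_count q l (a * Q xy.1 xy.2))%:R).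

Let q0R : 0 < q%:R :> R. Proof. by rewrite ltr0n. Qed.
Let Z_ge0 : 0 <= Z. Proof. by rewrite divr_ge0// addr_ge0// mulr_ge0. Qed.
Let I_ge0 : 0 <= I. Proof. by apply: Rintegral_ge0 => x _; exact: (weight_ge0 hw). Qed.
Let kap_ge0 : 0 <= class_constant.
Proof. by rewrite divr_ge0 ?sqrtr_ge0// mulr_ge0 ?pi_ge0. Qed.
Let mc_ge0 : 0 <= mixed_constant C a1 b1 c1 / X.
Proof.
rewrite divr_ge0 ?(ltW X_gt0)// /mixed_constant addr_ge0 ?mulr_ge0//.
by rewrite addr_ge0// ler0z ltW.
Qed.
Let V_ge0 : 0 <= V.
Proof. by apply: mulr_ge0; [exact: exprn_ge0|apply: mulr_ge0 => //; exact: exprn_ge0]. Qed.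

Let E1_ge0 : 0 <= E1.
Proof.
have h1 := harmonic_sum_ge0 R q; have h2 := harmonic_sum_ge0 R J.
move: V_ge0 (ler0n R K) (ler0n R T) (ler0n R l) (ler0n R J); rewrite /E1.
move: V (harmonic_sum R q) (harmonic_sum R J) (K%:R) (T%:R) (l%:R) (J%:R) h1 h2 => V' h h' k t l' j *.
by rewrite !(mulr_ge0, addr_ge0).
Qed.
Let E2_ge0 : 0 <= E2.
Proof.
have cX : 0 <= C 1 / X by rewrite divr_ge0// ltW.
have s1 : 0 <= Num.sqrt a1%:~R :> R by exact: sqrtr_ge0.
have s2 : 0 <= Num.sqrt N%:R :> R by exact: sqrtr_ge0.
apply: mulr_ge0; first exact: mulr_ge0.
by apply: addr_ge0 => //; do 2!apply: mulr_ge0 => //; apply: addr_ge0 => //; exact: mulr_ge0.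
Qed.

Lemma coprime_box_sum :
  \sum_(xy <- box) w (Q xy.1 xy.2)%:~R *
    ((coprimez (Q xy.1 xy.2) q%:Z)%:R * (short_count q l (a * Q xy.1 xy.2))%:R) =
  \sum_(A <- sublists (primes q)) (-1) ^+ size A * sifted (\prod_(p <- A) p)%N.
Proof.
transitivity (\sum_(xy <- box) \sum_(A <- sublists (primes q)) (-1) ^+ size A *
   (w (Q xy.1 xy.2)%:~R * ((\prod_(p <- A) ((p%:Z %| Q xy.1 xy.2)%Z)%:R) * (short_count q l (a * Q xy.1 xy.2))%:R))).
  apply: eq_bigr => xy _; rewrite coprime_prod_primes// prod_1B_sublists mulr_suml mulr_sumr.
  by apply: eq_bigr => A _; ring.
rewrite exchange_big /= big_seq [RHS]big_seq; apply: eq_bigr => A /sublists_subseq sA.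
rewrite -mulr_sumr; congr (_ * _); apply: eq_bigr => xy _.
rewrite prod_dvdz_indicator//; first by apply: subseq_uniq sA (primes_uniq _).
by apply/allP => p /(mem_subseq sA); rewrite mem_primes => /and3P[].
Qed.

(** There are at most [d ^ 2] classes modulo [d] on which [d] divides [Q]. On each, equidistribution
    replaces the count of [b] by [Z], and the remaining weighted sum is the ellipse count; both
    errors are bounded by their values at [D]. *)
Lemma sifted_small (d : nat) : (0 < d)%N -> (d <= D)%N ->
  `|sifted d - Z * class_constant * I * ((rho a1 b1 c1 d)%:R / d%:R ^+ 2)| <= D%:R ^+ 2 * (E1 + Z * E2).
Proof.
move=> d0 dD.
have d0R : 0 < d%:R :> R by rewrite ltr0n.
rewrite /sifted (box_classes (C := C) (X := X) (N := N) a1_gt0 Delta_gt0 hw N_gt M_gt0 M_a M_c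
  (fun z => (short_count q l (a * z))%:R) d0).
have -> : (rho a1 b1 c1 d)%:R = \sum_(u < d) \sum_(v < d) ((d%:Z %| Q (u : nat)%:Z (v : nat)%:Z)%Z)%:R :> R.
  by rewrite /rho natr_sum; apply: eq_bigr => u _; rewrite natr_sum.
set c := Z * class_constant * I / d%:R ^+ 2.
have -> : Z * class_constant * I * ((\sum_(u < d) \sum_(v < d) ((d%:Z %| Q (u : nat)%:Z (v : nat)%:Z)%Z)%:R) / d%:R ^+ 2)
  = \sum_(u < d) \sum_(v < d) ((d%:Z %| Q (u : nat)%:Z (v : nat)%:Z)%Z)%:R * c.
  rewrite mulrA mulrAC -/c mulrC mulr_suml; apply: eq_bigr => u _.
  by rewrite mulr_suml.
have EE : 0 <= E1 + Z * E2 by apply: addr_ge0 => //; apply: mulr_ge0.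
apply: (@le_trans _ _ (\sum_(u < d) \sum_(v < d) (E1 + Z * E2))); last first.
  rewrite !sumr_const !card_ord -[_ *+ d]mulr_natl -[(E1 + _) *+ d]mulr_natl mulrA -expr2.
  by rewrite ler_wpM2r// lerXn2r ?nnegrE// ler_nat.
rewrite -sumrB; apply: le_trans (ler_norm_sum _ _ _) _; apply: ler_sum => u _.
rewrite -sumrB; apply: le_trans (ler_norm_sum _ _ _) _; apply: ler_sum => v _.
rewrite -mulrBr normrM.
set S := \sum_(k < _) _.
suff h : `|S - c| <= E1 + Z * E2.
  by case: (d%:Z %| _)%Z; rewrite ?normr1 ?mul1r ?normr0 ?mul0r.
have ud : 0 <= (u : nat)%:Z < d%:Z by rewrite ltz_nat ltn_ord.
have vd : 0 <= (v : nat)%:Z < d%:Z by rewrite ltz_nat ltn_ord.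
have Jd : (bqf_height a1 b1 c1 * d ^ 2 * K <= J)%N by rewrite leq_mul// leq_mul// leq_exp2r.
have Td k : (0 < k < q * (bqf_height a1 b1 c1 * d ^ 2 * K))%N -> (size (divisors k) <= T)%N.
  move=> /andP[k0 k1]; apply: T_bound; rewrite k0 /=; apply: leq_trans k1 _.
  by rewrite leq_mul2l Jd orbT.
have e1 := @class_equidistribution R a1 b1 c1 Delta_gt0 q l d K T a
  ((u : nat)%:Z - d%:Z * M%:Z) ((v : nat)%:Z - d%:Z * M%:Z) _ _ q_gt0 d0 coprimez_unit_a K_le Td
  (class_edge_left a1_gt0 Delta_gt0 hw N_gt M_gt0 M_a M_c (v : nat)%:Z d0 ud)
  (class_edge_right a1_gt0 Delta_gt0 hw N_gt M_gt0 M_a M_c (u : nat)%:Z d0 vd)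
  (class_variation a1_gt0 c1_gt0 Delta_gt0 X_gt1 hw M d (u : nat)%:Z (v : nat)%:Z).
have e2 := class_weight_sum a1_gt0 c1_gt0 Delta_gt0 X_gt1 hw N_gt M_gt0 M_a M_c d0 ud vd.
move: e2 e1; rewrite -/K -/Z -/I -/E2.
set SW := \sum_(k < K) _; set kd := 2 * pi / _ => e2 e1.
have cE : c = Z * (kd * I).
  by rewrite /c /kd /class_constant [(_ * d%:R ^+ 2)^-1]invfM; ring.
have -> : S - c = (S - Z * SW) + Z * (SW - kd * I) by rewrite cE; ring.
apply: le_trans (ler_normD _ _) _; apply: lerD; last first.
  by rewrite normrM (ger0_norm Z_ge0); apply: ler_wpM2l.
apply: le_trans e1 _.
have H0 n : 0 <= harmonic_sum R n by exact: harmonic_sum_ge0.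
apply: ler_pM.
- by apply: mulr_ge0; [exact: exprn_ge0|apply: mulr_ge0 => //; exact: exprn_ge0].
- by rewrite ?addr_ge0 ?mulr_ge0 ?addr_ge0 ?mulr_ge0.
- by rewrite ler_wpM2l ?exprn_ge0// ler_wpM2r// lerXn2r ?nnegrE// ler_nat.
rewrite lerD2l ler_wpM2l ?mulr_ge0 ?addr_ge0 ?mulr_ge0// lerD2l.
by apply: ler_pM; rewrite ?mulr_ge0 ?harmonic_sum_mono// ler_wpM2l// ler_nat.
Qed.

Let E3 : R := 2 * C 1 * B%:R * ((2 * (l %/ D)).+1 * (N %/ q).+1)%N%:R.

(** From [rho p <= 2 p] and multiplicativity; hence the density [rho d / d ^ 2] decays like [1 / d]
    up to a divisor-type factor. *)
Lemma rho_prod_le (A : seq nat) : subseq A (primes q) ->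
  (rho a1 b1 c1 (\prod_(p <- A) p) <= 2 ^ size (primes q) * \prod_(p <- A) p)%N.
Proof.
move=> sA.
have uA : uniq A by apply: subseq_uniq sA (primes_uniq _).
have pA : all prime A by apply/allP => p /(mem_subseq sA); rewrite mem_primes => /and3P[].
rewrite rho_prod//; apply: (@leq_trans (\prod_(p <- A) (2 * p))%N).
  rewrite big_seq [X in (_ <= X)%N]big_seq; apply: leq_prod => p /(mem_subseq sA) /prime_divisor_odd_ndvd[h1 h2 h3].
  by apply: leq_trans (rho_le h1 h2 h3) (leq_pred _).
rewrite big_split /= big_const_seq count_predT iter_muln_1 leq_mul2r.
by rewrite leq_exp2l// size_subseq// orbT.
Qed.

(** No cancellation is sought: the sifted sum and its expected value are each small, the first by
    divisibility of [b], the second by the decay of [rho d / d ^ 2]. *)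
Lemma sifted_large (A : seq nat) : subseq A (primes q) -> (D < \prod_(p <- A) p)%N ->
  `|sifted (\prod_(p <- A) p)%N - Z * class_constant * I *
      ((rho a1 b1 c1 (\prod_(p <- A) p))%:R / (\prod_(p <- A) p)%N%:R ^+ 2)| <=
  E3 + Z * class_constant * I * ((2 ^ size (primes q))%N%:R / D%:R).
Proof.
move=> sA; have := rho_prod_le sA; set d := (\prod_(p <- A) p)%N => rd Dd.
have uA : uniq A by apply: subseq_uniq sA (primes_uniq _).
have pA : all prime A by apply/allP => p /(mem_subseq sA); rewrite mem_primes => /and3P[].
have d0 : (0 < d)%N by apply: leq_trans Dd.
have d0R : 0 < d%:R :> R by rewrite ltr0n.
have dq : (d %| q)%N.
  apply: prod_primes_dvdn => // p /(mem_subseq sA).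
  by rewrite mem_primes => /and3P[].
have /andP[s0 s1] : 0 <= sifted d <= E3.
  have := @box_tail R a1 b1 c1 X C w a1_gt0 c1_gt0 Delta_gt0 X_gt1 hw N M N_gt M_gt0 M_a M_c q l d B a q_gt0 d0 dq coprimez_unit_a B_bound.
  rewrite -/(sifted d) => /andP[-> /le_trans]; apply.
  rewrite ler_wpM2l ?mulr_ge0// ler_nat leq_mul2r ltnS leq_mul2l.
  by rewrite leq_div2l ?orbT// ltnW.
have m0 : 0 <= Z * class_constant * I by do 2!apply: mulr_ge0 => //.
apply: le_trans (ler_normB _ _) _; rewrite (ger0_norm s0); apply: lerD => //.
rewrite ger0_norm; last by rewrite mulr_ge0// divr_ge0// exprn_ge0.
rewrite ler_wpM2l// ler_pdivrMr ?exprn_gt0//.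
apply: (@le_trans _ _ ((2 ^ size (primes q))%N%:R * d%:R)); first by rewrite -natrM ler_nat.
rewrite -mulrA ler_wpM2l// expr2 mulrA ler_peMl ?(ltW d0R)//.
by rewrite mulrC ler_pdivlMr ?ltr0n// mul1r ler_nat ltnW.
Qed.

Lemma sieve_estimate :
  `| \sum_(xy <- box) w (Q xy.1 xy.2)%:~R *
      ((coprimez (Q xy.1 xy.2) q%:Z)%:R * (short_count q l (a * Q xy.1 xy.2))%:R)
    - Z * class_constant * I * local_density | <=
  (2 ^ size (primes q))%N%:R *
    (D%:R ^+ 2 * (E1 + Z * E2) + (E3 + Z * class_constant * I * ((2 ^ size (primes q))%N%:R / D%:R))).
Proof.
rewrite coprime_box_sum /local_density prod_1B_sublists mulr_sumr -sumrB.
apply: le_trans (ler_norm_sum _ _ _) _.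
set E := D%:R ^+ 2 * _ + _.
apply: (@le_trans _ _ (\sum_(A <- sublists (primes q)) E)); last first.
  by rewrite big_const_seq count_predT iter_addr_0 size_sublists -[_ *+ _]mulr_natl.
rewrite big_seq [X in _ <= X]big_seq; apply: ler_sum => A /sublists_subseq sA.
have uA : uniq A by apply: subseq_uniq sA (primes_uniq _).
have pA : all prime A by apply/allP => p /(mem_subseq sA); rewrite mem_primes => /and3P[].
have -> : \prod_(p <- A) ((rho a1 b1 c1 p)%:R / p%:R ^+ 2) =
   (rho a1 b1 c1 (\prod_(p <- A) p))%:R / (\prod_(p <- A) p)%N%:R ^+ 2 :> R.
  rewrite rho_prod// !natr_prod -prodrXl -prodf_div.
  by [].
rewrite mulrCA -mulrBr normrM normrX normrN1 expr1n mul1r.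
have d0 : (0 < \prod_(p <- A) p)%N by rewrite big_seq prodn_cond_gt0// => p pp; apply/prime_gt0/(allP pA).
have m0 : 0 <= E3 + Z * class_constant * I * ((2 ^ size (primes q))%N%:R / D%:R).
  apply: addr_ge0; first by do 3!apply: mulr_ge0 => //.
  by apply: mulr_ge0; [do 2!apply: mulr_ge0 => //|exact: divr_ge0].
have m1 : 0 <= D%:R ^+ 2 * (E1 + Z * E2).
  by apply: mulr_ge0; rewrite ?exprn_ge0//; apply: addr_ge0 => //; apply: mulr_ge0.
have [dD|dD] := leqP (\prod_(p <- A) p) D.
  by apply: le_trans (sifted_small d0 dD) _; rewrite lerDl.
by apply: le_trans (sifted_large sA dD) _; rewrite lerDr.
Qed.

End Sieve.

(** * Power bounds *)

Section Powbound.
Variable R : realType.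
Implicit Types (f g : nat -> R) (e s : R).

(** The relation [f = O(q ^ e)] with the constant hidden, so that products of bounds become sums of
    exponents. It concerns functions of [q] alone, hence estimates built from it are uniform in [a]
    and [w]. *)
Definition powbound f e : Prop :=
  exists2 c : R, 0 <= c & \forall q \near \oo, 0 <= f q <= c * q%:R `^ e.

Lemma powbound_le f g e : (\forall q \near \oo, 0 <= f q <= g q) -> powbound g e -> powbound f e.
Proof.
move=> fg [c c0 gc]; exists c => //; apply: filterS2 fg gc => q /andP[-> fg] /andP[_].
exact: le_trans.
Qed.

Lemma powboundW f e e' : powbound f e -> e <= e' -> powbound f e'.
Proof.
move=> [c c0 fc] ee; exists c => //; apply: filterS2 fc (nbhs_infty_ge 1) => q /andP[-> h] q1.
by apply: le_trans h _; rewrite ler_wpM2l// ler_powR// ler1n.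
Qed.

Lemma powboundM f g e e' : powbound f e -> powbound g e' -> powbound (fun q => f q * g q) (e + e').
Proof.
move=> [c c0 fc] [d d0 gd]; exists (c * d); first exact: mulr_ge0.
apply: filterS3 fc gd (nbhs_infty_ge 1) => q /andP[f0 fq] /andP[g0 gq] q1.
rewrite mulr_ge0//= powRD; last by rewrite pnatr_eq0 -lt0n q1 implybT.
by rewrite mulrACA; apply: ler_pM.
Qed.

Lemma powboundD f g e : powbound f e -> powbound g e -> powbound (fun q => f q + g q) e.
Proof.
move=> [c c0 fc] [d d0 gd]; exists (c + d); first exact: addr_ge0.
apply: filterS2 fc gd => q /andP[f0 fq] /andP[g0 gq].
by rewrite addr_ge0//= mulrDl lerD.
Qed.

Lemma powbound_cst (c : R) : 0 <= c -> powbound (fun=> c) 0.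
Proof. by move=> c0; exists c => //; near=> q; rewrite c0 powRr0 mulr1 lexx. Unshelve. all: by end_near. Qed.

Lemma powboundZ (c : R) f e : 0 <= c -> powbound f e -> powbound (fun q => c * f q) e.
Proof. by move=> /powbound_cst hc hf; have := powboundM hc hf; rewrite add0r. Qed.

Lemma powbound_pow e : powbound (fun q => q%:R `^ e) e.
Proof. by exists 1 => //; near=> q; rewrite powR_ge0 mul1r lexx. Unshelve. all: by end_near. Qed.

Lemma powbound_natr : powbound (fun q => q%:R) 1.
Proof. by apply: powbound_le (powbound_pow 1); near=> q; rewrite powRr1// ler0n lexx. Unshelve. all: by end_near. Qed.

Lemma powbound_powR f e s : 0 <= s -> powbound f e -> powbound (fun q => f q `^ s) (e * s).
Proof.
move=> s0 [c c0 fc]; exists (c `^ s); first exact: powR_ge0.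
apply: filterS fc => q /andP[f0 fq]; rewrite powR_ge0/=.
rewrite powRrM -powRM ?powR_ge0//; apply: ge0_ler_powR => //.
by rewrite nnegrE mulr_ge0// powR_ge0.
Qed.

Lemma powbound_sqrt f e : powbound f e -> powbound (fun q => Num.sqrt (f q)) (e / 2).
Proof.
move=> hf; have [c c0 fc] := hf; apply: powbound_le (powbound_powR (_ : 0 <= 2^-1) hf) => //.
by apply: filterS fc => q /andP[f0 _]; rewrite powR12_sqrt// sqrtr_ge0 lexx.
Qed.

Lemma powbound_truncn f e : powbound f e -> powbound (fun q => (Num.truncn (f q))%:R) e.
Proof.
move=> hf; apply: powbound_le (hf); have [c c0] := hf.
by apply: filterS => q /andP[f0 _]; rewrite ler0n/= truncn_le.
Qed.

Lemma powbound_truncnS f e : 0 <= e -> powbound f e -> powbound (fun q => (Num.truncn (f q)).+1%:R) e.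
Proof.
move=> e0 hf; have := powboundD (powboundW (powbound_cst ler01) e0) (powbound_truncn hf).
by apply: powbound_le; near=> q; rewrite ler0n/= addrC natr1.
Unshelve. all: by end_near. Qed.

(** Uses [ln x <= x ^ u / u] with [u = s / e']; enlarging [e] to [e' >= 1] makes the division
    legitimate. *)
Lemma powbound_ln (f : nat -> nat) e s : 0 < s -> powbound (fun q => (f q)%:R) e ->
  powbound (fun q => ln (f q)%:R) s.
Proof.
move=> s0 hf.
pose e' := Num.max 1 e.
have e'0 : 0 < e' by rewrite lt_max ltr01.
have hf' : powbound (fun q => (f q)%:R) e' by apply: powboundW hf _; rewrite le_max lexx orbT.
pose u := s / e'; have u0 : 0 < u by rewrite divr_gt0.
have ui : 0 <= u^-1 by rewrite invr_ge0 ltW.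
have := powboundZ ui (powbound_powR (ltW u0) hf').
have -> : e' * u = s by rewrite /u mulrCA divff ?mulr1 ?gt_eqF.
apply: powbound_le; near=> q.
case: (f q) => [|n]; first by rewrite ln0// lexx mulr_ge0// powR_ge0.
rewrite ln_ge0 ?ler1n//=.
have -> : ln n.+1%:R = u^-1 * ln (n.+1%:R `^ u) :> R by rewrite ln_powR mulKf// gt_eqF.
rewrite ler_wpM2l// ltW//; apply: lt_le_trans (ln_sublinear _) _; first by rewrite powR_gt0.
by [].
Unshelve. all: by end_near. Qed.

Lemma powbound_harmonic (f : nat -> nat) e s : 0 < s -> powbound (fun q => (f q)%:R) e ->
  powbound (fun q => harmonic_sum R (f q)) s.
Proof.
move=> s0 hf; have := powboundD (powboundW (powbound_cst ler01) (ltW s0)) (powbound_ln s0 hf).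
apply: powbound_le; near=> q; rewrite harmonic_sum_ge0/=.
case: (f q) => [|n]; last exact: harmonic_sum_le.
by rewrite /harmonic_sum big_geq// ln0// addr0.
Unshelve. all: by end_near. Qed.

Lemma powbound_divisors (f : nat -> nat) e s : 0 < s -> powbound (fun q => (f q)%:R) e ->
  exists2 T : nat -> nat, powbound (fun q => (T q)%:R) s &
    forall q k, (0 < k <= f q)%N -> (size (divisors k) <= T q)%N.
Proof.
move=> s0 hf.
pose e' := Num.max 1 e.
have e'0 : 0 < e' by rewrite lt_max ltr01.
have hf' : powbound (fun q => (f q)%:R) e' by apply: powboundW hf _; rewrite le_max lexx orbT.
pose u := s / e'; have u0 : 0 < u by rewrite divr_gt0.
have eu : e' * u = s by rewrite /u mulrCA divff ?mulr1 ?gt_eqF.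
have [c c1 hc] := size_divisors_bound u0.
have c0 : 0 <= c by apply: le_trans c1.
exists (fun q => Num.truncn (c * (f q)%:R `^ u)).
  by apply: powbound_truncn; rewrite -eu; apply: powboundZ => //; apply: powbound_powR => //; exact: ltW.
move=> q k /andP[k0 kf]; rewrite truncn_ge_nat; last by rewrite mulr_ge0// powR_ge0.
apply: le_trans (hc k k0) _; rewrite ler_wpM2l//.
by apply: ge0_ler_powR; rewrite ?nnegrE ?ler_nat ?(ltW u0).
Qed.

Lemma near_powR_ge e (A : R) : 0 < e -> \forall q \near \oo, A <= q%:R `^ e.
Proof.
move=> e0; have ei : e^-1 * e = 1 by rewrite mulVf ?gt_eqF.
apply: filterS (nbhs_infty_ger (Num.max 0 A `^ e^-1)) => q h.
have A0 : 0 <= Num.max 0 A by rewrite le_max lexx.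
apply: (@le_trans _ _ (Num.max 0 A)); first by rewrite le_max lexx orbT.
have -> : Num.max 0 A = (Num.max 0 A `^ e^-1) `^ e by rewrite -powRrM ei powRr1.
by apply: ge0_ler_powR => //; rewrite ?nnegrE ?powR_ge0// ltW.
Qed.

Lemma powbound_lt f e e' (h : R) : e < e' -> 0 < h -> powbound f e ->
  \forall q \near \oo, f q <= h * q%:R `^ e'.
Proof.
move=> ee h0 [c c0 fc]; have ee' : 0 < e' - e by rewrite subr_gt0.
apply: filterS3 fc (near_powR_ge (c / h) ee') (nbhs_infty_ge 1) => q /andP[_ fq] ch q1.
apply: le_trans fq _; rewrite -[e'](subrK e) powRD; last by rewrite pnatr_eq0 -lt0n q1 implybT.
by rewrite mulrA ler_wpM2r ?powR_ge0// mulrC -ler_pdivrMr.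
Qed.

End Powbound.

(** * Main term and error term *)

Section Weight_integral.
Variables (R : realType) (X : R) (C : nat -> R) (w : R -> R) (N : nat).
Hypotheses (X_gt0 : 0 < X) (hw : weight X C w) (N_gt : 2 * X < N%:R).
Let I : R := \int[lebesgue_measure]_(x in `[0, +oo[) w x.

Lemma weight_integral_le : I <= N%:R * (2 * C 1) + N%:R * (C 1 / X).
Proof.
have := weight_integral_sum X_gt0 hw N_gt; rewrite -/I ler_norml => /andP[_].
have : \sum_(n < N) w n%:R <= N%:R * (2 * C 1).
  apply: (@le_trans _ _ (\sum_(n < N) (2 * C 1))); last by rewrite sumr_const card_ord -[_ *+ N]mulr_natl.
  by apply: ler_sum => n _; exact: weight_le X_gt0 hw _.
by move=> h1 h2; rewrite -[leLHS](subrK (\sum_(n < N) w n%:R)) addrC; exact: lerD.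
Qed.

(** The plateau where [w = 1] has length [X / 2], hence contains at least [X / 2 - 1] integers. *)
Lemma weight_integral_ge : X / 2 - 1 - N%:R * (C 1 / X) <= I.
Proof.
have := weight_integral_sum X_gt0 hw N_gt; rewrite -/I ler_norml => /andP[+ _].
have : X / 2 - 1 <= \sum_(n < N) w n%:R.
  have le57 : 5 * X / 4 <= 7 * X / 4 by have := X_gt0; lra.
  have /(count_integers le57) : forall k : int, 5 * X / 4 <= k%:~R <= 7 * X / 4 -> 0 <= k < N%:Z.
    move=> k /andP[k1 k2]; rewrite -(ler_int R) -(ltr_int R).
    have h1 := X_gt0; have h2 := N_gt; rewrite -[(Posz N)%:~R]/(N%:R : R).
    by apply/andP; split; lra.
  rewrite ler_norml => /andP[+ _].
  have : \sum_(k < N) (5 * X / 4 <= k%:R <= 7 * X / 4)%R%:R <= \sum_(n < N) w n%:R :> R.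
    apply: ler_sum => n _; case: (boolP (5 * X / 4 <= n%:R <= 7 * X / 4)%R) => h; last exact: weight_ge0 hw _.
    by case: hw => _ _ _ w1 _; rewrite w1.
  by move: (\sum_(n < N) _) (\sum_(n < N) _) => u v; lra.
by move: (\sum_(n < N) _) (N%:R * _) => u v; lra.
Qed.

End Weight_integral.

Section Density.
Variables (R : realType) (a1 b1 c1 : int) (q : nat) (a : int).
Hypothesis q_coprime : coprimez (2 * bqf_Delta a1 b1 c1 * a) q%:Z.

(** The bound [rho p <= 2 p - 1] is exactly what turns the lower bound into a perfect square:
    [1 - (2 p - 1) / p ^ 2 = (1 - 1 / p) ^ 2]. *)
Lemma local_factor_bounds (p : nat) : p \in primes q ->
  (1 - p%:R^-1) ^+ 2 <= (1 - (rho a1 b1 c1 p)%:R / p%:R ^+ 2 : R) <= 1.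
Proof.
move=> /(prime_divisor_odd_ndvd q_coprime)[pp po pD].
have p0 : 0 < p%:R :> R by rewrite ltr0n prime_gt0.
have rp : (rho a1 b1 c1 p)%:R <= 2 * p%:R - 1 :> R.
  have := rho_le pp po pD; rewrite -(ler_nat R) => /le_trans; apply.
  have -> : (2 * p).-1%:R = (2 * p)%:R - 1 :> R by rewrite -[in RHS](@prednK (2 * p)) ?muln_gt0 ?prime_gt0// -natr1 addrK.
  by rewrite natrM.
apply/andP; split; last by rewrite lerBlDr lerDl divr_ge0// exprn_ge0.
have -> : (1 - p%:R^-1) ^+ 2 = 1 - (2 * p%:R - 1) / p%:R ^+ 2 :> R by field; rewrite gt_eqF.
by rewrite lerD2l lerN2 ler_wpM2r// invr_ge0 exprn_ge0.
Qed.

Lemma local_density_bounds :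
  (\prod_(p <- primes q) (1 - p%:R^-1 : R)) ^+ 2 <= local_density R a1 b1 c1 q <= 1.
Proof.
rewrite /local_density; apply/andP; split.
  rewrite -prodrXl big_seq [X in _ <= X]big_seq; apply: ler_prod => p /local_factor_bounds /andP[h _].
  by rewrite exprn_even_ge0.
rewrite big_seq; apply: prodr_ile1 => p /local_factor_bounds /andP[h ->].
by rewrite andbT (le_trans _ h)// exprn_even_ge0.
Qed.

(** Distributing [totient q / q] as the product of [1 - 1 / p] over the Gauss sum factors turns each
    into [1 - rho p / p ^ 2], so the complex main term is real. *)
Lemma main_termE (beta : R) (w : R -> R) : (0 < q)%N ->
  main_term a1 b1 c1 beta q w =
  (2 * Lq beta q / q%:R * class_constant R a1 b1 c1 *
    (\int[lebesgue_measure]_(x in `[0, +oo[) w x) * local_density R a1 b1 c1 q)%:C.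
Proof.
move=> q0; rewrite /main_term; set I := \int[_]_(x in _) _.
have qR : q%:R != 0 :> R by rewrite pnatr_eq0 -lt0n.
have tq : (totient q)%:R / q%:R = \prod_(p <- primes q) (1 - p%:R^-1) :> R.
  have qE : q%:R = \prod_(p <- primes q) (p ^ logn p q)%N%:R :> R.
    by rewrite {1}(prod_prime_decomp q0) prime_decompE big_map natr_prod.
  rewrite qE totientE// natr_prod -prodf_div.
  rewrite big_seq [RHS]big_seq; apply: eq_bigr => p pq; have := pq; rewrite mem_primes => /and3P[pp _ pdq].
  have p0 : p%:R != 0 :> R by rewrite pnatr_eq0 -lt0n prime_gt0.
  have lp : (0 < logn p q)%N by rewrite logn_gt0.
  rewrite -{2}(prednK lp) expnS !natrM.
  have -> : p.-1%:R = p%:R - 1 :> R by rewrite -[in RHS](@prednK p) ?prime_gt0// -natr1 addrK.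
  by field; rewrite p0 natrX expf_neq0.
have key : ((totient q)%:R / q%:R : R)%:C * \prod_(p <- primes q) (1 - GQ R a1 b1 c1 p 1 / p%:R ^+ 2) =
   (local_density R a1 b1 c1 q)%:C.
  rewrite tq /local_density !rmorph_prod -big_split /= big_seq [RHS]big_seq.
  apply: eq_bigr => p /(prime_divisor_odd_ndvd q_coprime)[pp po pD].
  rewrite mulrC !rmorphB !rmorph1 /= !fmorphV !rmorphM !fmorphV rmorphXn /= !rmorph_nat.
  exact: GQ_rho.
have -> : (4 * pi * (totient q)%:R * Lq beta q / (Num.sqrt (bqf_Delta a1 b1 c1)%:~R * q%:R ^+ 2))%:C =
  (2 * Lq beta q / q%:R * class_constant R a1 b1 c1)%:C * ((totient q)%:R / q%:R : R)%:C :> R[i].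
  rewrite -rmorphM /= /class_constant; congr (_%:C).
  by rewrite [(_ * q%:R ^+ 2)^-1]invfM; move: (Num.sqrt _)^-1 => r; field.
by rewrite -[X in X * _ = _]mulrA key -!rmorphM /= mulrAC.
Qed.

End Density.

(** * Choice of the parameters and size of the error term *)

Section Asymptotic.
Variables (R : realType) (a1 b1 c1 : int) (C : nat -> R) (beta s : R).
Hypotheses (a1_gt0 : 0 < a1) (c1_gt0 : 0 < c1) (Delta_gt0 : 0 < bqf_Delta a1 b1 c1).
Hypotheses (C1_ge0 : 0 <= C 1) (C2_ge0 : 0 <= C 2).
Hypotheses (beta_ge : 2 / 5 <= beta) (beta_lt1 : beta < 1) (s_gt0 : 0 < s) (s_le : s <= 1 / 1000).

(** [Nf] is the first integer past the support of the weight, [Mf] a half-side for which the box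
    contains the ellipse [Q <= Nf], and [Df] the cutoff between small and large divisors. *)
Let Nf (q : nat) : nat := (Num.truncn (2 * Xq beta q)).+1.
Let Mf (q : nat) : nat := (Num.truncn (Num.sqrt (4 * (a1 + c1)%:~R * (Nf q)%:R : R))).+1.
Let Kf (q : nat) : nat := (2 * Mf q).+1.
Let Df (q : nat) : nat := (Num.truncn (q%:R `^ (10 * s) : R)).+1.
Let Jf (q : nat) : nat := (bqf_height a1 b1 c1 * Df q ^ 2 * Kf q)%N.
Let lf (q : nat) : nat := Num.truncn (Lq beta q).
Let om (q : nat) : R := (2 ^ size (primes q))%N%:R.
Let Zf (q : nat) : R := (2 * (lf q)%:R + 1) / q%:R.
Let If (q : nat) : R := (Nf q)%:R * (2 * C 1) + (Nf q)%:R * (C 1 / Xq beta q).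
Let kap : R := class_constant R a1 b1 c1.

Let beta_ge0 : 0 <= beta. Proof. by have := beta_ge; lra. Qed.
Let beta1_ge0 : 0 <= beta + 1. Proof. by have := beta_ge; lra. Qed.
Let beta2_ge0 : 0 <= (beta + 1) / 2. Proof. by have := beta_ge; lra. Qed.
Let ac_gt0 : 0 <= 4 * (a1 + c1)%:~R :> R.
Proof. by rewrite mulr_ge0// ler0z addr_ge0 ?ltW. Qed.
Let kap_ge0 : 0 <= kap.
Proof. by rewrite divr_ge0 ?sqrtr_ge0// mulr_ge0 ?pi_ge0. Qed.

Let hcst (c e : R) : 0 <= c -> 0 <= e -> powbound (fun=> c) e.
Proof. by move=> c0 e0; exact: powboundW (powbound_cst c0) e0. Qed.

Let hL : powbound (Lq beta) beta. Proof. exact: powbound_pow. Qed.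

Let hq : powbound (fun q => q%:R : R) 1.
Proof. exact: powbound_natr. Qed.

Let hqi : powbound (fun q => q%:R^-1 : R) (-1).
Proof. by apply: powbound_le (powbound_pow (-1)); near=> q; rewrite powR_inv1// invr_ge0 ler0n lexx. Unshelve. all: by end_near. Qed.

Let hX : powbound (Xq beta) (beta + 1). Proof. exact: powboundM hL hq. Qed.

Let hXi : powbound (fun q => (Xq beta q)^-1) (- beta - 1).
Proof.
apply: powbound_le (powboundM (powbound_pow (- beta)) hqi); near=> q.
rewrite invr_ge0 mulr_ge0 ?powR_ge0//=.
by rewrite /Xq /Lq invfM -powRN.
Unshelve. all: by end_near. Qed.

Let hN : powbound (fun q => (Nf q)%:R : R) (beta + 1).
Proof. by apply: powbound_truncnS => //; exact: powboundZ hX. Qed.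

Let hNX : powbound (fun q => (Nf q)%:R * (C 1 / Xq beta q)) 0.
Proof. by apply: powboundW (powboundM hN (powboundZ C1_ge0 hXi)) _; lra. Qed.

Let hM : powbound (fun q => (Mf q)%:R : R) ((beta + 1) / 2).
Proof. by apply: powbound_truncnS => //; apply: powbound_sqrt; exact: powboundZ hN. Qed.

Let hK : powbound (fun q => (Kf q)%:R : R) ((beta + 1) / 2).
Proof.
have h : powbound (fun q => 1 + 2 * (Mf q)%:R : R) ((beta + 1) / 2).
  by apply: powboundD; [exact: hcst|exact: powboundZ hM].
by apply: powbound_le h; near=> q; rewrite ler0n /Kf -natr1 natrM addrC lexx.
Unshelve. all: by end_near. Qed.

Let hD : powbound (fun q => (Df q)%:R : R) (10 * s).
Proof. by apply: powbound_truncnS; [have := s_gt0; lra|exact: powbound_pow]. Qed.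

Let hDi : powbound (fun q => (Df q)%:R^-1 : R) (- (10 * s)).
Proof.
apply: powbound_le (powbound_pow _); apply: filterS (nbhs_infty_ge 1) => q q1.
rewrite invr_ge0 ler0n /= powRN lef_pV2 ?posrE ?ltr0n ?powR_gt0 ?ltr0n//.
by rewrite ltW// truncnS_gt.
Qed.

Let hJ : powbound (fun q => (Jf q)%:R : R) (20 * s + (beta + 1) / 2).
Proof.
have h := powboundM (powboundZ (ler0n R (bqf_height a1 b1 c1)) (powboundM hD hD)) hK.
apply: powbound_le (powboundW h _); last by lra.
by near=> q; rewrite ler0n /Jf !natrM lexx.
Unshelve. all: by end_near. Qed.

Let hH : powbound (fun q => harmonic_sum R q) s.
Proof. exact: (powbound_harmonic (f := id) s_gt0 hq). Qed.

Let hHJ : powbound (fun q => harmonic_sum R (Jf q)) s.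
Proof. exact: powbound_harmonic s_gt0 hJ. Qed.

Let hom : powbound om s.
Proof.
have [T hT bT] := @powbound_divisors R id 1 s s_gt0 hq.
apply: powbound_le hT; apply: filterS (nbhs_infty_ge 1) => q q1.
rewrite ler0n /= ler_nat; apply: leq_trans (expn2_size_primes q1) _.
by apply: bT; rewrite leqnn andbT.
Qed.

Let hl : powbound (fun q => 2 * (lf q)%:R + 1 : R) beta.
Proof.
apply: powboundD; last exact: hcst.
by apply: powboundZ => //; exact: powbound_truncn hL.
Qed.

Let hZ : powbound Zf (beta - 1). Proof. exact: powboundM hl hqi. Qed.

Let hI : powbound If (beta + 1).
Proof.
apply: powboundD; last exact: powboundW hNX _.
by apply: powboundW (powboundM hN (powbound_cst (_ : 0 <= 2 * C 1))) _; rewrite ?addr0//; exact: mulr_ge0.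
Qed.

Let hT : exists2 T : nat -> nat, powbound (fun q => (T q)%:R : R) s &
  forall q k, (0 < k < q * Jf q)%N -> (size (divisors k) <= T q)%N.
Proof.
have h : powbound (fun q => (q * Jf q)%N%:R : R) (1 + (20 * s + (beta + 1) / 2)).
  by apply: powbound_le (powboundM hq hJ); near=> q; rewrite ler0n natrM lexx.
have [T hT bT] := powbound_divisors s_gt0 h; exists T => // q k /andP[k0 kJ].
by apply: bT; rewrite k0 ltnW.
Unshelve. all: by end_near. Qed.

Let hB : exists2 B : nat -> nat, powbound (fun q => (B q)%:R : R) (2 * s) &
  forall q n, (0 < n < Nf q)%N -> (box_count a1 b1 c1 (Mf q) n <= B q)%N.
Proof.
have h : powbound (fun q => (4 * `|a1| * Nf q)%N%:R : R) (beta + 1).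
  by apply: powbound_le (powboundZ (ler0n R (4 * `|a1|)) hN); near=> q; rewrite ler0n natrM lexx.
have [T hT' bT] := powbound_divisors s_gt0 h.
pose c := (2 * (8 * `|bqf_Delta a1 b1 c1|).+1)%N.
exists (fun q => T q ^ 2 * c)%N.
  have h2 := powboundM (powboundM hT' hT') (powbound_cst (ler0n R c)).
  apply: powbound_le (powboundW h2 _); last by lra.
  by near=> q; rewrite ler0n !natrM lexx.
move=> q n /andP[n0 nN]; apply: leq_trans (@box_count_le a1 b1 c1 a1_gt0 Delta_gt0 (Mf q) n n0) _.
rewrite leq_mul2r leq_exp2r// bT ?orbT// !muln_gt0 n0 /= leq_mul2l (ltnW nN) orbT !andbT.
by rewrite absz_gt0 gt_eqF.
Unshelve. all: by end_near. Qed.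

(** The parameters are inserted into the sieve estimate. The spare [5 s] in the exponent is left to
    absorb the iterated logarithms of the main term. *)
Lemma SQ_asymptotic : exists2 c : R, 0 <= c & \forall q \near \oo, forall (a : int) (w : R -> R),
  coprimez (2 * bqf_Delta a1 b1 c1 * a) q%:Z -> weight (Xq beta q) C w ->
  `|SQ a1 b1 c1 beta q a w - 2 * Lq beta q / q%:R * kap *
     (\int[lebesgue_measure]_(x in `[0, +oo[) w x) * local_density R a1 b1 c1 q|
  <= c * q%:R `^ (2 * beta - 5 * s).
Proof.
have [T hT1 bT] := hT; have [B hB1 bB] := hB.
have hX1 : \forall q \near \oo, 1 < Xq beta q.
  apply: filterS (nbhs_infty_ge 2) => q q2.
  have q1 : 1 <= q%:R :> R by rewrite ler1n ltnW.
  have L1 : 1 <= Lq beta q by rewrite /Lq -[leLHS](powRr0 (q%:R : R)) ler_powR.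
  by apply: (@lt_le_trans _ _ q%:R); [rewrite ltr1n|rewrite /Xq ler_peMl].
have hKq : \forall q \near \oo, (Kf q <= q)%N.
  apply: filterS (powbound_lt (_ : (beta + 1) / 2 < 1) ltr01 hK) => [q|]; last by have := beta_lt1; lra.
  by rewrite powRr1// mul1r ler_nat.
pose V q : R := (Kf q)%:R ^+ 2 * ((Df q)%:R ^+ 2 * (mixed_constant C a1 b1 c1 / Xq beta q)).
pose E1 q : R := V q * (8 * (Kf q)%:R * harmonic_sum R q + 4 * (T q)%:R * (1 + 4 * harmonic_sum R q) *
      (2 * (lf q)%:R + 1 + 2 * (Jf q)%:R * harmonic_sum R (Jf q))).
pose E2 q : R := (Nf q)%:R * (C 1 / Xq beta q) * ((4 + 4 * Num.sqrt a1%:~R) * Num.sqrt (Nf q)%:R * 2 + 9).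
pose E3 q : R := 2 * C 1 * (B q)%:R * ((2 * (lf q %/ Df q)).+1 * (Nf q %/ q).+1)%N%:R.
(* The last summand pays for replacing the exact number [2 l + 1] of integers in the interval by
   [2 L]. *)
pose Er q : R := om q * ((Df q)%:R ^+ 2 * (E1 q + Zf q * E2 q) +
    (E3 q + Zf q * kap * If q * (om q / (Df q)%:R))) + q%:R^-1 * kap * If q.
have mc0 : 0 <= mixed_constant C a1 b1 c1.
  by rewrite /mixed_constant addr_ge0 ?mulr_ge0// addr_ge0// ler0z ltW.
have bs := s_gt0; have bs' := s_le; have bb := beta_ge; have bb' := beta_lt1.
have hV : powbound V (20 * s).
  have h := powboundM (powboundM hK hK) (powboundM (powboundM hD hD) (powboundZ mc0 hXi)).
  by apply: powboundW h _; lra.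
have h1 : powbound (fun q => 8 * (Kf q)%:R * harmonic_sum R q) (22 * s + (beta + 1) / 2).
  by apply: powboundW (powboundM (powboundZ (ler0n R 8) hK) hH) _; lra.
have h2 : powbound (fun q => 1 + 4 * harmonic_sum R q) s.
  by apply: powboundD; [apply: hcst => //; lra|exact: powboundZ hH].
have h3 : powbound (fun q => 2 * (lf q)%:R + 1 + 2 * (Jf q)%:R * harmonic_sum R (Jf q)) (21 * s + (beta + 1) / 2).
  apply: powboundD; first by apply: powboundW hl _; lra.
  by apply: powboundW (powboundM (powboundZ (ler0n R 2) hJ) hHJ) _; lra.
have h4 := powboundM (powboundM (powboundZ (ler0n R 4) hT1) h2) h3.
have hE1 : powbound E1 (43 * s + (beta + 1) / 2).
  have h := powboundM hV (powboundD (powboundW h1 (_ : _ <= 23 * s + (beta + 1) / 2))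
                                    (powboundW h4 (_ : _ <= 23 * s + (beta + 1) / 2))).
  by apply: powboundW (h _ _) _; lra.
have hE2 : powbound E2 ((beta + 1) / 2).
  have sa : 0 <= 4 + 4 * Num.sqrt a1%:~R :> R by rewrite addr_ge0// mulr_ge0// sqrtr_ge0.
  have h5 : powbound (fun q => (4 + 4 * Num.sqrt a1%:~R) * Num.sqrt (Nf q)%:R * 2 + 9 : R) ((beta + 1) / 2).
    apply: powboundD; last by apply: hcst => //; lra.
    by apply: powboundW (powboundM (powboundZ sa (powbound_sqrt hN)) (powbound_cst (ler0n R 2))) _; lra.
  by apply: powboundW (powboundM hNX h5) _; lra.
(* The exponent collects [beta - 10 s] from the multiples of [d] in the short interval, [beta] from
   the integers below [N] in one class modulo [q], and [2 s] from the multiplicity. *)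
have hE3 : powbound E3 (2 * beta - 8 * s).
  have hlD : powbound (fun q => (2 * (lf q %/ Df q)).+1%:R : R) (beta - 10 * s).
    have h : powbound (fun q => 1 + 2 * (Lq beta q * (Df q)%:R^-1)) (beta - 10 * s).
      by apply: powboundD; [apply: hcst => //; lra|apply: powboundZ => //; exact: powboundM hL hDi].
    apply: powbound_le h; near=> q; rewrite ler0n /= -natr1 addrC lerD2l natrM ler_wpM2l//.
    rewrite ler_pdivlMr ?ltr0n// -natrM.
    apply: (@le_trans _ _ (lf q)%:R); first by rewrite ler_nat leq_divM.
    by rewrite truncn_le powR_ge0.
  have hNq : powbound (fun q => (Nf q %/ q).+1%:R : R) beta.
    have h : powbound (fun q => 1 + (Nf q)%:R * q%:R^-1 : R) beta.
      by apply: powboundD; [apply: hcst => //; lra|apply: powboundW (powboundM hN hqi) _; lra].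
    apply: powbound_le h; apply: filterS (nbhs_infty_ge 1) => q q1.
    rewrite ler0n /= -natr1 addrC lerD2l ler_pdivlMr ?ltr0n// -natrM ler_nat.
    exact: leq_divM.
  have h := powboundM (powboundZ (_ : 0 <= 2 * C 1) hB1) (powboundM hlD hNq).
  apply: powbound_le (powboundW (h _) _); [|exact: mulr_ge0|lra].
  by near=> q; rewrite /E3 natrM lexx andbT; do 3!apply: mulr_ge0 => //.
have hEr : powbound Er (2 * beta - 5 * s).
  apply: powboundD; last first.
    by apply: powboundW (powboundM (powboundM hqi (powbound_cst kap_ge0)) hI) _; lra.
  (* The power saving: [63 s + (beta + 1) / 2 <= 2 beta - 6 s] holds for [beta >= 2 / 5] and
     [s <= 1 / 1000]. *)
  have g1 : powbound (fun q => (Df q)%:R ^+ 2 * (E1 q + Zf q * E2 q)) (2 * beta - 6 * s).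
    have h := powboundM (powboundM hD hD) (powboundD hE1 (powboundW (powboundM hZ hE2) (_ : _ <= 43 * s + (beta + 1) / 2))).
    by apply: powboundW (h _) _; lra.
  have g2 : powbound (fun q => E3 q + Zf q * kap * If q * (om q / (Df q)%:R)) (2 * beta - 6 * s).
    apply: powboundD; first by apply: powboundW hE3 _; lra.
    by apply: powboundW (powboundM (powboundM (powboundM hZ (powbound_cst kap_ge0)) hI) (powboundM hom hDi)) _; lra.
  by apply: powboundW (powboundM hom (powboundD g1 g2)) _; lra.
have [c c0 hc] := hEr; exists c => //.
apply: filterS3 hc (filterI hX1 hKq) (nbhs_infty_ge 1) => q /andP[_ hq'] [X1 Kq] q1 a w caq hw.
apply: le_trans hq'.
have X0 : 0 < Xq beta q by exact: lt_trans X1.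
have N_gt : 2 * Xq beta q < (Nf q)%:R by exact: truncnS_gt.
have N0 : (0 < Nf q)%N by [].
have M_sq : 4 * (a1 + c1) * (Nf q)%:Z <= (Mf q)%:Z ^+ 2.
  rewrite -(ler_int R) [leRHS]rmorphXn !intrM /= -![(Posz _)%:~R]/(_%:R : R).
  set z := 4%:~R * _ * _.
  have z0 : 0 <= z by rewrite mulr_ge0.
  rewrite -[z]sqr_sqrtr// lerXn2r ?nnegrE ?sqrtr_ge0// ltW//.
  exact: truncnS_gt.
have M_a : 4 * a1 * (Nf q)%:Z <= (Mf q)%:Z ^+ 2.
  by apply: le_trans M_sq; rewrite ler_wpM2r// ler_wpM2l// lerDl ltW.
have M_c : 4 * c1 * (Nf q)%:Z <= (Mf q)%:Z ^+ 2.
  by apply: le_trans M_sq; rewrite ler_wpM2r// ler_wpM2l// lerDr ltW.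
have ca : coprimez a q%:Z by move: caq; rewrite coprimezMl => /andP[].
have main := @sieve_estimate R a1 b1 c1 (Xq beta q) C w a1_gt0 c1_gt0 Delta_gt0 X1 hw (Nf q) (Mf q)
  N_gt isT M_a M_c q (lf q) (Df q) (T q) (B q) a q1 caq isT Kq (bT q) (bB q).
rewrite (SQ_box (C := C) (X := Xq beta q) (N := Nf q) (M := Mf q) a1_gt0 c1_gt0 Delta_gt0 X1 hw N_gt isT M_a M_c)//.
move: main; rewrite -/kap -/(Zf q) -/(om q) -/(lf q).
set S := \sum_(xy <- _) _; set I := \int[_]_(x in _) _; set P := local_density _ _ _ _ _ => main.
have /andP[P0 P1] : 0 <= P <= 1.
  have /andP[h ->] := local_density_bounds R caq.
  by rewrite andbT (le_trans _ h)// exprn_even_ge0.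
have I0 : 0 <= I by apply: Rintegral_ge0 => x _; exact: weight_ge0 hw _.
have I1 : I <= If q by exact: weight_integral_le X0 hw N_gt.
have q0R : 0 < q%:R :> R by rewrite ltr0n.
have qi0 : 0 <= q%:R^-1 :> R by rewrite invr_ge0.
have -> : S - 2 * Lq beta q / q%:R * kap * I * P = (S - Zf q * kap * I * P) +
   (2 * (lf q)%:R + 1 - 2 * Lq beta q) * (q%:R^-1 * kap * I * P).
  by rewrite /Zf; ring.
have Z0 : 0 <= Zf q by rewrite mulr_ge0// addr_ge0// mulr_ge0.
apply: le_trans (ler_normD _ _) _; apply: lerD.
  apply: le_trans main _; rewrite ler_wpM2l// lerD2l lerD2l ler_wpM2r ?divr_ge0//.
  by rewrite ler_wpM2l// mulr_ge0.
rewrite normrM -[leRHS]mul1r; apply: ler_pM => //.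
  have L0 : 0 <= Lq beta q by exact: powR_ge0.
  have := truncn_itv L0; rewrite -/(lf q) -natr1 => /andP[l1 l2].
  by rewrite ler_norml; lra.
have qk : 0 <= q%:R^-1 * kap by rewrite mulr_ge0.
rewrite ger0_norm; last by do 2!apply: mulr_ge0 => //.
rewrite -mulrA ler_wpM2l//; apply: le_trans I1.
by rewrite ler_piMr.
Unshelve. all: by end_near. Qed.

End Asymptotic.

Lemma bqf_posdef_gt0 (R : realType) (a1 b1 c1 : int) : bqf_posdef R a1 b1 c1 ->
  [/\ 0 < a1, 0 < c1 & 0 < bqf_Delta a1 b1 c1].
Proof.
move=> hQ.
have a0 : 0 < a1.
  have := hQ 1 0; rewrite xpair_eqE oner_eq0 => /(_ isT).
  by rewrite /bqfR expr1n expr0n /= !mulr0 !addr0 mulr1 ltr0z.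
have c0 : 0 < c1.
  have := hQ 0 1; rewrite xpair_eqE oner_eq0 andbF => /(_ isT).
  by rewrite /bqfR expr1n expr0n /= !mulr0 mul0r !add0r mulr1 ltr0z.
split=> //.
(* At [(b1, - 2 a1)], where the derivative in [x] vanishes, the form takes the value
   [a1 * Delta]. *)
have := hQ b1%:~R (- (2 * a1%:~R)).
have a0' : a1%:~R != 0 :> R by rewrite intr_eq0 gt_eqF.
rewrite xpair_eqE oppr_eq0 mulf_eq0 pnatr_eq0 (negPf a0') andbF => /(_ isT).
have -> : bqfR a1 b1 c1 b1%:~R (- (2 * a1%:~R)) = (a1 * bqf_Delta a1 b1 c1)%:~R :> R.
  by rewrite /bqfR /bqf_Delta !(intrM, intrB, rmorphXn) /=; ring.
by rewrite ltr0z pmulr_rgt0.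
Qed.

Section Relative_error.
Variables (R : realType) (a1 b1 c1 : int) (C : nat -> R) (beta : R).
Hypotheses (a1_gt0 : 0 < a1) (c1_gt0 : 0 < c1) (Delta_gt0 : 0 < bqf_Delta a1 b1 c1).
Hypotheses (C1_ge0 : 0 <= C 1) (C2_ge0 : 0 <= C 2).
Hypotheses (beta_ge : 2 / 5 <= beta) (beta_lt1 : beta < 1).

Definition main_real (q : nat) (w : R -> R) : R :=
  2 * Lq beta q / q%:R * class_constant R a1 b1 c1 *
    (\int[lebesgue_measure]_(x in `[0, +oo[) w x) * local_density R a1 b1 c1 q.

Let kap_gt0 : 0 < class_constant R a1 b1 c1.
Proof. by rewrite divr_gt0 ?mulr_gt0 ?pi_gt0// sqrtr_gt0 ltr0z. Qed.

Let LX (q : nat) (u k : R) : (0 < q)%N -> 2 * Lq beta q / q%:R * k * (u * Xq beta q) = 2 * k * u * q%:R `^ (2 * beta).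
Proof.
move=> q0; have q1 : q%:R != 0 :> R by rewrite pnatr_eq0 -lt0n.
have -> : q%:R `^ (2 * beta) = Lq beta q * Lq beta q.
  by rewrite /Lq -powRD ?q1 ?implybT//; congr (_ `^ _); ring.
by rewrite /Xq; field.
Qed.

(** The integral has order [X = L q], so the main term without its density has order [L ^ 2]. The
    density is at most 1 and at least the square of a Mertens product. *)
Lemma main_real_bounds : exists k k' : R, [/\ 0 < k, 0 < k' &
  \forall q \near \oo, forall (a : int) (w : R -> R),
  coprimez (2 * bqf_Delta a1 b1 c1 * a) q%:Z -> weight (Xq beta q) C w ->
  [/\ 0 < ln (ln q%:R) :> R, k * (q%:R `^ (2 * beta) / ln (ln q%:R) ^+ 2) <= main_real q w
    & main_real q w <= k' * q%:R `^ (2 * beta)]].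
Proof.
set kap := class_constant R a1 b1 c1.
have [c c0 [q0 hq0]] := prod_1Bprimes_inv_ge R.
(* The [9] comes from [N <= 3 X]: the bounds [2 C 1] and [C 1 / X] on the integral give
   [6 C 1 X + 3 C 1]. The [+ 1] keeps [k'] positive when [C 1 = 0]. *)
exists (kap / 2 * c ^+ 2), (2 * kap * (9 * C 1 + 1)); split.
- by apply: mulr_gt0; [exact: divr_gt0|exact: exprn_gt0].
- by apply: mulr_gt0; [exact: mulr_gt0|rewrite ltr_wpDl// mulr_ge0].
(* Large enough for [X / 2 - 1 - 3 C 1 >= X / 4], which bounds the integral from below. *)
have b0 := beta_ge; have Xbig : \forall q \near \oo, 4 + 16 * C 1 <= Xq beta q.
  have e0 : 0 < beta + 1 by lra.
  apply: filterS2 (near_powR_ge (4 + 16 * C 1) e0) (nbhs_infty_ge 1) => q + q1.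
  rewrite powRD; last by rewrite pnatr_eq0 -lt0n q1 implybT.
  by rewrite powRr1.
apply: filterS3 (nbhs_infty_ge q0) (nbhs_infty_ge 1) Xbig => q qq0 q1 X1 a w caq hw.
have [ll0 hP] := hq0 q qq0.
have X0 : 0 < Xq beta q by have := C1_ge0; lra.
have N_gt : 2 * Xq beta q < (Num.truncn (2 * Xq beta q)).+1%:R by exact: truncnS_gt.
have NX : (Num.truncn (2 * Xq beta q)).+1%:R <= 3 * Xq beta q.
  rewrite -natr1; have : (Num.truncn (2 * Xq beta q))%:R <= 2 * Xq beta q by rewrite truncn_le mulr_ge0// ltW.
  by have := C1_ge0; lra.
have NC : (Num.truncn (2 * Xq beta q)).+1%:R * (C 1 / Xq beta q) <= 3 * C 1.
  by rewrite mulrCA [leRHS]mulrC ler_wpM2l// ler_pdivrMr.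
split=> //.
  have := weight_integral_ge X0 hw N_gt; set I := \int[_]_(x in _) _ => Ige.
  have I4 : 4^-1 * Xq beta q <= I.
    apply: le_trans Ige.
    by have := C1_ge0; have := NC; lra.
  have /andP[hd _] := local_density_bounds R caq.
  have P2 : (c / ln (ln q%:R)) ^+ 2 <= local_density R a1 b1 c1 q.
    by apply: le_trans hd; rewrite lerXn2r ?nnegrE// ?(le_trans _ hP)// divr_ge0// ltW.
  rewrite /main_real -/I.
  have -> : kap / 2 * c ^+ 2 * (q%:R `^ (2 * beta) / ln (ln q%:R) ^+ 2) =
    2 * Lq beta q / q%:R * kap * (4^-1 * Xq beta q) * (c / ln (ln q%:R)) ^+ 2.
    by rewrite LX//; field; rewrite gt_eqF.
  have L0 : 0 <= 2 * Lq beta q / q%:R * kap.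
    by rewrite mulr_ge0 ?(ltW kap_gt0)// divr_ge0// mulr_ge0// powR_ge0.
  apply: ler_pM => //; last by rewrite ler_wpM2l.
    by rewrite mulr_ge0// mulr_ge0// ltW.
  by rewrite exprn_even_ge0.
have := weight_integral_le X0 hw N_gt; set I := \int[_]_(x in _) _ => Ile.
have I0 : 0 <= I by apply: Rintegral_ge0 => x _; exact: weight_ge0 hw _.
have I9 : I <= (9 * C 1 + 1) * Xq beta q.
  apply: le_trans Ile _.
  have e1 : (Num.truncn (2 * Xq beta q)).+1%:R * (2 * C 1) <= 3 * Xq beta q * (2 * C 1).
    by rewrite ler_wpM2r// mulr_ge0.
  have e3 : 3 * C 1 <= 3 * C 1 * Xq beta q by rewrite ler_peMr ?mulr_ge0//; have := C1_ge0; lra.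
  apply: le_trans (lerD e1 NC) _.
  have -> : (9 * C 1 + 1) * Xq beta q = 3 * Xq beta q * (2 * C 1) + 3 * C 1 * Xq beta q + Xq beta q by ring.
  by lra.
have /andP[hd P1] := local_density_bounds R caq.
have P0 : 0 <= local_density R a1 b1 c1 q by apply: le_trans hd; rewrite exprn_even_ge0.
have L0 : 0 <= 2 * Lq beta q / q%:R * kap.
  by rewrite mulr_ge0 ?(ltW kap_gt0)// divr_ge0// mulr_ge0// powR_ge0.
rewrite /main_real -/I -/kap -LX//.
apply: (@le_trans _ _ (2 * Lq beta q / q%:R * kap * I)); first by rewrite ler_piMr// mulr_ge0.
by rewrite ler_wpM2l.
Qed.

(** The error saves [q ^ (5 s)], whereas the density costs only [(ln (ln q)) ^ 2 <= (ln q) ^ 2],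
    which is bounded by a multiple of [q ^ (2 s)]. *)
Lemma SQ_relative_error (delta : R) : 0 < delta -> \forall q \near \oo, forall (a : int) (w : R -> R),
  coprimez (2 * bqf_Delta a1 b1 c1 * a) q%:Z -> weight (Xq beta q) C w ->
  0 < main_real q w /\ `|SQ a1 b1 c1 beta q a w - main_real q w| <= delta * main_real q w.
Proof.
move=> d0.
have [s s0 s1] : exists2 s : R, 0 < s & s <= 1 / 1000 by exists (1 / 1000); lra.
have [c c0 hc] := SQ_asymptotic a1_gt0 c1_gt0 Delta_gt0 C1_ge0 C2_ge0 beta_ge beta_lt1 s0 s1.
have [k [k' [k0 k'0 hk]]] := main_real_bounds.
have hq : powbound (fun q => q%:R : R) 1.
  exact: powbound_natr.
have hln : powbound (fun q => ln q%:R : R) s := powbound_ln (f := id) s0 hq.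
have hc2 := powboundZ c0 (powboundM hln hln).
have s5 : s + s < 5 * s by lra.
have hlog := powbound_lt s5 (mulr_gt0 d0 k0) hc2.
apply: filterS3 (filterI hc hk) hlog (nbhs_infty_ge 1) => q [hcq hkq] hlq q1 a w caq hw.
have [ll0 mge _] := hkq a w caq hw.
have qb : 0 < q%:R `^ (2 * beta) :> R by rewrite powR_gt0// ltr0n.
have m0 : 0 < main_real q w.
  by apply: lt_le_trans mge; rewrite mulr_gt0// divr_gt0// exprn_gt0.
split=> //; apply: le_trans (hcq a w caq hw) _.
apply: (@le_trans _ _ (delta * (k * (q%:R `^ (2 * beta) / ln (ln q%:R) ^+ 2)))); last first.
  by rewrite ler_wpM2l// ltW.
have l0 : 0 < ln q%:R :> R.
  by rewrite ltNge; apply/negP => h; move: ll0; rewrite ln0// ltxx.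
have lll : ln (ln q%:R) <= ln q%:R :> R by apply: ltW; exact: ln_sublinear.
rewrite !mulrA ler_pdivlMr ?exprn_gt0//.
have -> : q%:R `^ (2 * beta) = q%:R `^ (2 * beta - 5 * s) * q%:R `^ (5 * s) :> R.
  by rewrite -powRD ?subrK// pnatr_eq0 -lt0n q1 implybT.
rewrite [leLHS]mulrAC [leRHS]mulrCA [leRHS]mulrC [leLHS]mulrC mulrC.
rewrite ler_wpM2r ?powR_ge0//; apply: le_trans hlq; rewrite ler_wpM2l// -expr2.
by rewrite lerXn2r ?nnegrE// ltW.
Unshelve. all: by end_near. Qed.

End Relative_error.

Theorem theorem4 (R : realType) (a1 b1 c1 : int) (eps beta : R) (C : nat -> R)
    (hQ : bqf_posdef R a1 b1 c1) (heps : 0 < eps)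
    (hbeta : 2 / 5 + 3 * eps <= beta) (hbeta1 : beta < 1) :
  (forall delta : R, 0 < delta ->
     exists q0 : nat, forall (q : nat) (a : int) (w : R -> R),
       (q0 <= q)%N ->
       coprimez (2 * bqf_Delta a1 b1 c1 * a) q%:Z ->
       weight (Xq beta q) C w ->
       exists2 eta : R[i], `|eta| <= delta%:C &
         (SQ a1 b1 c1 beta q a w)%:C = main_term a1 b1 c1 beta q w * (1 + eta))
  /\
  (exists k1 k2 : R, 0 < k1 /\ 0 < k2 /\
     exists q0 : nat, forall (q : nat) (a : int) (w : R -> R),
       (q0 <= q)%N ->
       coprimez (2 * bqf_Delta a1 b1 c1 * a) q%:Z ->
       weight (Xq beta q) C w ->
       k1 * (q%:R `^ (2 * beta) / ln (ln q%:R) ^+ 2) <= SQ a1 b1 c1 beta q a w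
         <= k2 * q%:R `^ (2 * beta)).
Proof.
have [a1_gt0 c1_gt0 Delta_gt0] := bqf_posdef_gt0 hQ.
have beta_ge : 2 / 5 <= beta by lra.
have Xpos (q : nat) : (1 <= q)%N -> 0 < Xq beta q.
  by move=> q1; rewrite mulr_gt0 ?powR_gt0 ?ltr0n.
(* A negative [C 1] or [C 2] admits no weight at all, so both claims are then vacuous for
   [q >= 1]. *)
have [/andP[C1 C2]|CN] := boolP ((0 <= C 1) && (0 <= C 2)); last first.
  have vac (q : nat) w : (1 <= q)%N -> weight (Xq beta q) C w -> False.
    move=> q1 hw; move/negP: CN; apply.
    by rewrite !(weight_C_ge0 (Xpos q q1) hw).
  split=> [delta d0|]; first by exists 1%N => q a w q1 _ /(vac q w q1).
  by exists 1, 1; split=> //; split=> //; exists 1%N => q a w q1 _ /(vac q w q1).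
have rel := SQ_relative_error a1_gt0 c1_gt0 Delta_gt0 C1 C2 beta_ge hbeta1.
split=> [delta d0|].
  have [q0 _ h] := filterI (rel _ d0) (nbhs_infty_ge 1).
  exists q0 => q a w qq0 caq hw.
  have [hq q1] := h q qq0; have [m0 hm] := hq a w caq hw.
  (* The relative error is the real number [S / m - 1], which makes sense because the main term is
     positive. *)
  exists (SQ a1 b1 c1 beta q a w / main_real a1 b1 c1 beta q w - 1)%:C.
    rewrite normc_def /= expr0n /= addr0 sqrtr_sqr lecR.
    set S := SQ _ _ _ _ _ _ _; set m := main_real _ _ _ _ _ _ in m0 hm *.
    have -> : S / m - 1 = (S - m) / m by field; rewrite gt_eqF.
    by rewrite normrM normfV (gtr0_norm m0) ler_pdivrMr.
  rewrite (main_termE caq)// -[X in X%:C * _]/(main_real a1 b1 c1 beta q w).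
  set z := _ / _ - 1.
  have -> : 1 + z%:C = (1 + z)%:C :> R[i] by rewrite [RHS]rmorphD rmorph1.
  rewrite -rmorphM /= /z; congr (_%:C).
  by field; rewrite gt_eqF.
have [k [k' [k0 k'0 hk]]] := main_real_bounds Delta_gt0 C1 beta_ge.
(* The asymptotic with relative error [1/2] transfers the bounds on the main term to the sum. *)
exists (k / 2), (3 / 2 * k'); rewrite divr_gt0// mulr_gt0//; split=> //; split=> //.
have h2 : 0 < 2^-1 :> R by rewrite invr_gt0.
have [q0 _ h] := filterI (rel _ h2) hk.
exists q0 => q a w qq0 caq hw.
have [hq hkq] := h q qq0; have [m0] := hq a w caq hw; have [_ m1 m2] := hkq a w caq hw.
rewrite ler_norml => /andP[e1 e2].
have -> : k / 2 * (q%:R `^ (2 * beta) / ln (ln q%:R) ^+ 2) = 2^-1 * (k * (q%:R `^ (2 * beta) / ln (ln q%:R) ^+ 2)) by ring.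
move: m1 m2 e1 e2 m0; rewrite -[3 / 2 * k' * _]mulrA; set A := k * _; set B := k' * _; set S := SQ _ _ _ _ _ _ _; set m := main_real _ _ _ _ _ _.
by move=> m1 m2 e1 e2 m0; apply/andP; split; lra.
Qed.
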